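(* Let $A$ and $B$ be algebras provided with systems $E$ and $F$ respectively. Let ${}_fm_e$ and ${}_en_f$ ($e\in E$, $f\in F$) be non negative integers, let $$M=\bigoplus_{e\in E,f\in F}{}_fm_e\,(Bf\otimes eA),\qquad N=\bigoplus_{e\in E,f\in F}{}_en_f\,(Ae\otimes fB)$$ be the corresponding projective bimodules and let $\Lambda=\begin{pmatrix} A & N \\ M & B \end{pmatrix}$ be the corresponding null-square projective algebra. Suppose there are no efficient cycles in the Peirce $E\cup F$-quiver $Q_{E\cup F}$ of $\Lambda$. Then there exists a positive integer $h$ such that for $n\geq h$ $$\mathsf{HH}^n(\Lambda)=\mathsf{HH}^n(A)\oplus\mathsf{HH}^n(B).$$
   Context: $k$ is a field; algebras are nonzero associative unital $k$-algebras, not necessarily finite dimensional; $\otimes=\otimes_k$; $\mathsf{HH}^n(\Lambda)=\mathsf{Ext}^n_{\Lambda\otimes\Lambda^{op}}(\Lambda,\Lambda)$. Equality of cohomology spaces means isomorphism of vector spaces. A system of an algebra is a finite set of orthogonal idempotents (not necessarily primitive) whose sum is $1$. The notation ${}_fm_e(Bf\otimes eA)$ means the direct sum of ${}_fm_e$ copies of the projective $B$-$A$-bimodule $Bf\otimes eA$. The null-square algebra $\begin{pmatrix} A & N \\ M & B \end{pmatrix}$ has matrix multiplication given by the bimodule structures, with all products $mn$ and $nm$ ($m\in M$, $n\in N$) equal to zero. The Peirce $E$-quiver $Q_E$ of $A$ has set of vertices $E$, and for $x\ne y\in E$ there is one arrow from $x$ to $y$ exactly when $yAx\neq0$ (no loops);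 similarly for the Peirce $F$-quiver $Q_F$ of $B$. The quiver $Q_{E\cup F}$ has set of vertices the disjoint union $E\cup F$; it is the disjoint union of $Q_E$ and $Q_F$ together with vertical arrows: one arrow from $e\in E$ to $f\in F$ if ${}_fm_e\neq0$, and one arrow from $f\in F$ to $e\in E$ if ${}_en_f\neq0$. An efficient path of $Q_{E\cup F}$ is an oriented path which does not contain two successive arrows of $Q_E$, nor two successive arrows of $Q_F$. An efficient cycle is an efficient path of positive length whose source and target coincide. *)

(* Defs.v *)
From HB Require Import structures.
From mathcomp Require Import all_boot all_algebra.
From mathcomp Require Import finmap boolp functions freeg.

Set Implicit Arguments.
Unset Strict Implicit.
Unset Printing Implicit Defensive.

Import GRing.Theory.
Local Open Scope ring_scope.
Local Open Scope quotient_scope.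

Section FreeModule.
Variables (R : nzRingType) (K : choiceType).

Lemma freegUZ (c a : R) (x : K) : c *: << a *g x >> = << (c * a) *g x >>.
Proof. by apply/eqP/freeg_eqP => y; rewrite coeffZ !coeffU mulrA. Qed.

Variables (M : lmodType R) (f : K -> M).

Fact fglift_is_linear : linear (fglift f : {freeg K / R} -> M).
Proof.
pose g : {freeg K / R} -> M := fglift f.
have gB r s : g (r - s) = g r - g s by exact: lift_is_additive.
have g0 : g 0 = 0 by rewrite -(subrr 0) gB subrr.
have gN r : g (- r) = - g r by rewrite -sub0r gB g0 sub0r.
have gD : {morph g : r s / r + s}.
  by move=> r s; rewrite -[s in LHS]opprK gB gN opprK.
move=> c r s; rewrite -/g gD; congr (_ + _).
rewrite -[r]freeg_sumE scaler_sumr.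
rewrite !(big_morph g gD g0) scaler_sumr; apply: eq_bigr => p _.
by rewrite freegUZ /g !liftU scalerA.
Qed.

HB.instance Definition _ :=
  GRing.isLinear.Build R {freeg K / R} M *:%R (fglift f) fglift_is_linear.

Lemma freeg_linear_ext (g h : {linear {freeg K / R} -> M}) :
  (forall x, g << x >> = h << x >>) -> g =1 h.
Proof.
move=> gh r; rewrite -[r]freeg_sumE !linear_sum; apply: eq_bigr => x _.
by rewrite -[coeff x r]mulr1 -freegUZ !linearZ_LR gh.
Qed.

End FreeModule.

Record submod (R : pzRingType) (V : lmodType R) := Submod {
  smem : V -> Prop;
  smem0 : smem 0;
  smemD : forall u v, smem u -> smem v -> smem (u + v);
  smemZ : forall (c : R) v, smem v -> smem (c *: v)
}.

Section Submod.
Variables (R : pzRingType) (V : lmodType R) (S : submod V).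

Definition submod_pred : {pred V} := fun v => `[< smem S v >].

Fact submod_pred_closed : submod_closed submod_pred.
Proof.
split; first by apply/asboolP; exact: smem0.
move=> c u v /asboolP Su /asboolP Sv; apply/asboolP.
by apply: smemD => //; exact: smemZ.
Qed.

HB.instance Definition _ :=
  GRing.isSubmodClosed.Build R V submod_pred submod_pred_closed.

Record submod_of := SubmodOf { submod_val : V; _ : submod_val \in submod_pred }.

HB.instance Definition _ := [isSub for submod_val].
HB.instance Definition _ := [Choice of submod_of by <:].
HB.instance Definition _ := [SubChoice_isSubLmodule of submod_of by <:].

Lemma submod_ofP (x : submod_of) : smem S (val x).
Proof. by apply/asboolP; exact: (valP x). Qed.

Definition mk_submod (v : V) (Sv : smem S v) : submod_of :=
  SubmodOf (asboolT Sv).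

Definition quotmod : Type := Quotient.quot submod_pred.

HB.instance Definition _ := GRing.Zmodule.on quotmod.

Definition qproj (v : V) : quotmod := \pi_(Quotient.quot submod_pred) v.
Definition qrepr (q : quotmod) : V := repr (q : Quotient.quot submod_pred).

Lemma qreprK q : qproj (qrepr q) = q.
Proof. exact: reprK. Qed.

Lemma qprojP u v : qproj u = qproj v <-> smem S (u - v).
Proof.
split=> [/eqP|Suv].
  by rewrite /qproj -Quotient.idealrBE => /asboolP.
by apply/eqP; rewrite /qproj -Quotient.idealrBE; apply/asboolP.
Qed.

Fact qprojB : {morph qproj : u v / u - v}.
Proof. by move=> u v; rewrite /qproj raddfB. Qed.

Fact qprojD : {morph qproj : u v / u + v}.
Proof. by move=> u v; rewrite /qproj raddfD. Qed.

Definition qscale (c : R) (q : quotmod) : quotmod := qproj (c *: qrepr q).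

Lemma qprojZ c v : qproj (c *: v) = qscale c (qproj v).
Proof.
by apply/qprojP; rewrite -scalerBr; apply/smemZ/qprojP; rewrite qreprK.
Qed.

Fact qscaleA a b q : qscale a (qscale b q) = qscale (a * b) q.
Proof. by rewrite -[q]qreprK -!qprojZ scalerA. Qed.
Fact qscale1 : left_id 1 qscale.
Proof. by move=> q; rewrite -[q]qreprK -!qprojZ scale1r. Qed.
Fact qscaleDr : right_distributive qscale +%R.
Proof.
by move=> c p q; rewrite -[p]qreprK -[q]qreprK -qprojD -!qprojZ -qprojD scalerDr.
Qed.
Fact qscaleDl q : {morph qscale^~ q : a b / a + b}.
Proof. by move=> a b; rewrite -[q]qreprK -!qprojZ -qprojD scalerDl. Qed.

HB.instance Definition _ := GRing.Zmodule_isLmodule.Build R quotmod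
  qscaleA qscale1 qscaleDr qscaleDl.

Fact qproj_is_linear : linear qproj.
Proof. by move=> c u v; rewrite qprojD qprojZ. Qed.

HB.instance Definition _ :=
  GRing.isLinear.Build R V quotmod *:%R qproj qproj_is_linear.

End Submod.

Arguments qproj {R V} S v.

Section Kernel.
Variables (R : pzRingType) (V W : lmodType R) (f : {linear V -> W}).

Fact kernelD u v : f u = 0 -> f v = 0 -> f (u + v) = 0.
Proof. by move=> fu fv; rewrite linearD fu fv addr0. Qed.
Fact kernelZ (c : R) v : f v = 0 -> f (c *: v) = 0.
Proof. by move=> fv; rewrite linearZ_LR fv scaler0. Qed.

Definition kernel : submod V :=
  @Submod R V (fun v => f v = 0) (linear0 f) kernelD kernelZ.

End Kernel.

Definition restr (k R : pzRingType) (phi : {rmorphism k -> R})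
  (X : lmodType R) : Type := X.

Section Restr.
Variables (k R : pzRingType) (phi : {rmorphism k -> R}) (X : lmodType R).
Local Notation Xk := (restr phi X).

HB.instance Definition _ := GRing.Zmodule.on Xk.

Definition restr_scale (c : k) (x : Xk) : Xk := phi c *: (x : X).

Fact restr_scaleA a b x :
  restr_scale a (restr_scale b x) = restr_scale (a * b) x.
Proof. by rewrite /restr_scale scalerA rmorphM. Qed.
Fact restr_scale1 : left_id 1 restr_scale.
Proof. by move=> x; rewrite /restr_scale rmorph1 scale1r. Qed.
Fact restr_scaleDr : right_distributive restr_scale +%R.
Proof. by move=> a x y; exact: scalerDr. Qed.
Fact restr_scaleDl x : {morph restr_scale^~ x : a b / a + b}.
Proof. by move=> a b; rewrite /restr_scale rmorphD; exact: scalerDl. Qed.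

HB.instance Definition _ := GRing.Zmodule_isLmodule.Build k Xk
  restr_scaleA restr_scale1 restr_scaleDr restr_scaleDl.

End Restr.

Section OppositeAlgebra.
Variables (k : comNzRingType) (A : algType k).

HB.instance Definition _ := GRing.Zmodule_isLmodule.Build k A^c
  (@scalerA k A) (@scale1r k A) (@scalerDr k A) (fun v => @scalerDl k A v).

Fact opp_scaleAl (c : k) (x y : A^c) : c *: (x * y) = c *: x * y.
Proof. by rewrite /*%R /=; exact: scalerAr. Qed.
Fact opp_scaleAr (c : k) (x y : A^c) : c *: (x * y) = x * (c *: y).
Proof. by rewrite /*%R /=; exact: scalerAl. Qed.

HB.instance Definition _ := GRing.Lmodule_isLalgebra.Build k A^c opp_scaleAl.
HB.instance Definition _ := GRing.Lalgebra_isAlgebra.Build k A^c opp_scaleAr.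

End OppositeAlgebra.

(* Finite direct sums, as products of modules. *)
Definition dirsum (R : pzRingType) (I : finType) (X : I -> lmodType R) : Type :=
  forall i, X i.

Section DirectSum.
Variables (R : pzRingType) (I : finType) (X : I -> lmodType R).
Local Notation D := (dirsum X).
Implicit Types x y z : D.

HB.instance Definition _ := gen_eqMixin D.
HB.instance Definition _ := gen_choiceMixin D.

Definition dirsum0 : D := fun i => 0.
Definition dirsum_opp x : D := fun i => - x i.
Definition dirsum_add x y : D := fun i => x i + y i.
Definition dirsum_scale (c : R) x : D := fun i => c *: x i.

Fact dirsum_addA : associative dirsum_add.
Proof. by move=> x y z; apply: functional_extensionality_dep => i; exact: addrA. Qed.
Fact dirsum_addC : commutative dirsum_add.
Proof. by move=> x y; apply: functional_extensionality_dep => i; exact: addrC. Qed.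
Fact dirsum_add0 : left_id dirsum0 dirsum_add.
Proof. by move=> x; apply: functional_extensionality_dep => i; exact: add0r. Qed.
Fact dirsum_addN : left_inverse dirsum0 dirsum_opp dirsum_add.
Proof. by move=> x; apply: functional_extensionality_dep => i; exact: addNr. Qed.

HB.instance Definition _ := GRing.isZmodule.Build D
  dirsum_addA dirsum_addC dirsum_add0 dirsum_addN.

Fact dirsum_scaleA a b x :
  dirsum_scale a (dirsum_scale b x) = dirsum_scale (a * b) x.
Proof. by apply: functional_extensionality_dep => i; exact: scalerA. Qed.
Fact dirsum_scale1 : left_id 1 dirsum_scale.
Proof. by move=> x; apply: functional_extensionality_dep => i; exact: scale1r. Qed.
Fact dirsum_scaleDr : right_distributive dirsum_scale +%R.
Proof. by move=> c x y; apply: functional_extensionality_dep => i; exact: scalerDr. Qed.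
Fact dirsum_scaleDl x : {morph dirsum_scale^~ x : a b / a + b}.
Proof. by move=> a b; apply: functional_extensionality_dep => i; exact: scalerDl. Qed.

HB.instance Definition _ := GRing.Zmodule_isLmodule.Build R D
  dirsum_scaleA dirsum_scale1 dirsum_scaleDr dirsum_scaleDl.

End DirectSum.

Section Tensor.
Variables (k : fieldType) (U V : lmodType k).

Inductive tensor_rel : {freeg (U * V)%type / k} -> Prop :=
| tensor_rel0 : tensor_rel 0
| tensor_relD r s : tensor_rel r -> tensor_rel s -> tensor_rel (r + s)
| tensor_relZ c r : tensor_rel r -> tensor_rel (c *: r)
| tensor_rel_addl u u' v :
    tensor_rel (<< (u + u', v) >> - << (u, v) >> - << (u', v) >>)
| tensor_rel_addr u v v' :
    tensor_rel (<< (u, v + v') >> - << (u, v) >> - << (u, v') >>)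
| tensor_rel_scalel c u v :
    tensor_rel (<< (c *: u, v) >> - c *: << (u, v) >>)
| tensor_rel_scaler c u v :
    tensor_rel (<< (u, c *: v) >> - c *: << (u, v) >>).

Definition tensor_submod : submod {freeg (U * V)%type / k} :=
  @Submod _ _ tensor_rel tensor_rel0 tensor_relD tensor_relZ.

Definition tensor : Type := quotmod tensor_submod.

HB.instance Definition _ := GRing.Lmodule.on tensor.

Definition tens (u : U) (v : V) : tensor := qproj tensor_submod << (u, v) >>.

Lemma tensDl u u' v : tens (u + u') v = tens u v + tens u' v.
Proof.
rewrite /tens -[RHS]linearD; apply/qprojP.
by rewrite opprD addrA; exact: tensor_rel_addl.
Qed.

Lemma tensDr u v v' : tens u (v + v') = tens u v + tens u v'.
Proof.
rewrite /tens -[RHS]linearD; apply/qprojP.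
by rewrite opprD addrA; exact: tensor_rel_addr.
Qed.

Lemma tensZl c u v : tens (c *: u) v = c *: tens u v.
Proof.
by rewrite /tens -[RHS]linearZ_LR; apply/qprojP; exact: tensor_rel_scalel.
Qed.

Lemma tensZr c u v : tens u (c *: v) = c *: tens u v.
Proof.
by rewrite /tens -[RHS]linearZ_LR; apply/qprojP; exact: tensor_rel_scaler.
Qed.

Lemma tensor_ind (P : tensor -> Prop) :
  P 0 -> (forall s t, P s -> P t -> P (s + t)) -> (forall u v, P (tens u v)) ->
  forall t, P t.
Proof.
move=> P0 PD Pt t; rewrite -[t]qreprK -[qrepr t]freeg_sumE.
rewrite (@linear_sum _ _ _ _ (qproj tensor_submod)).
apply: (big_ind P) => // -[u v] _.
rewrite -[coeff _ _]mulr1 -freegUZ.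
rewrite linearZ_LR; have := Pt (coeff (u, v) (qrepr t) *: u) v.
by rewrite tensZl.
Qed.

Definition bilinear_map (W : lmodType k) (f : U -> V -> W) : Prop :=
  (forall v, linear (f^~ v)) /\ (forall u, linear (f u)).

Definition tlift (W : lmodType k) (f : U -> V -> W) (t : tensor) : W :=
  fglift (fun p => f p.1 p.2) (qrepr t).

Section Lift.
Variables (W : lmodType k) (f : U -> V -> W).
Hypothesis bf : bilinear_map f.
Let g : {freeg (U * V)%type / k} -> W := fglift (fun p => f p.1 p.2).

Let gL : linear g.
Proof. exact: fglift_is_linear. Qed.
Let gD : {morph g : r s / r + s}.
Proof. by move=> r s; rewrite -[r]scale1r gL !scale1r. Qed.
Let g0 : g 0 = 0.
Proof. by apply: (addrI (g 0)); rewrite -gD !addr0. Qed.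
Let gZ c r : g (c *: r) = c *: g r.
Proof. by rewrite -[c *: r]addr0 gL g0 !addr0. Qed.
Let gN r : g (- r) = - g r.
Proof. by rewrite -[- r]scaleN1r gZ scaleN1r. Qed.
Let gU p : g << p >> = f p.1 p.2.
Proof. by rewrite /g liftU scale1r. Qed.

Let g_rel r : tensor_rel r -> g r = 0.
Proof.
case: bf => bl br.
elim=> [|r1 r2 _ E1 _ E2|c r1 _ E|u u' v|u v v'|c u v|c u v].
- exact: g0.
- by rewrite gD E1 E2 addr0.
- by rewrite gZ E scaler0.
- rewrite !gD !gN !gU /=; have := bl v 1 u u'; rewrite !scale1r => ->.
  by rewrite addrAC addrK subrr.
- rewrite !gD !gN !gU /=; have := br u 1 v v'; rewrite !scale1r => ->.
  by rewrite addrAC addrK subrr.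
- rewrite gD gN gZ !gU /=; have := bl v c u 0; rewrite !addr0 => ->.
  suff -> : f 0 v = 0 by rewrite addr0 subrr.
  by have := bl v (-1) 0 0; rewrite /= scaler0 addr0 scaleN1r addNr.
- rewrite gD gN gZ !gU /=; have := br u c v 0; rewrite !addr0 => ->.
  suff -> : f u 0 = 0 by rewrite addr0 subrr.
  by have := br u (-1) 0 0; rewrite /= scaler0 addr0 scaleN1r addNr.
Qed.

Let tlift_proj r : tlift f (qproj tensor_submod r) = g r.
Proof.
apply/eqP; rewrite -subr_eq0 -/(g _) /tlift -/(g _) -gN -gD; apply/eqP.
by apply: g_rel; apply: ((qprojP tensor_submod _ _).1 _); rewrite qreprK.
Qed.

Lemma tlift_tens u v : tlift f (tens u v) = f u v.
Proof. by rewrite tlift_proj gU. Qed.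

Lemma tlift_linear : linear (tlift f).
Proof.
move=> c s t; rewrite -[s]qreprK -[t]qreprK -linearZ_LR -linearD.
by rewrite !tlift_proj gD gZ.
Qed.

Lemma tliftD s t : tlift f (s + t) = tlift f s + tlift f t.
Proof. by rewrite -[s]scale1r tlift_linear !scale1r. Qed.

Lemma tlift0 : tlift f 0 = 0.
Proof. by apply: (addrI (tlift f 0)); rewrite -tliftD !addr0. Qed.

Lemma tliftZ c t : tlift f (c *: t) = c *: tlift f t.
Proof. by rewrite -[c *: t]addr0 tlift_linear tlift0 !addr0. Qed.

End Lift.
End Tensor.

Section TensorAction.
Variables (k : fieldType) (U V X Y : lmodType k).
Variables (opX : U -> X -> X) (opY : V -> Y -> Y).

(* The action (u (x) v) . (x (x) y) = (u . x) (x) (v . y), see [tact_tens]; it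
   yields both the product of a tensor product of algebras and the external
   tensor product of modules. *)
Definition tact (s : tensor U V) : tensor X Y -> tensor X Y :=
  tlift (fun u v => tlift (fun x y => tens (opX u x) (opY v y))) s.

Hypotheses (bX : bilinear_map opX) (bY : bilinear_map opY).

Lemma tact_inner_bilin u v :
  bilinear_map (fun x y => tens (opX u x) (opY v y)).
Proof.
split=> [y c x x'|x c y y'] /=.
  by rewrite (bX.2 u) tensDl tensZl.
by rewrite (bY.2 v) tensDr tensZr.
Qed.

Lemma tact_outer_bilin :
  bilinear_map (fun u v => tlift (fun x y => tens (opX u x) (opY v y))).
Proof.
split=> [v c u u'|u c v v']; apply: functional_extensionality_dep => t /=.
all: elim/tensor_ind: t => [|s t IHs IHt|x y].
- by rewrite /GRing.add /GRing.scale /= !tlift0 ?scaler0 ?addr0 //;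
    exact: tact_inner_bilin.
- rewrite tliftD; last exact: tact_inner_bilin.
  rewrite IHs IHt /GRing.add /GRing.scale /= !tliftD; do ?exact: tact_inner_bilin.
  by rewrite scalerDr addrACA.
- rewrite /GRing.add /GRing.scale /= !tlift_tens; do ?exact: tact_inner_bilin.
  by rewrite (bX.1 x) tensDl tensZl.
- by rewrite /GRing.add /GRing.scale /= !tlift0 ?scaler0 ?addr0 //;
    exact: tact_inner_bilin.
- rewrite tliftD; last exact: tact_inner_bilin.
  rewrite IHs IHt /GRing.add /GRing.scale /= !tliftD; do ?exact: tact_inner_bilin.
  by rewrite scalerDr addrACA.
- rewrite /GRing.add /GRing.scale /= !tlift_tens; do ?exact: tact_inner_bilin.
  by rewrite (bY.1 y) tensDr tensZr.
Qed.

Lemma tact_tens u v x y :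
  tact (tens u v) (tens x y) = tens (opX u x) (opY v y).
Proof.
rewrite /tact tlift_tens; last exact: tact_outer_bilin.
by rewrite tlift_tens //; exact: tact_inner_bilin.
Qed.

Lemma tactDl s s' t : tact (s + s') t = tact s t + tact s' t.
Proof. by rewrite /tact tliftD //; exact: tact_outer_bilin. Qed.

Lemma tactZl c s t : tact (c *: s) t = c *: tact s t.
Proof. by rewrite /tact tliftZ //; exact: tact_outer_bilin. Qed.

Lemma tact0l t : tact 0 t = 0.
Proof. by rewrite /tact tlift0 //; exact: tact_outer_bilin. Qed.

Lemma tactDr s t t' : tact s (t + t') = tact s t + tact s t'.
Proof.
elim/tensor_ind: s => [|s s' IH IH'|u v]; first by rewrite !tact0l addr0.
  by rewrite !tactDl IH IH' addrACA.
rewrite /tact tlift_tens; last exact: tact_outer_bilin.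
by rewrite tliftD //; exact: tact_inner_bilin.
Qed.

Lemma tactZr s c t : tact s (c *: t) = c *: tact s t.
Proof.
elim/tensor_ind: s => [|s s' IH IH'|u v]; first by rewrite !tact0l scaler0.
  by rewrite !tactDl IH IH' scalerDr.
rewrite /tact tlift_tens; last exact: tact_outer_bilin.
by rewrite tliftZ //; exact: tact_inner_bilin.
Qed.

Lemma tact0r s : tact s 0 = 0.
Proof. by apply: (addrI (tact s 0)); rewrite -tactDr !addr0. Qed.

End TensorAction.

Lemma mul_bilinear (k : fieldType) (A : algType k) :
  bilinear_map (fun a b : A => a * b).
Proof.
split=> [b c a a'|a c b b'] /=; first by rewrite mulrDl -scalerAl.
by rewrite mulrDr -scalerAr.
Qed.

Section TensorAlgebra.
Variables (k : fieldType) (A B : algType k).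
Local Notation T := (tensor A B).
Implicit Types s t : T.

Let bA := mul_bilinear A.
Let bB := mul_bilinear B.

Definition tensor_mul s t : T := tact (fun a a' => a * a') (fun b b' => b * b') s t.
Definition tensor_one : T := tens 1 1.

Fact tensor_mulA : associative tensor_mul.
Proof.
rewrite /tensor_mul => r s t; elim/tensor_ind: r => [|r r' E E'|a b].
- by rewrite !tact0l.
- by rewrite !tactDl // E E'.
elim/tensor_ind: s => [|s s' E E'|a' b'].
- by rewrite ?(tact0l, tact0r).
- by rewrite !(tactDl, tactDr) // E E'.
elim/tensor_ind: t => [|t t' E E'|a'' b''].
- by rewrite !tact0r.
- by rewrite !tactDr // E E'.
by rewrite !tact_tens // !mulrA.
Qed.

Fact tensor_mul1 : left_id tensor_one tensor_mul.
Proof.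
rewrite /tensor_mul => t; elim/tensor_ind: t => [|t t' E E'|a b].
- by rewrite !tact0r.
- by rewrite !tactDr // E E'.
by rewrite tact_tens // !mul1r.
Qed.

Fact tensor_mulr1 : right_id tensor_one tensor_mul.
Proof.
rewrite /tensor_mul => t; elim/tensor_ind: t => [|t t' E E'|a b].
- by rewrite !tact0l.
- by rewrite !tactDl // E E'.
by rewrite tact_tens // !mulr1.
Qed.

Fact tensor_mulDl : left_distributive tensor_mul +%R.
Proof. by move=> r s t; exact: tactDl. Qed.
Fact tensor_mulDr : right_distributive tensor_mul +%R.
Proof. by move=> r s t; exact: tactDr. Qed.

HB.instance Definition _ := GRing.Zmodule_isPzRing.Build T
  tensor_mulA tensor_mul1 tensor_mulr1 tensor_mulDl tensor_mulDr.

Lemma tensM (a a' : A) (b b' : B) :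
  (tens a b : T) * tens a' b' = tens (a * a') (b * b').
Proof. exact: tact_tens. Qed.

Lemma tens1 : tens 1 1 = 1 :> T.
Proof. by []. Qed.

Fact tensor_scaleAl (c : k) s t : c *: (s * t) = (c *: s) * t.
Proof. by rewrite /*%R /= /tensor_mul tactZl. Qed.
Fact tensor_scaleAr (c : k) s t : c *: (s * t) = s * (c *: t).
Proof. by rewrite /*%R /= /tensor_mul tactZr. Qed.

Definition tensor_in (c : k) : T := c *: (1 : T).

Fact tensor_in_is_zmod : zmod_morphism tensor_in.
Proof. by move=> c d; rewrite /tensor_in scalerBl. Qed.
Fact tensor_in_is_monoid : monoid_morphism tensor_in.
Proof.
split=> [|c d]; first exact: scale1r.
by rewrite /tensor_in -tensor_scaleAl mul1r scalerA.
Qed.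
HB.instance Definition _ :=
  GRing.isZmodMorphism.Build k T tensor_in tensor_in_is_zmod.
HB.instance Definition _ :=
  GRing.isMonoidMorphism.Build k T tensor_in tensor_in_is_monoid.

End TensorAlgebra.

Arguments tensor_in {k} A B c.

Lemma scale_restr_bilinear (k : fieldType) (A : algType k) (X : lmodType A) :
  bilinear_map (fun (a : A) (x : restr (GRing.in_alg A) X) =>
    (a *: (x : X) : restr (GRing.in_alg A) X)).
Proof.
split=> [x c a a'|a c x x'].
  by rewrite scalerDl -[c *: a]mulr_algl -scalerA.
rewrite scalerDr; congr (_ + _).
have -> : a *: (c *: x : X) = (a * c%:A) *: (x : X) by rewrite -scalerA.
by rewrite mulr_algr -[c *: a]mulr_algl -scalerA.
Qed.

(* The tensor product over k of an A-module X and a B-module Y, as an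
   (A (x) B)-module. *)
Definition extens (k : fieldType) (A B : algType k)
    (X : lmodType A) (Y : lmodType B) : Type :=
  tensor (restr (GRing.in_alg A) X) (restr (GRing.in_alg B) Y).

Section ExternalTensor.
Variables (k : fieldType) (A B : algType k) (X : lmodType A) (Y : lmodType B).
Local Notation XY := (extens X Y).

HB.instance Definition _ := GRing.Zmodule.on XY.

Let bX := scale_restr_bilinear X.
Let bY := scale_restr_bilinear Y.
Let bA := mul_bilinear A.
Let bB := mul_bilinear B.

Definition extens_scale (s : tensor A B) (t : XY) : XY :=
  tact (fun (a : A) (x : restr (GRing.in_alg A) X) => a *: (x : X))
       (fun (b : B) (y : restr (GRing.in_alg B) Y) => b *: (y : Y)) s t.

Fact extens_scaleA r s t :
  extens_scale r (extens_scale s t) = extens_scale (r * s) t.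
Proof.
rewrite /extens_scale /*%R /= /tensor_mul.
elim/tensor_ind: r => [|r r' E E'|a b].
- by rewrite !tact0l.
- by rewrite !tactDl // E E'.
elim/tensor_ind: s => [|s s' E E'|a' b'].
- by rewrite ?(tact0l, tact0r).
- by rewrite !(tactDl, tactDr) // E E'.
elim/tensor_ind: t => [|t t' E E'|x y].
- by rewrite !tact0r.
- by rewrite !tactDr // E E'.
by rewrite !tact_tens // !scalerA.
Qed.
Fact extens_scale1 : left_id 1 extens_scale.
Proof.
rewrite /extens_scale => t; elim/tensor_ind: t => [|t t' E E'|x y].
- by rewrite !tact0r.
- by rewrite !tactDr // E E'.
by rewrite tact_tens // !scale1r.
Qed.
Fact extens_scaleDr : right_distributive extens_scale +%R.
Proof. by move=> s t t'; exact: tactDr. Qed.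
Fact extens_scaleDl t : {morph extens_scale^~ t : r s / r + s}.
Proof. by move=> r s; exact: tactDl. Qed.

HB.instance Definition _ := GRing.Zmodule_isLmodule.Build (tensor A B) XY
  extens_scaleA extens_scale1 extens_scaleDr extens_scaleDl.

End ExternalTensor.

(* Modules over [tensor A B^c] are the A-B-bimodules on which k acts
   centrally. *)

Section Bimodule.
Variables (k : fieldType) (A B : algType k) (X : lmodType (tensor A B^c)).

Definition lact (a : A) (x : X) : X := tens a (1 : B^c) *: x.
Definition ract (x : X) (b : B) : X := tens (1 : A) (b : B^c) *: x.

Lemma lactDl a a' x : lact (a + a') x = lact a x + lact a' x.
Proof. by rewrite /lact tensDl scalerDl. Qed.
Lemma lactDr a x x' : lact a (x + x') = lact a x + lact a x'.
Proof. exact: scalerDr. Qed.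
Lemma ractDl x x' b : ract (x + x') b = ract x b + ract x' b.
Proof. exact: scalerDr. Qed.
Lemma ractDr x b b' : ract x (b + b') = ract x b + ract x b'.
Proof. by rewrite /ract -scalerDl; congr (_ *: x); exact: tensDr. Qed.
Lemma lact1 x : lact 1 x = x.
Proof. by rewrite /lact tens1 scale1r. Qed.
Lemma ract1 x : ract x 1 = x.
Proof. by rewrite /ract; exact: scale1r. Qed.
Lemma lact0 a : lact a 0 = 0.
Proof. exact: scaler0. Qed.
Lemma ract0 b : ract 0 b = 0.
Proof. exact: scaler0. Qed.
Lemma lact0l x : lact 0 x = 0.
Proof. by apply: (addrI (lact 0 x)); rewrite -lactDl !addr0. Qed.
Lemma ract0r x : ract x 0 = 0.
Proof. by apply: (addrI (ract x 0)); rewrite -ractDr !addr0. Qed.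
Lemma lactA a a' x : lact a (lact a' x) = lact (a * a') x.
Proof. by rewrite /lact scalerA tensM mulr1. Qed.
Lemma ractA x b b' : ract (ract x b) b' = ract x (b * b').
Proof. by rewrite /ract scalerA tensM mulr1. Qed.
Lemma lractA a x b : lact a (ract x b) = ract (lact a x) b.
Proof. by rewrite /lact /ract !scalerA !tensM !mulr1 !mul1r. Qed.

Lemma lactZl c a x : lact (c *: a) x = tensor_in A B^c c *: lact a x.
Proof. by rewrite /lact tensZl scalerA /tensor_in -tensor_scaleAl mul1r. Qed.
Lemma lactZr c a x : lact a (tensor_in A B^c c *: x) = tensor_in A B^c c *: lact a x.
Proof.
rewrite /lact !scalerA; congr (_ *: x).
by rewrite /tensor_in -tensor_scaleAl -tensor_scaleAr mulr1 mul1r.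
Qed.
Lemma ractZl c x b : ract (tensor_in A B^c c *: x) b = tensor_in A B^c c *: ract x b.
Proof.
rewrite /ract !scalerA; congr (_ *: x).
by rewrite /tensor_in -tensor_scaleAl -tensor_scaleAr mulr1 mul1r.
Qed.
Lemma ractZr c x b : ract x (c *: b) = tensor_in A B^c c *: ract x b.
Proof.
rewrite /ract [tens _ _](tensZr c (1 : A) (b : B^c)) scalerA.
by rewrite /tensor_in -tensor_scaleAl mul1r.
Qed.

End Bimodule.

Arguments lact {k A B X} a x.
Arguments ract {k A B X} x b.

Definition env (k : fieldType) (A : algType k) : Type := tensor A A^c.

Definition regbim (k : fieldType) (A : algType k) : Type := A.

Section Enveloping.
Variables (k : fieldType) (A : algType k).

HB.instance Definition _ := GRing.PzRing.on (env A).
HB.instance Definition _ := GRing.Lmodule.on (env A).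
HB.instance Definition _ := GRing.Zmodule.on (regbim A).

(* (a (x) b) . x = a x b, see [regbim_scale_tens]. *)
Definition regbim_scale (s : env A) (x : regbim A) : regbim A :=
  tlift (fun (a : A) (b : A^c) => fun x : A => a * x * (b : A)) s x.

Lemma regbim_bilin :
  bilinear_map (fun (a : A) (b : A^c) => fun x : A => a * x * (b : A)).
Proof.
split=> [b c a a'|a c b b']; apply: functional_extensionality_dep => x /=.
  by rewrite /GRing.add /GRing.scale /= !mulrDl -!scalerAl.
by rewrite /GRing.add /GRing.scale /= mulrDr -scalerAr.
Qed.

Lemma regbim_scale_tens (a : A) (b : A^c) x :
  regbim_scale (tens a b) x = a * (x : A) * (b : A).
Proof. by rewrite /regbim_scale tlift_tens //; exact: regbim_bilin. Qed.

Fact regbim_scaleDl x : {morph regbim_scale^~ x : r s / r + s}.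
Proof. by move=> r s; rewrite /regbim_scale tliftD //; exact: regbim_bilin. Qed.

Lemma regbim_scale0 x : regbim_scale 0 x = 0.
Proof. by rewrite /regbim_scale tlift0 //; exact: regbim_bilin. Qed.

Fact regbim_scaleDr : right_distributive regbim_scale +%R.
Proof.
move=> s x y; elim/tensor_ind: s => [|s s' E E'|a b].
- by rewrite !regbim_scale0 addr0.
- by rewrite !regbim_scaleDl E E' addrACA.
by rewrite !regbim_scale_tens mulrDr mulrDl.
Qed.

Lemma regbim_scaler0 s : regbim_scale s 0 = 0.
Proof. by apply: (addrI (regbim_scale s 0)); rewrite -regbim_scaleDr !addr0. Qed.

Fact regbim_scale1 : left_id 1 regbim_scale.
Proof. by move=> x; rewrite [LHS]regbim_scale_tens mul1r mulr1. Qed.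

Fact regbim_scaleA r s x :
  regbim_scale r (regbim_scale s x) = regbim_scale (r * s) x.
Proof.
elim/tensor_ind: r => [|r r' E E'|a b].
- by rewrite mul0r !regbim_scale0.
- by rewrite mulrDl !regbim_scaleDl E E'.
elim/tensor_ind: s => [|s s' E E'|a' b'].
- by rewrite mulr0 !regbim_scale0 regbim_scaler0.
- by rewrite mulrDr !regbim_scaleDl regbim_scaleDr E E'.
by rewrite [tens a b * _]tensM !regbim_scale_tens !mulrA.
Qed.

Fact env_neq0 : 1 != 0 :> env A.
Proof.
apply/eqP => e10; have := oner_neq0 A.
by rewrite -[1 : A](regbim_scale1 (1 : A)) e10 regbim_scale0 eqxx.
Qed.

HB.instance Definition _ := GRing.PzSemiRing_isNonZero.Build (env A) env_neq0.
HB.instance Definition _ :=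
  GRing.Lmodule_isLalgebra.Build k (env A) (@tensor_scaleAl k A A^c).
HB.instance Definition _ :=
  GRing.Lalgebra_isAlgebra.Build k (env A) (@tensor_scaleAr k A A^c).

HB.instance Definition _ := GRing.Zmodule_isLmodule.Build (env A) (regbim A)
  regbim_scaleA regbim_scale1 regbim_scaleDr regbim_scaleDl.

End Enveloping.

Definition projective (R : pzRingType) (P : lmodType R) : Prop :=
  forall (V W : lmodType R) (g : {linear V -> W}) (f : {linear P -> W}),
    (forall w, exists v, g v = w) ->
    exists h : {linear P -> V}, forall p, g (h p) = f p.

Record resolution (R : pzRingType) (X : lmodType R) := Resolution {
  res_obj :> nat -> lmodType R;
  res_diff : forall n, {linear res_obj n.+1 -> res_obj n};
  res_aug : {linear res_obj 0 -> X};
  res_projective : forall n, projective (res_obj n);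
  res_aug_surj : forall x, exists p, res_aug p = x;
  res_exact0 : forall p, res_aug p = 0 <-> exists q, p = res_diff 0 q;
  res_exactS : forall n p, res_diff n p = 0 <-> exists q, p = res_diff n.+1 q
}.

Section FreeResolution.
Variable R : nzRingType.
Implicit Types X : lmodType R.

Definition free_aug X : {freeg X / R} -> X := fglift id.

HB.instance Definition _ X := GRing.Linear.on (@free_aug X).

Lemma free_aug_surj X x : exists r, @free_aug X r = x.
Proof. by exists << x >>; rewrite /free_aug liftU scale1r. Qed.

Lemma free_projective (K : choiceType) :
  projective ({freeg K / R} : lmodType R).
Proof.
move=> V W g f gsurj.
have [s gs] : exists s : K -> V, forall x, g (s x) = f << x >>.
  exists (fun x => projT1 (cid (gsurj (f << x >>)))) => x.
  exact: projT2 (cid (gsurj (f << x >>))).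
exists (fglift s) => r.
apply: (freeg_linear_ext (g := g \o fglift s) (h := f)) => x /=.
by rewrite liftU scale1r gs.
Qed.

Definition free_syzygy X : lmodType R := submod_of (kernel (@free_aug X)).

Fixpoint free_syz X (n : nat) : lmodType R :=
  if n is m.+1 then free_syzygy (free_syz X m) else X.

Definition free_term X (n : nat) : lmodType R := {freeg (free_syz X n) / R}.

Definition free_diff X (n : nat) : {linear free_term X n.+1 -> free_term X n} :=
  (val : {linear free_syz X n.+1 -> free_term X n}) \o @free_aug (free_syz X n.+1).

Fact free_exact0 X (r : free_term X 0) :
  free_aug r = 0 <-> exists q, r = free_diff X 0 q.
Proof.
split=> [r0|[q ->]]; last exact: (submod_ofP (free_aug q)).
have [q qE] := free_aug_surj (mk_submod (S := kernel (@free_aug X)) r0).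
by exists q; rewrite /= qE.
Qed.

Fact free_exactS X n (r : free_term X n.+1) :
  free_diff X n r = 0 <-> exists q, r = free_diff X n.+1 q.
Proof.
rewrite -(@free_exact0 (free_syz X n.+1)) /=; split=> [r0|->]; last by [].
by apply: val_inj; exact: r0.
Qed.

(* The standard free resolution of [X]: its n-th term is the free module on the
   underlying set of the n-th syzygy module. *)
Definition free_resolution X : resolution X :=
  @Resolution R X (free_term X) (free_diff X) (@free_aug X)
    (fun n => @free_projective (free_syz X n)) (@free_aug_surj X)
    (@free_exact0 X) (@free_exactS X).

End FreeResolution.

Section Hom.
Variables (k : fieldType) (R : algType k) (X Y : lmodType R).
Local Notation Yk := (restr (GRing.in_alg R) Y).

Definition is_hom (f : X -> Yk) : Prop := linear (f : X -> Y).

Fact is_hom0 : is_hom 0.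
Proof. by move=> a x y; rewrite /= scaler0 addr0. Qed.
Fact is_homD f g : is_hom f -> is_hom g -> is_hom (f + g).
Proof.
by move=> fl gl a x y; rewrite [LHS](congr2 +%R (fl a x y) (gl a x y)) addrACA
  -scalerDr.
Qed.
Fact is_homZ (c : k) f : is_hom f -> is_hom (c *: f).
Proof.
move=> fl a x y; rewrite [LHS](congr1 ( *:%R c%:A) (fl a x y)) scalerDr.
by congr (_ + _); rewrite !scalerA mulr_algl mulr_algr.
Qed.

Definition hom_submod : submod (X -> Yk) := Submod is_hom0 is_homD is_homZ.

Definition hom : Type := submod_of hom_submod.

HB.instance Definition _ := GRing.Lmodule.on hom.

End Hom.

Section HomPrecomp.
Variables (k : fieldType) (R : algType k) (X X' Y : lmodType R).
Variable d : {linear X' -> X}.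

Fact precomp_subproof (f : hom X Y) : is_hom (val f \o d : X' -> Y).
Proof.
move=> a x y; rewrite /= linearP.
exact: (submod_ofP f).
Qed.

Definition precomp (f : hom X Y) : hom X' Y :=
  @mk_submod k _ (hom_submod X' Y) (val f \o d) (precomp_subproof f).

Fact precomp_is_linear : linear precomp.
Proof. by move=> c f g; apply: val_inj. Qed.

HB.instance Definition _ :=
  GRing.isLinear.Build k (hom X Y) (hom X' Y) *:%R precomp precomp_is_linear.

End HomPrecomp.

Arguments precomp {k R X X'} Y d f.

Section Cohomology.
Variables (k : pzRingType) (C : nat -> lmodType k).
Variable delta : forall n, {linear C n -> C n.+1}.

Definition cocycles (n : nat) : lmodType k := submod_of (kernel (delta n)).

(* A degree 0 coboundary is zero: the complex starts in degree 0. *)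
Definition is_coboundary (n : nat) : C n -> Prop :=
  match n with
  | 0 => fun z => z = 0
  | m.+1 => fun z => exists y, z = delta m y
  end.

Fact coboundary0 n : is_coboundary (val (0 : cocycles n)).
Proof. by case: n => [|n] //; exists 0; rewrite linear0. Qed.
Fact coboundaryD n (z z' : cocycles n) :
  is_coboundary (val z) -> is_coboundary (val z') -> is_coboundary (val (z + z')).
Proof.
case: n z z' => [|n] z z' /=; first by move=> z0 z'0; rewrite z0 z'0 addr0.
by move=> [y zE] [y' z'E]; exists (y + y'); rewrite linearD -zE -z'E.
Qed.
Fact coboundaryZ n (c : k) (z : cocycles n) :
  is_coboundary (val z) -> is_coboundary (val (c *: z)).
Proof.
case: n z => [|n] z /=; first by move=> z0; rewrite z0 scaler0.
by move=> [y zE]; exists (c *: y); rewrite linearZ_LR -zE.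
Qed.

Definition coboundaries n : submod (cocycles n) :=
  @Submod k (cocycles n) (fun z => is_coboundary (val z))
    (coboundary0 n) (@coboundaryD n) (@coboundaryZ n).

Definition cohomology (n : nat) : lmodType k := quotmod (coboundaries n).

End Cohomology.

(* Ext is computed from the standard free resolution of the first argument; by
   the comparison theorem any projective resolution gives the same space. *)
Definition Ext (k : fieldType) (R : algType k) (n : nat) (X Y : lmodType R) :
    lmodType k :=
  cohomology (fun i => precomp Y (res_diff (free_resolution X) i)) n.

Definition HH (k : fieldType) (n : nat) (A : algType k) : lmodType k :=
  Ext n (regbim A : lmodType (env A)) (regbim A : lmodType (env A)).

Definition lmod_iso (R : pzRingType) (V W : lmodType R) : Prop :=
  exists f : {linear V -> W}, bijective f.

(* [x.1.1], [x.1.2], [x.2.1], [x.2.2] are the entries of the matrix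
   (A N // M B). *)
Definition nullsq (k : fieldType) (A B : algType k)
    (M : lmodType (tensor B A^c)) (N : lmodType (tensor A B^c)) : Type :=
  ((A * restr (tensor_in A B^c) N) *
   (restr (tensor_in B A^c) M * B))%type.

Section NullSquare.
Variables (k : fieldType) (A B : algType k).
Variables (M : lmodType (tensor B A^c)) (N : lmodType (tensor A B^c)).
Local Notation L := (nullsq M N).
Implicit Types x y z : L.

HB.instance Definition _ := GRing.Lmodule.on L.

(* The products of an element of N with an element of M, in either order,
   are zero. *)
Definition nullsq_mul x y : L :=
  ((x.1.1 * y.1.1,
    lact x.1.1 (y.1.2 : N) + ract (x.1.2 : N) y.2.2),
   (ract (x.2.1 : M) y.1.1 + lact x.2.2 (y.2.1 : M),
    x.2.2 * y.2.2)).

Definition nullsq_one : L := ((1, 0), (0, 1)).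

Fact nullsq_mulA : associative nullsq_mul.
Proof.
move=> [[a n] [m b]] [[a' n'] [m' b']] [[a'' n''] [m'' b'']].
rewrite /nullsq_mul /= !mulrA; congr ((_, _), (_, _)).
  by rewrite lactDr ractDl lactA ractA lractA addrA.
by rewrite lactDr ractDl lactA ractA lractA addrA.
Qed.

Fact nullsq_mul1 : left_id nullsq_one nullsq_mul.
Proof.
move=> [[a n] [m b]]; rewrite /nullsq_mul /= !mul1r !lact1.
congr ((_, _), (_, _)).
  by rewrite [ract _ _]scaler0 addr0.
by rewrite [ract _ _]scaler0 add0r.
Qed.

Fact nullsq_mulr1 : right_id nullsq_one nullsq_mul.
Proof.
move=> [[a n] [m b]]; rewrite /nullsq_mul /= !mulr1 !ract1.
congr ((_, _), (_, _)).
  by rewrite [lact _ _]scaler0 add0r.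
by rewrite [lact _ _]scaler0 addr0.
Qed.

Fact nullsq_mulDl : left_distributive nullsq_mul +%R.
Proof.
move=> [[a n] [m b]] [[a' n'] [m' b']] [[a'' n''] [m'' b'']].
rewrite /nullsq_mul /= !mulrDl; congr ((_, _), (_, _)).
  by rewrite lactDl ractDl addrACA.
by rewrite lactDl ractDl addrACA.
Qed.

Fact nullsq_mulDr : right_distributive nullsq_mul +%R.
Proof.
move=> [[a n] [m b]] [[a' n'] [m' b']] [[a'' n''] [m'' b'']].
rewrite /nullsq_mul /= !mulrDr; congr ((_, _), (_, _)).
  by rewrite lactDr ractDr addrACA.
by rewrite lactDr ractDr addrACA.
Qed.

Fact nullsq_one_neq0 : nullsq_one != 0.
Proof. by apply/eqP => -[/eqP]; rewrite oner_eq0. Qed.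

HB.instance Definition _ := GRing.Zmodule_isNzRing.Build L
  nullsq_mulA nullsq_mul1 nullsq_mulr1 nullsq_mulDl nullsq_mulDr
  nullsq_one_neq0.

Fact nullsq_scaleAl (c : k) x y : c *: (x * y) = c *: x * y.
Proof.
case: x y => [[a n] [m b]] [[a' n'] [m' b']].
congr ((_, _), (_, _)) => /=; rewrite ?scalerAl //.
  rewrite [LHS](scalerDr (tensor_in _ _ c)).
  by rewrite -lactZl ractZl.
rewrite [LHS](scalerDr (tensor_in _ _ c)).
by rewrite -lactZl ractZl.
Qed.
Fact nullsq_scaleAr (c : k) x y : c *: (x * y) = x * (c *: y).
Proof.
case: x y => [[a n] [m b]] [[a' n'] [m' b']].
congr ((_, _), (_, _)) => /=; rewrite ?scalerAr //.
  rewrite [LHS](scalerDr (tensor_in _ _ c)).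
  by rewrite -ractZr lactZr.
rewrite [LHS](scalerDr (tensor_in _ _ c)).
by rewrite -ractZr lactZr.
Qed.

HB.instance Definition _ := GRing.Lmodule_isLalgebra.Build k L nullsq_scaleAl.
HB.instance Definition _ := GRing.Lalgebra_isAlgebra.Build k L nullsq_scaleAr.

End NullSquare.

Definition is_system (A : nzRingType) (E : {fset A}) : Prop :=
  [/\ forall e : E, val e * val e = val e,
      forall e e' : E, e != e' -> val e * val e' = 0 &
      \sum_(e : E) val e = 1].

Section LeftIdeal.
Variables (R : nzRingType) (e : R).

Definition in_lideal (x : R^o) : Prop := exists r : R, x = r * e.

Fact lideal0 : in_lideal 0.
Proof. by exists 0; rewrite mul0r. Qed.
Fact lidealD x y : in_lideal x -> in_lideal y -> in_lideal (x + y).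
Proof. by move=> [r ->] [s ->]; exists (r + s); rewrite mulrDl. Qed.
Fact lidealZ (c : R) x : in_lideal x -> in_lideal (c *: x).
Proof. by move=> [r ->]; exists (c * r); rewrite -mulrA. Qed.

Definition lideal : lmodType R := submod_of (Submod lideal0 lidealD lidealZ).

End LeftIdeal.

(* The B-A-bimodule Bf (x) eA. Its right-hand factor eA is the left ideal
   generated by e in the opposite algebra of A. *)
Definition projbim (k : fieldType) (B A : algType k) (f : B) (e : A) :
    lmodType (tensor B A^c) :=
  extens (lideal f : lmodType B) (lideal (e : A^c) : lmodType A^c).

Definition projbim_sum (k : fieldType) (B A : algType k)
    (F : {fset B}) (E : {fset A}) (m : F -> E -> nat) :
    lmodType (tensor B A^c) :=
  dirsum (fun i : {fe : F * E & 'I_(m fe.1 fe.2)} =>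
    projbim (val (tag i).1) (val (tag i).2)).

Section PeirceQuiver.
Variables (k : fieldType) (A B : algType k) (E : {fset A}) (F : {fset B}).
Variables (m : F -> E -> nat) (n : E -> F -> nat).

Definition peirce_arrow (R : algType k) (D : {fset R}) (x y : D) : Prop :=
  x <> y /\ exists a : R, val y * a * val x <> 0.

(* The arrows of the quiver on the disjoint union of E and F; there is at most
   one arrow from a vertex to another one. *)
Definition arrow (x y : E + F) : Prop :=
  match x, y with
  | inl e, inl e' => peirce_arrow e e'
  | inr f, inr f' => peirce_arrow f f'
  | inl e, inr f => m f e <> 0%N
  | inr f, inl e => n e f <> 0%N
  end.

Definition in_QE (x y : E + F) : Prop :=
  match x, y with inl _, inl _ => True | _, _ => False end.
Definition in_QF (x y : E + F) : Prop :=
  match x, y with inr _, inr _ => True | _, _ => False end.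

(* The path x -> p_0 -> p_1 -> ... *)
Fixpoint is_path (x : E + F) (p : seq (E + F)) : Prop :=
  if p is y :: p' then arrow x y /\ is_path y p' else True.

Fixpoint no_two_successive (x : E + F) (p : seq (E + F)) : Prop :=
  match p with
  | y :: ((z :: _) as p') =>
      [/\ ~ (in_QE x y /\ in_QE y z), ~ (in_QF x y /\ in_QF y z) &
          no_two_successive y p']
  | _ => True
  end.

Definition efficient_path (x : E + F) (p : seq (E + F)) : Prop :=
  is_path x p /\ no_two_successive x p.

Definition efficient_cycle (x : E + F) (p : seq (E + F)) : Prop :=
  [/\ efficient_path x p, (0 < size p)%N & last x p = x].

End PeirceQuiver.

(* Main.v *)
(** Let C = A x B.  The algebra Lambda is C + P, where P = M + N is a square-zero
    ideal which, as a C-bimodule, is a finite sum of bimodules C y_i (x) x_i C.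
    Extending scalars from C to Lambda takes a C-module X to an extension of
    X (with P acting by zero) by the sum of the C y_i (x) x_i X; this functor is
    exact, preserves projectives and is left adjoint to restriction.  Over
    Lambda, the inflated module C y_i is therefore a quotient of a projective by
    a sum of copies of those C y_j with x_j C y_i <> 0.  A cycle of this relation
    on the indices yields an efficient cycle, so without efficient cycles every
    inflated C y_i, and dually every inflated x_i C, has finite projective
    dimension.  Hence, in large degrees, Lambda may be replaced by the inflated
    bimodule C, and scalar extension on one side and then on the other gives
    HH^n(Lambda) = Ext^n_{C-C}(C, Lambda).  The two central idempotents of C cut
    this down to HH^n(A) + HH^n(B), since P has no component in either diagonal
    block. *)
From HB Require Import structures.
From mathcomp Require Import all_boot all_algebra.
From mathcomp Require Import finmap boolp classical_sets functions freeg.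
Require Import Defs.

Set Implicit Arguments.
Unset Strict Implicit.
Unset Printing Implicit Defensive.

Import GRing.Theory.
Local Open Scope ring_scope.

(** * Short exact sequences, stable isomorphism and syzygies *)

(** Everything is phrased through syzygies up to maps that factor through projectives, so no long
    exact sequence is needed: if the kernel of a surjection has finite projective dimension, its
    source and target have the same high syzygies in this sense, hence the same high Ext with every
    coefficient module. Only first arguments are replaced, and the bound on the degree depends on
    them alone; the coefficient [G] is merely restricted. Ext is handled in degrees [n.+1], where it
    is a quotient of Hom out of a syzygy; Hom itself is not invariant under adding projectives.
    Scalar extension from [C] to [G] is needed for one-sided modules and for each side of a
    bimodule. It is built once over [G (x) T] with a spectator algebra [T], which is [k], then
    [G^c], then, for the opposite extension, [C]. Instead of a tensor product over [C] it is an
    extension of modules given by a cocycle, which puts its kernel in plain sight. The right-hand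
    side of a bimodule is reached by passing to opposite algebras and swapping tensor factors. *)

Definition Lin (R : pzRingType) (U V : lmodType R) (f : U -> V)
    (fL : linear f) : {linear U -> V} :=
  HB.pack f (GRing.isLinear.Build R U V *:%R f fL).

Section ShortExact.
Variable R : pzRingType.
Implicit Types X Y Z F V W P : lmodType R.

Definition ses Z F X (i : {linear Z -> F}) (p : {linear F -> X}) :=
  [/\ injective i, (forall x, exists y, p y = x) &
      (forall y, p y = 0 <-> exists z, y = i z)].

Lemma ses_comp Z F X (i : {linear Z -> F}) (p : {linear F -> X}) :
  ses i p -> forall z, p (i z) = 0.
Proof. by case=> _ _ e z; apply/e; exists z. Qed.

Lemma ses_lift Z F X (i : {linear Z -> F}) (p : {linear F -> X}) V
    (f : {linear V -> F}) :
  ses i p -> (forall v, p (f v) = 0) ->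
  exists g : {linear V -> Z}, forall v, i (g v) = f v.
Proof.
move=> [iI _ e] pf0.
have gP v : exists z, f v = i z by apply/e.
pose g v := projT1 (cid (gP v)).
have gE v : i (g v) = f v by rewrite -(projT2 (cid (gP v))).
have gL : linear g by move=> a u v; apply: iI; rewrite linearP !gE linearP.
by exists (Lin gL).
Qed.

Lemma surj_desc F X (p : {linear F -> X}) Y (f : {linear F -> Y}) :
  (forall x, exists y, p y = x) -> (forall y, p y = 0 -> f y = 0) ->
  exists g : {linear X -> Y}, forall y, g (p y) = f y.
Proof.
move=> pS pf.
pose s x := projT1 (cid (pS x)).
have sE x : p (s x) = x := projT2 (cid (pS x)).
have fE y y' : p y = p y' -> f y = f y'.
  by move=> e; apply/eqP; rewrite -subr_eq0 -linearB pf // linearB e subrr.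
have gL : linear (fun x => f (s x)).
  by move=> a u v; rewrite -linearP; apply: fE; rewrite linearP !sE.
by exists (Lin gL) => y; apply: fE; rewrite sE.
Qed.

Lemma ses_kernel F X (p : {linear F -> X}) :
  (forall x, exists y, p y = x) ->
  ses (val : {linear submod_of (kernel p) -> F}) p.
Proof.
move=> pS; split=> [||y]; [exact: val_inj | exact: pS |].
split=> [py|[z ->]]; last exact: (submod_ofP z).
by exists (mk_submod (S := kernel p) py).
Qed.

Lemma projective_retract X Y (i : {linear X -> Y}) (r : {linear Y -> X}) :
  (forall x, r (i x) = x) -> projective Y -> projective X.
Proof.
move=> ri Ypr V W g f gS.
have [h hE] := Ypr V W g (f \o r)%FUN gS.
by exists (h \o i)%FUN => x /=; rewrite hE /= ri.
Qed.

Lemma projective_pair X Y :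
  projective X -> projective Y -> projective (X * Y)%type.
Proof.
move=> Xpr Ypr V W g f gS.
have f1L : linear (fun x : X => f (x, 0)).
  by move=> a u v; rewrite -linearP; congr (f (_, _)); rewrite /= scaler0 addr0.
have f2L : linear (fun y : Y => f (0, y)).
  by move=> a u v; rewrite -linearP; congr (f (_, _)); rewrite /= scaler0 addr0.
have [h1 h1E] := Xpr V W g (Lin f1L) gS.
have [h2 h2E] := Ypr V W g (Lin f2L) gS.
have hL : linear (fun xy : X * Y => h1 xy.1 + h2 xy.2).
  by move=> a u v; rewrite /= !linearP scalerDr addrACA.
exists (Lin hL) => -[x y] /=.
by rewrite linearD h1E h2E /= -linearD; congr (f (_, _)); rewrite /= ?addr0 ?add0r.
Qed.

Lemma projective_zero X : (forall x : X, x = 0) -> projective X.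
Proof.
move=> X0 V W g f gS; exists \0%R => x.
by rewrite [x]X0 !linear0.
Qed.

End ShortExact.

Section DirectSums.
Variables (R : pzRingType) (I : finType) (X : I -> lmodType R).

Definition dsingle i (x : X i) : dirsum X := dfwith (fun j => 0 : X j) x.

Lemma dsingle_in i x : dsingle x i = x.
Proof. exact: dfwith_in. Qed.

Lemma dsingle_out i j (x : X i) : i != j -> dsingle x j = 0.
Proof. by move=> ne; exact: dfwith_out. Qed.

Fact dsingle_linear i : linear (@dsingle i).
Proof.
move=> a u v; apply: functional_extensionality_dep => j.
rewrite /GRing.add /GRing.scale /= /dirsum_add /dirsum_scale /dsingle.
by case: dfwithP => [|j' ne]; rewrite ?dfwith_in ?dfwith_out // scaler0 addr0.
Qed.

Lemma dirsum_sumE (x : dirsum X) : \sum_i dsingle (x i) = x.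
Proof.
apply: functional_extensionality_dep => j.
have -> (s : seq I) (y : I -> dirsum X) :
    (\sum_(i <- s) y i) j = \sum_(i <- s) y i j.
  by elim: s => [|i s IH]; rewrite ?big_nil // !big_cons -IH.
rewrite (bigD1 j) //= dsingle_in big1 ?addr0 // => i ne.
by rewrite dsingle_out.
Qed.

Lemma dirsum_lift (W : lmodType R) (h : forall i, {linear X i -> W}) :
  exists f : {linear dirsum X -> W}, forall x, f x = \sum_i h i (x i).
Proof.
have hL : linear (fun x : dirsum X => \sum_i h i (x i)).
  move=> a u v; rewrite scaler_sumr -big_split /=; apply: eq_bigr => i _.
  by rewrite -linearP.
by exists (Lin hL).
Qed.

Lemma projective_dirsum :
  (forall i, projective (X i)) -> projective (dirsum X : lmodType R).
Proof.
move=> Xpr V W g f gS.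
have [h hE] : exists h : forall i, {linear X i -> V},
    forall i x, g (h i x) = f (dsingle x).
  have H i : exists h : {linear X i -> V}, forall x, g (h x) = f (dsingle x).
    exact: (Xpr i V W g (f \o Lin (@dsingle_linear i))%FUN gS).
  by exists (fun i => projT1 (cid (H i))) => i; exact: (projT2 (cid (H i))).
have [h' h'E] := dirsum_lift h; exists h' => x.
rewrite h'E linear_sum /=; under eq_bigr do rewrite hE.
by rewrite -(linear_sum f) dirsum_sumE.
Qed.

End DirectSums.

(** * Modules up to maps factoring through projectives; projective dimension *)

Section Stable.
Variable R : nzRingType.
Implicit Types X Y Z F V W P : lmodType R.

Lemma free_syzygy_ses X :
  ses (val : {linear free_syzygy X -> {freeg X / R}}) (@free_aug R X).
Proof. exact/ses_kernel/free_aug_surj. Qed.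

(** Factoring through the canonical free cover of [Y] is the same as factoring through some
    projective module, but involves no quantification over modules. *)
Definition factors_free X Y (f : X -> Y) :=
  exists h : {linear X -> {freeg Y / R}}, forall x, f x = free_aug (h x).

Lemma factors_freeP X Y P (a : {linear X -> P}) (b : {linear P -> Y}) f :
  projective P -> (forall x, f x = b (a x)) -> factors_free (f : X -> Y).
Proof.
move=> Ppr fE; have [h hE] := Ppr _ _ (@free_aug R Y) b (@free_aug_surj R Y).
by exists (h \o a)%FUN => x; rewrite fE /= hE.
Qed.

Lemma factors_freeD X Y (f g : X -> Y) :
  factors_free f -> factors_free g -> factors_free (fun x => f x + g x).
Proof.
move=> [h hE] [h' h'E]; exists (h \+ h')%R => x.
by rewrite hE h'E /= linearD.
Qed.

Lemma factors_free_comp X X' Y Y' (u : {linear X' -> X}) (f : X -> Y)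
    (v : {linear Y -> Y'}) :
  factors_free f -> factors_free (fun x => v (f (u x))).
Proof.
move=> [h hE].
apply: (factors_freeP (a := (h \o u)%FUN) (b := (v \o @free_aug R Y)%FUN)
  (@free_projective R Y)) => x /=.
by rewrite hE.
Qed.

Definition stable_iso X Y := exists (u : {linear X -> Y}) (v : {linear Y -> X}),
  factors_free (fun x => x - v (u x)) /\ factors_free (fun y => y - u (v y)).

Lemma stab_iso X Y (u : {linear X -> Y}) (v : {linear Y -> X}) :
  cancel u v -> cancel v u -> stable_iso X Y.
Proof.
move=> uK vK; exists u, v; split; exists \0%R => x.
  by rewrite uK subrr linear0.
by rewrite vK subrr linear0.
Qed.

Lemma stab_refl X : stable_iso X X.
Proof. exact: (@stab_iso X X idfun idfun). Qed.

Lemma stab_sym X Y : stable_iso X Y -> stable_iso Y X.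
Proof. by move=> [u [v [p q]]]; exists v, u. Qed.

Lemma stab_trans X Y Z : stable_iso X Y -> stable_iso Y Z -> stable_iso X Z.
Proof.
move=> [u [v [p q]]] [u' [v' [p' q']]].
exists (u' \o u)%FUN, (v \o v')%FUN; split.
  have := factors_freeD p (factors_free_comp u v p').
  congr factors_free; apply/funext => x /=.
  by rewrite linearB addrA subrK.
have := factors_freeD q' (factors_free_comp v' u' q).
congr factors_free; apply/funext => x /=.
by rewrite linearB addrA subrK.
Qed.

(** The endomorphism [1 - vv uu] of [F] restricts to [1 - v1 u1] on [Z]. Subtracting [b (h (p y))],
    which vanishes on [Z], makes it die under [p], so that it takes values in [Z]. A factorization
    through the given [i] is more precise than one through some projective: it says that the
    difference extends to [F]. *)
Lemma stab_syz_half Z F X Z' F' X' i p i' p' (u : {linear X -> X'})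
    (v : {linear X' -> X}) (uu : {linear F -> F'}) (vv : {linear F' -> F})
    (u1 : {linear Z -> Z'}) (v1 : {linear Z' -> Z}) :
  @ses R Z F X i p -> @ses R Z' F' X' i' p' -> projective F ->
  (forall y, p' (uu y) = u (p y)) -> (forall y, p (vv y) = v (p' y)) ->
  (forall z, i' (u1 z) = uu (i z)) -> (forall z, i (v1 z) = vv (i' z)) ->
  factors_free (fun x => x - v (u x)) ->
  exists s : {linear F -> Z}, forall z, z - v1 (u1 z) = s (i z).
Proof.
move=> S S' Fpr uuE vvE u1E v1E [h hE].
have [_ pS _] := S; have [iI _ _] := S.
have [b bE] := free_projective (@free_aug R X) pS.
pose d := (idfun \- (vv \o uu \+ (b \o (h \o p))))%R : {linear F -> F}.
have dE y : d y = y - (vv (uu y) + b (h (p y))) by [].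
have pd0 y : p (d y) = 0.
  rewrite dE linearB linearD vvE uuE bE /=.
  by rewrite -hE [v _ + _]addrC subrK subrr.
have [s sE] := ses_lift S pd0.
exists s => z; apply: iI.
by rewrite sE dE linearB v1E u1E (ses_comp S) !linear0 addr0.
Qed.

(** A form of Schanuel's lemma. The maps and both factorizations are kept as data: [stab_syz] only
    uses that they pass through projectives, whereas [extq_stab] uses that they pass through [i] and
    [i']. *)
Lemma stab_syz_maps Z F X Z' F' X' i p i' p' :
  @ses R Z F X i p -> @ses R Z' F' X' i' p' ->
  projective F -> projective F' -> stable_iso X X' ->
  exists (u1 : {linear Z -> Z'}) (v1 : {linear Z' -> Z})
    (uu : {linear F -> F'}) (vv : {linear F' -> F})
    (s : {linear F -> Z}) (s' : {linear F' -> Z'}),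
    [/\ forall z, i' (u1 z) = uu (i z), forall z, i (v1 z) = vv (i' z),
        forall z, z - v1 (u1 z) = s (i z) & forall z, z - u1 (v1 z) = s' (i' z)].
Proof.
move=> S S' Fpr F'pr [u [v [vu uv]]].
have [[_ pS _] [_ p'S _]] := (S, S').
have [uu uuE] := Fpr _ _ p' (u \o p)%FUN p'S.
have [vv vvE] := F'pr _ _ p (v \o p')%FUN pS.
have [u1 u1E] : exists u1 : {linear Z -> Z'}, forall z, i' (u1 z) = uu (i z).
  apply: (ses_lift (f := (uu \o i)%FUN) S') => z /=.
  by rewrite uuE /= (ses_comp S) linear0.
have [v1 v1E] : exists v1 : {linear Z' -> Z}, forall z, i (v1 z) = vv (i' z).
  apply: (ses_lift (f := (vv \o i')%FUN) S) => z /=.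
  by rewrite vvE /= (ses_comp S') linear0.
have [s sE] := stab_syz_half S S' Fpr uuE vvE u1E v1E vu.
have [s' s'E] := stab_syz_half S' S F'pr vvE uuE v1E u1E uv.
by exists u1, v1, uu, vv, s, s'.
Qed.

Lemma stab_syz Z F X Z' F' X' i p i' p' :
  @ses R Z F X i p -> @ses R Z' F' X' i' p' ->
  projective F -> projective F' -> stable_iso X X' -> stable_iso Z Z'.
Proof.
move=> S S' Fpr F'pr e.
have [u1 [v1 [uu [vv [s [s' [_ _ sE s'E]]]]]]] := stab_syz_maps S S' Fpr F'pr e.
by exists u1, v1; split; [exact: (factors_freeP Fpr sE) | exact: (factors_freeP F'pr s'E)].
Qed.

Lemma stab_free_syzygy X Y : stable_iso X Y -> stable_iso (free_syzygy X) (free_syzygy Y).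
Proof.
apply: stab_syz (free_syzygy_ses X) (free_syzygy_ses Y) _ _; exact: free_projective.
Qed.

Lemma stab_free_syz X Y n : stable_iso X Y -> stable_iso (free_syz X n) (free_syz Y n).
Proof. by elim: n => // n IH /IH; exact: stab_free_syzygy. Qed.

Lemma stab_ses Z F X i p :
  @ses R Z F X i p -> projective F -> stable_iso Z (free_syzygy X).
Proof.
move=> S Fpr; apply: stab_syz S (free_syzygy_ses X) Fpr _ (stab_refl X).
exact: free_projective.
Qed.

(** [X] is a retract of [Y] plus a free module: the part of the identity not seen by [v u] is
    recovered from [h]. *)
Lemma stab_projective X Y : stable_iso X Y -> projective Y -> projective X.
Proof.
move=> [u [v [[h hE] _]]] Ypr.
have iL : linear (fun x => (u x, h x)) by move=> a x y; rewrite !linearP.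
have rL : linear (fun yz : Y * {freeg X / R} => v yz.1 + free_aug yz.2).
  by move=> a x y; rewrite /= !linearP scalerDr addrACA.
apply: (projective_retract (i := Lin iL) (r := Lin rL)).
  by move=> x /=; rewrite -hE addrC subrK.
by apply: projective_pair => //; exact: free_projective.
Qed.

(** [free_syz] adds the outermost syzygy, while inductions on the projective dimension replace the
    module itself by its first syzygy. *)
Lemma free_syzS X n : free_syz X n.+1 = free_syz (free_syzygy X) n.
Proof. by elim: n => // n IH; rewrite [LHS]/= -/(free_syz X n.+1) IH. Qed.

Lemma free_syzD X n m : free_syz X (n + m) = free_syz (free_syz X n) m.
Proof. by elim: m => [|m IH]; rewrite ?addn0 // addnS /= IH. Qed.

Lemma projective_syzygy X : projective X -> projective (free_syzygy X).
Proof.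
move=> Xpr; have S := free_syzygy_ses X.
have [s sE] := Xpr _ _ (@free_aug R X) idfun (@free_aug_surj R X).
pose d := (idfun \- (s \o @free_aug R X))%R : {linear {freeg X / R} -> {freeg X / R}}.
have [r rE] : exists r : {linear {freeg X / R} -> free_syzygy X},
    forall y, val (r y) = d y.
  apply: (ses_lift S) => y; rewrite /d /= linearB /= -/(free_aug _).
  by rewrite (sE (free_aug y)) subrr.
apply: (projective_retract (i := val) (r := r)) (@free_projective R X) => z.
apply: val_inj; rewrite rE /d /= -/(free_aug _).
have -> : free_aug (val z) = 0 by exact: (ses_comp S).
by rewrite linear0 subr0.
Qed.

Lemma projective_free_syz X n m : (n <= m)%N ->
  projective (free_syz X n) -> projective (free_syz X m).
Proof.
move=> /subnKC <-; elim: (m - n)%N => [|d IH]; rewrite ?addn0 // addnS => P.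
by apply: projective_syzygy; exact: IH.
Qed.

Definition finite_pd X := exists n, projective (free_syz X n).

Definition ev_stable_iso X Y := exists n, stable_iso (free_syz X n) (free_syz Y n).

Lemma ev_stab_le X Y n m : (n <= m)%N ->
  stable_iso (free_syz X n) (free_syz Y n) -> stable_iso (free_syz X m) (free_syz Y m).
Proof. by move=> /subnKC <- e; rewrite !free_syzD; exact: stab_free_syz. Qed.

Lemma ev_stab_sym X Y : ev_stable_iso X Y -> ev_stable_iso Y X.
Proof. by move=> [n e]; exists n; exact: stab_sym. Qed.

Lemma stab_ev X Y : stable_iso X Y -> ev_stable_iso X Y.
Proof. by exists 0%N. Qed.

(** The kernel [U] of the composite of the free cover of [X'] with [p] is a syzygy of [X], and it is
    an extension of the projective [Z] by the syzygy of [X']. That extension splits. *)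
Lemma ev_stab_ses0 Z X' X i p : @ses R Z X' X i p -> projective Z ->
  stable_iso (free_syzygy X') (free_syzygy X).
Proof.
move=> S Zpr; have [iI pS e] := S.
pose q := (p \o @free_aug R X')%FUN : {linear {freeg X' / R} -> X}.
have qS x : exists y, q y = x.
  have [x' <-] := pS x; have [y <-] := free_aug_surj x'; by exists y.
have S1 := ses_kernel qS; set U : lmodType R := submod_of (kernel q) in S1.
apply: stab_trans (stab_ses S1 (@free_projective R X')).
have S2 := free_syzygy_ses X'.
have [t tE] : exists t : {linear U -> Z}, forall y, i (t y) = free_aug (val y).
  by apply: (ses_lift (f := (@free_aug R X' \o (val : {linear U -> _}))%FUN) S) => y;
    exact: (submod_ofP y).
have tS z : exists y, t y = z.
  have [y yE] := free_aug_surj (i z).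
  have qy : q y = 0 by rewrite /q /= -/(free_aug _) yE (ses_comp S).
  exists (mk_submod (S := kernel q) qy); apply: iI; rewrite tE; exact: yE.
have [s sE] := Zpr _ _ t idfun tS.
have [j jE] : exists j : {linear free_syzygy X' -> U}, forall y, val (j y) = val y.
  apply: (ses_lift (f := (val : {linear free_syzygy X' -> _})) S1) => y.
  by rewrite /q /= -/(free_aug _) (ses_comp S2) linear0.
pose d := ((val : {linear U -> _}) \o (idfun \- (s \o t)))%FUN : {linear U -> _}.
have [v vE] : exists v : {linear U -> free_syzygy X'}, forall y, val (v y) = d y.
  apply: (ses_lift S2) => y; rewrite /d /= -/(free_aug _) linearB.
  have au (w : U) : free_aug (val w) = i (t w) by rewrite tE.
  apply/eqP; rewrite subr_eq0; apply/eqP.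
  by rewrite [LHS]au [RHS]au sE.
(* Here [v j] is the identity, and [1 - j v = s t] passes through the projective [Z]. *)
exists j, v; split.
  exists \0%R => y; rewrite linear0; apply/eqP; rewrite subr_eq0; apply/eqP.
  apply: val_inj; rewrite vE /d /= jE.
  have -> : t (j y) = 0.
    by apply: iI; rewrite tE jE linear0; exact: (ses_comp S2).
  by rewrite linear0 subr0.
apply: (factors_freeP (a := t) (b := s) Zpr) => y.
apply: val_inj; rewrite linearB /= jE vE /d /=.
by rewrite opprB addrC subrK.
Qed.

(** Induction on the projective dimension of [Z]: the horseshoe construction replaces the sequence
    by one of first syzygies, in which the kernel has smaller projective dimension. *)
Lemma ev_stab_ses Z X' X i p : @ses R Z X' X i p -> finite_pd Z -> ev_stable_iso X' X.
Proof.
move=> S [n]; elim: n Z X' X i p S => [|n IH] Z X' X i p S.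
  (* One syzygy cannot be avoided: if [X'] is projective too, [X] may still fail to be
     projective. *)
  by move=> Zpr; exists 1%N; exact: (ev_stab_ses0 S).
rewrite free_syzS => Zn.
have [iI pS e] := S.
have [l lE] := free_projective (@free_aug R X) pS.
(* The free covers of [Z] and [X] together cover [X']. The kernel [K] of [q] is a syzygy of [X'] up
   to projectives, and [j], [t] below make it an extension of the syzygy of [X] by the syzygy of
   [Z]. *)
pose q := ((i \o (@free_aug R Z \o fst)) \+ (l \o snd))%R
  : {linear ({freeg Z / R} * {freeg X / R})%type -> X'}.
have qE a b : q (a, b) = i (free_aug a) + l b by [].
have qS x' : exists y, q y = x'.
  have [b bE] := free_aug_surj (p x').
  have : p (x' - l b) = 0 by rewrite linearB lE /= -bE subrr.
  move/e => [z zE]; have [a aE] := free_aug_surj z.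
  by exists (a, b); rewrite qE aE -zE subrK.
have S1 := ses_kernel qS; set K : lmodType R := submod_of (kernel q) in S1.
have Fpr : projective ({freeg Z / R} * {freeg X / R})%type.
  by apply: projective_pair; exact: free_projective.
have SX := free_syzygy_ses X; have SZ := free_syzygy_ses Z.
have fL : linear (fun z : free_syzygy Z => (val z, 0) : {freeg Z / R} * {freeg X / R}).
  by move=> a u v; congr (_, _); rewrite /= ?scaler0 ?addr0.
have [j jE] : exists j : {linear free_syzygy Z -> K}, forall z, val (j z) = (val z, 0).
  apply: (ses_lift (f := Lin fL) S1) => z.
  have -> : q (Lin fL z) = i (free_aug (val z)) + l 0 by [].
  by rewrite [free_aug _](ses_comp SZ) !linear0 addr0.
have [t tE] : exists t : {linear K -> free_syzygy X}, forall y, val (t y) = (val y).2.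
  apply: (ses_lift (f := (snd \o (val : {linear K -> _}))%FUN) SX) => y /=.
  have := submod_ofP y; rewrite /= -/(q _); case: (val y) => a b /= ab.
  move/eqP: ab; rewrite addrC addr_eq0 => /eqP lb.
  have <- : p (l b) = free_aug b := lE b.
  by rewrite lb linearN (ses_comp S) oppr0.
have S3 : ses j t.
  split.
  - move=> z z' /(congr1 val); rewrite !jE => -[]; exact: val_inj.
  - move=> x; have : p (l (val x)) = 0 by rewrite lE (ses_comp SX).
    move/e => [z zE]; have [a aE] := free_aug_surj (- z).
    have qy : q (a, val x) = 0 by rewrite qE aE zE -linearD addNr linear0.
    by exists (mk_submod (S := kernel q) qy); apply: val_inj; rewrite tE.
  move=> y; split=> [ty|[z ->]]; last by apply: val_inj; rewrite tE jE linear0.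
  have y2 : (val y).2 = 0 by rewrite -tE ty linear0.
  have : free_aug (val y).1 = 0.
    apply: iI; rewrite linear0; have qy : q (val y) = 0 := submod_ofP y.
    have qE' ab : q ab = i (free_aug ab.1) + l ab.2 by [].
    by move: qy; rewrite qE' y2 linear0 addr0.
  move=> y1; exists (mk_submod (S := kernel (@free_aug R Z)) y1).
  by apply: val_inj; rewrite jE /= -y2 -surjective_pairing.
have [m em] := IH _ _ _ _ _ S3 Zn.
exists m.+1; rewrite !free_syzS; apply: stab_trans em.
by apply/stab_free_syz/stab_sym/(stab_ses S1).
Qed.

Lemma fpd_projective X : projective X -> finite_pd X.
Proof. by exists 0%N. Qed.

Lemma fpd_ev X Y : ev_stable_iso X Y -> finite_pd Y -> finite_pd X.
Proof.
move=> [n e] [m pr]; exists (maxn n m).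
apply: stab_projective (ev_stab_le (leq_maxl n m) e) _.
exact: projective_free_syz (leq_maxr n m) pr.
Qed.

Lemma fpd_iso X Y (u : {linear X -> Y}) (v : {linear Y -> X}) :
  cancel u v -> cancel v u -> finite_pd Y -> finite_pd X.
Proof. by move=> uK vK; apply/fpd_ev/stab_ev/(stab_iso uK vK). Qed.

Lemma fpd_ses Z F X i p : @ses R Z F X i p -> finite_pd Z -> finite_pd F -> finite_pd X.
Proof. by move=> S Zf; apply/fpd_ev/ev_stab_sym/(ev_stab_ses S). Qed.

Lemma fpd_le X n : projective (free_syz X n) ->
  forall m, (n <= m)%N -> projective (free_syz X m).
Proof. by move=> pr m nm; exact: projective_free_syz pr. Qed.

End Stable.

Lemma dirsum_ses (R : pzRingType) (I : finType) (Z F X : I -> lmodType R)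
    (i : forall a, {linear Z a -> F a}) (p : forall a, {linear F a -> X a}) :
  (forall a, ses (i a) (p a)) ->
  exists (i' : {linear dirsum Z -> dirsum F}) (p' : {linear dirsum F -> dirsum X}),
    [/\ ses i' p', forall z a, i' z a = i a (z a) & forall y a, p' y a = p a (y a)].
Proof.
move=> S.
have iL : linear ((fun z a => i a (z a)) : dirsum Z -> dirsum F).
  by move=> c u v; apply: functional_extensionality_dep => a; exact: linearP.
have pL : linear ((fun y a => p a (y a)) : dirsum F -> dirsum X).
  by move=> c u v; apply: functional_extensionality_dep => a; exact: linearP.
exists (Lin iL), (Lin pL); split=> //; split.
- move=> z z' /= e; apply: functional_extensionality_dep => a.
  have [iI _ _] := S a; apply: iI; exact: (congr1 (fun f => f a) e).
- move=> x; have H a : exists y, p a y = x a by have [_ + _] := S a; exact.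
  exists (fun a => projT1 (cid (H a))); apply: functional_extensionality_dep => a /=.
  exact: (projT2 (cid (H a))).
move=> y; split=> [y0|[z ->]].
  have H a : exists z, y a = i a z.
    have [_ _ e] := S a; apply/e; exact: (congr1 (fun f : dirsum X => f a) y0).
  exists (fun a => projT1 (cid (H a))); apply: functional_extensionality_dep => a /=.
  exact: (projT2 (cid (H a))).
by apply: functional_extensionality_dep => a /=; rewrite (ses_comp (S a)).
Qed.

(** Finiteness of [I] gives one bound for all summands, and the induction takes syzygies of all of
    them at once. *)
Lemma fpd_dirsum (R : nzRingType) (I : finType) (X : I -> lmodType R) :
  (forall a, finite_pd (X a)) -> finite_pd (dirsum X : lmodType R).
Proof.
move=> Xf.
have [n] : exists n, forall a, projective (free_syz (X a) n).
  exists (\max_a projT1 (cid (Xf a))) => a; apply: fpd_le (projT2 (cid (Xf a))) _ _.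
  exact: (leq_bigmax (F := fun a => projT1 (cid (Xf a)))).
elim: n X {Xf} => [|n IH] X Xpr; first exact/fpd_projective/projective_dirsum.
have [i [p [S _ _]]] := dirsum_ses (fun a => free_syzygy_ses (X a)).
apply: (fpd_ses S); last first.
  by apply/fpd_projective/projective_dirsum => a; exact: free_projective.
by apply: IH => a; rewrite -free_syzS.
Qed.

(** * Ext and stable isomorphism *)

Section Iso.
Variable R : pzRingType.
Implicit Types V W : lmodType R.

Lemma lmod_iso_inj_surj V W (f : {linear V -> W}) :
  injective f -> (forall w, exists v, f v = w) -> lmod_iso V W.
Proof.
move=> fI fS; exists f.
have gK w : f (projT1 (cid (fS w))) = w := projT2 (cid (fS w)).
exists (fun w => projT1 (cid (fS w))) => v; last exact: gK.
by apply: fI; rewrite gK.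
Qed.

Lemma lmod_iso_sym V W : lmod_iso V W -> lmod_iso W V.
Proof.
move=> [f [g fK gK]].
have gL : linear g by move=> a u v; rewrite -[u in LHS]gK -[v in LHS]gK -linearP fK.
by exists (Lin gL); exists f.
Qed.

Lemma lmod_iso_trans U V W : lmod_iso U V -> lmod_iso V W -> @lmod_iso R U W.
Proof. by move=> [f fB] [g gB]; exists (g \o f)%FUN; exact: bij_comp. Qed.

Lemma lmod_iso_pair V W V' W' :
  lmod_iso V V' -> lmod_iso W W' -> @lmod_iso R (V * W)%type (V' * W')%type.
Proof.
move=> [f [f' fK f'K]] [g [g' gK g'K]].
have hL : linear (fun p : V * W => (f p.1, g p.2)).
  by move=> a u v /=; rewrite !linearP.
exists (Lin hL); exists (fun p => (f' p.1, g' p.2)) => -[x y] /=.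
  by rewrite fK gK.
by rewrite f'K g'K.
Qed.

Lemma qproj_surj V (S : submod V) q : exists v, qproj S v = q.
Proof. by exists (qrepr q); exact: qreprK. Qed.

Lemma qproj_eq0 V (S : submod V) v : qproj S v = 0 <-> smem S v.
Proof.
have q0 : qproj S 0 = 0 := linear0 (qproj S).
by have := qprojP S v 0; rewrite subr0 q0.
Qed.

Lemma quot_iso V W (S : submod V) (a : {linear V -> W}) :
  (forall w, exists v, a v = w) -> (forall v, a v = 0 <-> smem S v) ->
  lmod_iso (quotmod S) W.
Proof.
move=> aS aE.
have [f fE] : exists f : {linear quotmod S -> W}, forall v, f (qproj S v) = a v.
  by apply: surj_desc; [exact: qproj_surj | move=> v /qproj_eq0/aE].
apply: (lmod_iso_inj_surj (f := f)) => [p q|w].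
  have [[u <-] [v <-]] := (qproj_surj p, qproj_surj q).
  rewrite !fE => e; apply/qprojP/aE.
  by rewrite linearB e subrr.
by have [v <-] := aS w; exists (qproj S v).
Qed.

Lemma quot_quot_iso V W (S : submod V) (T : submod W) (a : {linear V -> W}) :
  (forall w, exists v t, smem T t /\ w = a v + t) ->
  (forall v, smem T (a v) <-> smem S v) -> lmod_iso (quotmod S) (quotmod T).
Proof.
move=> aS aE; apply: (quot_iso (a := (qproj T \o a)%FUN)) => [q|v].
  have [w <-] := qproj_surj q; have [v [t [/qproj_eq0 t0 ->]]] := aS w.
  by exists v; rewrite qprojD t0 addr0.
by rewrite -aE; exact: qproj_eq0.
Qed.

End Iso.

Lemma submod_valP (R : pzRingType) (V : lmodType R) (S : submod V) (c : R)
    (x y : submod_of S) :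
  val (c *: x + y) = c *: val x + val y.
Proof. by []. Qed.

Section HomLin.
Variables (k : fieldType) (R : algType k).
Implicit Types X Y Z F : lmodType R.

Definition hom_lin X Y (f : hom X Y) : {linear X -> Y} := Lin (submod_ofP f).

Definition lin_hom X Y (f : {linear X -> Y}) : hom X Y :=
  @mk_submod k _ (hom_submod X Y) f (linearP f).

Lemma hom_eq X Y (f g : hom X Y) : val f =1 val g -> f = g.
Proof. by move=> e; apply: val_inj; apply/funext. Qed.

Lemma hom_valP X Y (c : k) (f g : hom X Y) x :
  val (c *: f + g) x = (GRing.in_alg R c *: (val f x : Y) + val g x : Y).
Proof. exact: (congr1 (@^~ x) (submod_valP c f g)). Qed.

Section ExtQuotient.
Variables (Z F Y : lmodType R) (i : {linear Z -> F}).

Definition extendable (h : hom Z Y) := exists g : hom F Y, h = precomp Y i g.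

Fact extendable0 : extendable 0.
Proof. by exists 0; rewrite linear0. Qed.
Fact extendableD g h : extendable g -> extendable h -> extendable (g + h).
Proof. by move=> [g' ->] [h' ->]; exists (g' + h'); rewrite linearD. Qed.
Fact extendableZ (c : k) h : extendable h -> extendable (c *: h).
Proof. by move=> [h' ->]; exists (c *: h'); rewrite linearZ. Qed.

Definition ext_submod : submod (hom Z Y) :=
  @Submod k (hom Z Y) extendable extendable0 extendableD extendableZ.
(** The cokernel of the restriction from [Hom(F, Y)] to [Hom(Z, Y)]. For [F] projective and [Z] the
    kernel of a surjection of [F] onto [X], it is [Ext^1(X, Y)]. *)
Definition extq : lmodType k := quotmod ext_submod.

End ExtQuotient.

Arguments ext_submod {Z F} Y i.
Arguments extq {Z F} Y i.

(** A map out of [Z] differs from its round trip through [Z'] by one that factors through [i], hence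
    extends to [F]; [uu] and [vv] carry extendable maps to extendable maps. *)
Lemma extq_stab Z F X Z' F' X' i p i' p' Y :
  @ses R Z F X i p -> @ses R Z' F' X' i' p' ->
  projective F -> projective F' -> stable_iso X X' -> lmod_iso (extq Y i) (extq Y i').
Proof.
move=> S S' Fpr F'pr e.
have [u1 [v1 [uu [vv [s [s' [u1E v1E sE s'E]]]]]]] := stab_syz_maps S S' Fpr F'pr e.
apply: (@quot_quot_iso k _ _ (ext_submod Y i) (ext_submod Y i') (precomp Y v1)) => [w|h].
  exists (precomp Y u1 w), (precomp Y i' (precomp Y s' w)).
  split; first by exists (precomp Y s' w).
  apply: hom_eq => z /=; rewrite -[z in LHS](subrK (u1 (v1 z))) s'E addrC.
  exact: (linearD (hom_lin w) (u1 (v1 z)) (s' (i' z))).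
split=> [[g gE]|[g ->]].
  exists (precomp Y uu g + precomp Y s h); apply: hom_eq => z /=.
  rewrite -[z in LHS](subrK (v1 (u1 z))) sE.
  have /= -> := linearD (hom_lin h) (s (i z)) (v1 (u1 z)).
  rewrite addrC; congr (_ + _).
  have /= := congr1 (fun f : hom Z' Y => val f (u1 z)) gE.
  by rewrite u1E.
exists (precomp Y vv g); apply: hom_eq => z /=.
by rewrite v1E.
Qed.

(** Dimension shifting, read off from the complex: a cocycle in degree [n.+1] kills the image of the
    next term, so it is a map out of the syzygy [Z], and it is a coboundary when this map extends
    along the inclusion of [Z] into the n-th term. *)
Lemma Ext_succ n X Y :
  lmod_iso (Ext n.+1 X Y)
    (extq Y (val : {linear free_syzygy (free_syz X n) -> free_term X n})).
Proof.
apply: lmod_iso_sym.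
set Z := free_syzygy _.
pose aug : {linear free_term X n.+1 -> Z} := @free_aug R Z.
have augS x : exists y, aug y = x := @free_aug_surj R Z x.
have aug0 y : aug y = 0 <-> exists q, y = free_diff X n.+1 q.
  rewrite -free_exactS; have -> : free_diff X n y = val (aug y) by [].
  by split=> [->|v0] //; exact: val_inj.
pose delta j : {linear hom (free_term X j) Y -> hom (free_term X j.+1) Y} :=
  precomp Y (free_diff X j).
change (lmod_iso (extq Y (val : {linear Z -> free_term X n})) (cohomology delta n.+1)).
have zcl (h : hom Z Y) : delta n.+1 (precomp Y aug h) = 0.
  apply: hom_eq => y /=.
  have /= -> : aug (free_diff X n.+1 y) = 0 by apply/aug0; exists y.
  exact: (linear0 (hom_lin h)).
pose a (h : hom Z Y) : cocycles delta n.+1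
  := mk_submod (S := kernel _) (zcl h).
have aL : linear a by move=> c u v; apply: val_inj; apply: hom_eq.
apply: (@quot_quot_iso k _ _ (ext_submod Y _) (coboundaries delta n.+1) (Lin aL)) => [w|h].
  have [h hE] : exists h : {linear Z -> Y}, forall y, h (aug y) = val (val w) y.
    apply: (surj_desc (f := hom_lin (val w)) augS) => y /aug0 [q ->].
    have /= := submod_ofP w => /(congr1 (fun f : hom _ Y => val f q)).
    by [].
  exists (lin_hom h), 0; split; first exact: smem0.
  rewrite addr0; apply: val_inj; apply: hom_eq => y /=.
  by rewrite -hE.
split=> /= [[g gE]|[g ->]].
  exists g; apply: hom_eq => z; have [y <-] := augS z.
  have /= := congr1 (fun f : hom _ Y => val f y) gE.
  by [].
by exists g; apply: hom_eq.
Qed.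

Lemma Ext_stab n X X' Y : stable_iso (free_syz X n) (free_syz X' n) ->
  lmod_iso (Ext n.+1 X Y) (Ext n.+1 X' Y).
Proof.
move=> e; apply: lmod_iso_trans (Ext_succ n X Y) _.
apply: lmod_iso_trans (lmod_iso_sym (Ext_succ n X' Y)).
apply: extq_stab (free_syzygy_ses _) (free_syzygy_ses _) _ _ e; exact: free_projective.
Qed.

(** The bound is chosen before [Y], so it survives every later change of coefficients. *)
Lemma Ext_ev_stab X X' : ev_stable_iso X X' ->
  exists h, forall n, (h <= n)%N -> forall Y, lmod_iso (Ext n X Y) (Ext n X' Y).
Proof.
move=> [h e]; exists h.+1 => -[|n] // hn Y.
by apply: Ext_stab; exact: ev_stab_le e.
Qed.

Lemma ses_pair Z F X Z' F' X' i p i' p' :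
  @ses R Z F X i p -> @ses R Z' F' X' i' p' ->
  exists (j : {linear (Z * Z')%type -> (F * F')%type})
    (q : {linear (F * F')%type -> (X * X')%type}),
    ses j q /\ forall z z', j (z, z') = (i z, i' z').
Proof.
move=> [iI pS e] [i'I p'S e'].
have jL : linear (fun z : Z * Z' => (i z.1, i' z.2)) by move=> a u v /=; rewrite !linearP.
have qL : linear (fun z : F * F' => (p z.1, p' z.2)) by move=> a u v /=; rewrite !linearP.
exists (Lin jL), (Lin qL); split=> //; split.
- by move=> [a b] [c d] [/iI -> /i'I ->].
- by move=> [x x']; have [[y <-] [y' <-]] := (pS x, p'S x'); exists (y, y').
move=> [y y']; split=> /= [[/e [z ->] /e' [z' ->]]|[[z z'] [-> ->]]].
  by exists (z, z').
by congr (_, _); [apply/e; exists z | apply/e'; exists z'].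
Qed.

Lemma stab_free_syz_pair X X' n :
  stable_iso (free_syz (X * X')%type n) (free_syz X n * free_syz X' n)%type.
Proof.
elim: n => [|n IH]; first exact: stab_refl.
have [j [q [S _]]] := ses_pair (free_syzygy_ses (free_syz X n)) (free_syzygy_ses (free_syz X' n)).
apply: stab_syz (free_syzygy_ses _) S _ _ IH; first exact: free_projective.
by apply: projective_pair; exact: free_projective.
Qed.

(** By [extq_stab] the sum of the two syzygy sequences may stand in for the standard sequence of
    [X * X']; for this sum, maps and extendable maps both split into components. *)
Lemma Ext_pair n X X' Y :
  lmod_iso (Ext n.+1 (X * X')%type Y) (Ext n.+1 X Y * Ext n.+1 X' Y)%type.
Proof.
apply: lmod_iso_trans (Ext_succ _ _ _) _.
apply: lmod_iso_trans; last first.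
  exact: lmod_iso_pair (lmod_iso_sym (Ext_succ n X Y)) (lmod_iso_sym (Ext_succ n X' Y)).
have [j [q [S jE]]] := ses_pair (free_syzygy_ses (free_syz X n)) (free_syzygy_ses (free_syz X' n)).
set Z := free_syzygy (free_syz X n) in j S jE *.
set Z' := free_syzygy (free_syz X' n) in j S jE *.
set F := free_term X n; set F' := free_term X' n.
apply: lmod_iso_trans.
  apply: extq_stab (free_syzygy_ses _) S _ _ (stab_free_syz_pair X X' n).
    exact: free_projective.
  by apply: projective_pair; exact: free_projective.
have in1L (U V : lmodType R) : linear (fun u : U => (u, 0) : U * V).
  by move=> a u v; congr (_, _); rewrite /= scaler0 addr0.
have in2L (U V : lmodType R) : linear (fun u : V => (0, u) : U * V).
  by move=> a u v; congr (_, _); rewrite /= scaler0 addr0.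
pose a1 := (qproj (ext_submod Y (val : {linear Z -> F})) \o
  precomp Y (Lin (in1L Z Z')))%FUN : {linear hom (Z * Z')%type Y -> _}.
pose a2 := (qproj (ext_submod Y (val : {linear Z' -> F'})) \o
  precomp Y (Lin (in2L Z Z')))%FUN : {linear hom (Z * Z')%type Y -> _}.
have aL : linear (fun h => (a1 h, a2 h)).
  by move=> c u v; congr (_, _); exact: linearP.
have pair_lin (U V : lmodType R) (f : hom U Y) (g : hom V Y) :
    linear (fun uv : U * V => hom_lin f uv.1 + hom_lin g uv.2).
  move=> c u v; rewrite scalerDr addrACA; congr (_ + _); exact: linearP.
apply: (@quot_iso k _ _ (ext_submod Y j) (Lin aL)) => [[w w']|h].
  have [[f <-] [f' <-]] := (qproj_surj w, qproj_surj w').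
  exists (lin_hom (Lin (pair_lin _ _ f f'))).
  congr (_, _); congr (qproj (ext_submod Y _) _).
    by apply: hom_eq => z /=; rewrite [val f' 0](linear0 (hom_lin f')) addr0.
  by apply: hom_eq => z /=; rewrite [val f 0](linear0 (hom_lin f)) add0r.
split=> [|[g ->]].
  case=> /(qproj_eq0 (ext_submod Y _)) [f fE] /(qproj_eq0 (ext_submod Y _)) [f' f'E].
  exists (lin_hom (Lin (pair_lin _ _ f f'))); apply: hom_eq => -[z z'] /=.
  rewrite jE /=.
  have /= <- := congr1 (fun f : hom _ Y => val f z) fE.
  have /= <- := congr1 (fun f : hom _ Y => val f z') f'E.
  have /= <- := linearD (hom_lin h) (z, 0) (0, z').
  by congr (val h (_, _)); rewrite /= ?addr0 ?add0r.
congr (_, _); apply/(qproj_eq0 (ext_submod Y _)).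
  exists (precomp Y (Lin (in1L F F')) g); apply: hom_eq => z /=.
  by rewrite jE linear0.
exists (precomp Y (Lin (in2L F F')) g); apply: hom_eq => z /=.
by rewrite jE linear0.
Qed.

End HomLin.

Arguments ext_submod {k R Z F} Y i.
Arguments extq {k R Z F} Y i.

(** * Transport of Ext along an adjunction *)

Section Adjunction.
Variables (k : fieldType) (S R : algType k).
Variable Phi : lmodType S -> lmodType R.
Variables (Y : lmodType R) (Y' : lmodType S).
Variable tau : forall X, {linear hom (Phi X) Y -> hom X Y'}.
Hypothesis tauI : forall X, injective (tau X).
Hypothesis tauS : forall X g, exists f, tau X f = g.
Hypothesis Phi_proj : forall X, projective X -> projective (Phi X).
Hypothesis Phi_ses : forall (Z F X : lmodType S) (i : {linear Z -> F}) (p : {linear F -> X}),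
  ses i p -> exists (i' : {linear Phi Z -> Phi F}) (p' : {linear Phi F -> Phi X}),
    ses i' p' /\ forall g, tau Z (precomp Y i' g) = precomp Y' i (tau F g).

Lemma stab_free_syz_adj X n : stable_iso (free_syz (Phi X) n) (Phi (free_syz X n)).
Proof.
elim: n => [|n IH]; first exact: stab_refl.
have [i [p [ses_ip _]]] := Phi_ses (free_syzygy_ses (free_syz X n)).
apply: stab_syz (free_syzygy_ses _) ses_ip _ _ IH; first exact: free_projective.
by apply: Phi_proj; exact: free_projective.
Qed.

(** [Phi] turns the syzygy sequence of [X] into one that computes Ext of [Phi X], and [tau] matches
    both Hom and the extendable maps. Hence [Phi] is only required on objects and on short exact
    sequences, and naturality of [tau] only along their first map. *)
Lemma Ext_adjoint X n : lmod_iso (Ext n.+1 (Phi X) Y) (Ext n.+1 X Y').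
Proof.
apply: lmod_iso_trans (Ext_succ _ _ _) _.
apply: lmod_iso_trans (lmod_iso_sym (Ext_succ n X Y')).
have [i [p [ses_ip iE]]] := Phi_ses (free_syzygy_ses (free_syz X n)).
apply: lmod_iso_trans.
  apply: extq_stab (free_syzygy_ses _) ses_ip _ _ (stab_free_syz_adj X n).
    exact: free_projective.
  by apply: Phi_proj; exact: free_projective.
apply: (@quot_quot_iso k _ _ (ext_submod Y i) (ext_submod Y' (val : {linear free_syzygy (free_syz X n) -> free_term X n})) (tau _)) => [g|f].
  by have [f <-] := tauS g; exists f, 0; rewrite addr0; split=> //; exact: smem0.
split=> [[g]|[g ->]]; last by exists (tau _ g); rewrite iE.
have [g' <-] := tauS g; rewrite -iE => /tauI ->.
by exists g'.
Qed.

End Adjunction.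

(** * Tensor products over a field *)

Lemma additive0 (U V : zmodType) (f : U -> V) : {morph f : x y / x + y} -> f 0 = 0.
Proof. by move=> fD; apply: (addrI (f 0)); rewrite -fD !addr0. Qed.

Section VectorSpaces.
Variable k : fieldType.
Implicit Types U V W X : lmodType k.

(* A maximal subspace meeting the kernel trivially is a complement of it. *)
Lemma linear_section V W (g : {linear V -> W}) :
  (forall w, exists v, g v = w) -> exists s : {linear W -> V}, cancel s g.
Proof.
move=> gS.
pose P (D : set V) := (forall c u v, D u -> D v -> D (c *: u + v)) /\
  (forall u, D u -> g u = 0 -> u = 0).
have [D [[Dl D0] Dmax]] : exists D, P D /\ forall B, (D `<` B)%classic -> ~ P B.
  apply: Zorn_bigcup => FF FP Ftot; split=> [c u v [A FA Au] [B FB Bv]|u [A FA Au]].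
    have [AB|BA] := Ftot _ _ FA FB.
      by exists B => //; apply: (FP _ FB).1 => //; exact: AB.
    by exists A => //; apply: (FP _ FA).1 => //; exact: BA.
  exact: (FP _ FA).2.
have Dfull v : exists2 d, D d & g d = g v.
  apply: contrapT => H.
  (* The alternative [d = 0] is listed separately because a maximal [D] is not yet known to be
     inhabited: the empty set also satisfies [P], as the union of an empty chain must. That case is
     excluded at the end by comparison with the zero subspace. *)
  pose B := [set u | exists c d, (D d \/ d = 0) /\ u = c *: v + d]%classic.
  have Dl' c d d' : D d \/ d = 0 -> D d' \/ d' = 0 -> D (c *: d + d') \/ c *: d + d' = 0.
    have Dz x : D x -> D 0 by move=> Dx; rewrite -(addNr x) -scaleN1r; exact: Dl.
    move=> [Dd|->] [Dd'|->]; rewrite ?scaler0 ?addr0 ?add0r; try by [left|right].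
      by left; exact: Dl.
    by left; rewrite -[_ *: _]addr0; apply: Dl => //; exact: Dz Dd.
  apply: (Dmax B); first split=> [u Du|Bsub].
  - by exists 0, u; rewrite scale0r add0r; split=> //; left.
  - have Bv : B v by exists 1, 0; rewrite scale1r addr0; split=> //; right.
    by apply: H; exists v => //; exact: Bsub.
  split=> [c u w [a [d [Dd ->]]] [b [d' [Dd' ->]]]|u [a [d [Dd ->]]]].
    exists (c * a + b), (c *: d + d'); split; first exact: Dl'.
    by rewrite scalerDl scalerDr scalerA addrACA.
  rewrite linearD linearZ /= => /eqP; rewrite addr_eq0 => /eqP e.
  have [a0|a0] := eqVneq a 0.
    move: e; rewrite a0 !scale0r add0r => /esym/eqP; rewrite oppr_eq0 => /eqP gd.
    by case: Dd => // Dd; exact: D0.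
  case: H; have {}e : g v = g (- a^-1 *: d).
    by rewrite linearZ /= scaleNr -scalerN -e scalerA mulVf // scale1r.
  case: Dd => [Dd|d0].
    exists (- a^-1 *: d) => //; rewrite -[_ *: _]addr0; apply: (Dl _ _ _ Dd).
    by rewrite -(addNr d) -scaleN1r; exact: Dl.
  have gv0 : g v = 0 by rewrite e d0 scaler0 linear0.
  have [[x Dx]|nD] := pselect (exists x, D x).
    exists 0; last by rewrite gv0 linear0.
    by rewrite -(addNr x) -scaleN1r; exact: Dl.
  exfalso; apply: (Dmax [set 0]%classic).
    split=> [x Dx|sub]; last by apply: nD; exists 0; exact: sub.
    by case: nD; exists x.
  by split=> [c x y -> ->|x ->] //; rewrite /= scaler0 addr0.
have sP w : exists d, D d /\ g d = w.
  by have [v <-] := gS w; have [d Dd e] := Dfull v; exists d.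
pose s w := projT1 (cid (sP w)).
have sD w : D (s w) := (projT2 (cid (sP w))).1.
have sK w : g (s w) = w := (projT2 (cid (sP w))).2.
have sL : linear s.
  move=> c u v; apply/eqP; rewrite -subr_eq0; apply/eqP; apply: D0.
    by rewrite [_ - _]addrC -scaleN1r; exact: (Dl _ _ _ (Dl _ _ _ (sD u) (sD v)) (sD _)).
  by rewrite linearB linearP !sK subrr.
by exists (Lin sL) => w; exact: sK.
Qed.

Lemma projective_field V : projective V.
Proof.
move=> U W g f gS; have [s sK] := linear_section gS.
by exists (s \o f)%FUN => v; rewrite /= sK.
Qed.

Lemma ses_split U V W (i : {linear U -> V}) (p : {linear V -> W}) : ses i p ->
  exists (r : {linear V -> U}) (s : {linear W -> V}),
    [/\ cancel i r, cancel s p & forall v, v = i (r v) + s (p v)].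
Proof.
move=> S; have [iI pS e] := S; have [s sK] := linear_section pS.
have [r rE] : exists r : {linear V -> U}, forall v, i (r v) = (idfun \- (s \o p))%R v.
  by apply: (ses_lift (f := (idfun \- (s \o p))%R) S) => v /=; rewrite linearB /= sK subrr.
exists r, s; split=> // [u|v]; last by rewrite rE /= subrK.
by apply: iI; rewrite rE /= (ses_comp S) linear0 subr0.
Qed.

Fact image0 U V (f : {linear U -> V}) : exists u, 0 = f u.
Proof. by exists 0; rewrite linear0. Qed.
Fact imageD U V (f : {linear U -> V}) (x y : V) :
  (exists u, x = f u) -> (exists u, y = f u) -> exists u, x + y = f u.
Proof. by move=> [u ->] [v ->]; exists (u + v); rewrite linearD. Qed.
Fact imageZ U V (f : {linear U -> V}) (c : k) (x : V) :
  (exists u, x = f u) -> exists u, c *: x = f u.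
Proof. by move=> [u ->]; exists (c *: u); rewrite linearZ. Qed.

Definition image_submod U V (f : {linear U -> V}) : submod V :=
  Submod (image0 f) (@imageD U V f) (@imageZ U V f).

Lemma linear_retraction U V (i : {linear U -> V}) :
  injective i -> exists r : {linear V -> U}, cancel i r.
Proof.
move=> iI; have S : ses i (qproj (image_submod i)).
  by split=> // [x|y]; [exact: qproj_surj | rewrite qproj_eq0].
by have [r [_ [iK _ _]]] := ses_split S; exists r.
Qed.

Lemma tens0l U V (v : V) : tens (0 : U) v = 0.
Proof. by rewrite -(scale0r 0) tensZl scale0r. Qed.

Lemma tens0r U V (u : U) : tens u (0 : V) = 0.
Proof. by rewrite -(scale0r 0) tensZr scale0r. Qed.

Lemma tensor_additive_ext U V (W : zmodType) (f g : tensor U V -> W) :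
  {morph f : x y / x + y} -> {morph g : x y / x + y} ->
  (forall u v, f (tens u v) = g (tens u v)) -> f =1 g.
Proof.
move=> fD gD e t; elim/tensor_ind: t => [|s t Es Et|//].
  by rewrite (additive0 fD) (additive0 gD).
by rewrite fD gD Es Et.
Qed.

Lemma tmap_bilin U V U' V' (f : {linear U -> U'}) (g : {linear V -> V'}) :
  bilinear_map (fun u v => tens (f u) (g v)).
Proof.
by split=> [v c u u'|u c v v'] /=; rewrite linearP (tensDl, tensDr) (tensZl, tensZr).
Qed.

Definition tmap U V U' V' (f : {linear U -> U'}) (g : {linear V -> V'})
    (t : tensor U V) : tensor U' V' :=
  tlift (fun u v => tens (f u) (g v)) t.

HB.instance Definition _ U V U' V' (f : {linear U -> U'}) (g : {linear V -> V'}) :=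
  GRing.isLinear.Build k (tensor U V) (tensor U' V') *:%R (tmap f g)
    (tlift_linear (tmap_bilin f g)).

Lemma tmap_tens U V U' V' (f : {linear U -> U'}) (g : {linear V -> V'}) u v :
  tmap f g (tens u v) = tens (f u) (g v).
Proof. exact: (tlift_tens (tmap_bilin f g)). Qed.

Lemma tmapD U V U' V' (f : {linear U -> U'}) (g : {linear V -> V'}) :
  {morph tmap f g : s t / s + t}.
Proof. exact: (tliftD (tmap_bilin f g)). Qed.

Lemma tmap0 U V U' V' (f : {linear U -> U'}) (g : {linear V -> V'}) : tmap f g 0 = 0.
Proof. exact: (tlift0 (tmap_bilin f g)). Qed.

(** Over a field the sequence splits, and the splitting identities pass to tensors, where they give
    exactness formally. *)
Lemma tmap_ses_l U V W (i : {linear U -> V}) (p : {linear V -> W}) X :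
  ses i p -> ses (tmap i (idfun : {linear X -> X})) (tmap p (idfun : {linear X -> X})).
Proof.
move=> S; have [r [s [iK sK e]]] := ses_split S.
have riK t : tmap r idfun (tmap i (idfun : {linear X -> X}) t) = t.
  elim/tensor_ind: t => [|t t' Et Et'|u v]; first by rewrite !tmap0.
    by rewrite !tmapD Et Et'.
  by rewrite !tmap_tens /= iK.
have psK t : tmap p idfun (tmap s (idfun : {linear X -> X}) t) = t.
  elim/tensor_ind: t => [|t t' Et Et'|u v]; first by rewrite !tmap0.
    by rewrite !tmapD Et Et'.
  by rewrite !tmap_tens /= sK.
have tE t : t = tmap i idfun (tmap r (idfun : {linear X -> X}) t) +
    tmap s idfun (tmap p (idfun : {linear X -> X}) t).
  elim/tensor_ind: t => [|t t' Et Et'|u v]; first by rewrite !tmap0 addr0.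
    by rewrite !tmapD [LHS](congr2 +%R Et Et') addrACA.
  by rewrite !tmap_tens /= -tensDl -e.
split.
- exact: can_inj riK.
- by move=> t; exists (tmap s idfun t); exact: psK.
move=> t; split=> /= [pt|[z ->]].
  by exists (tmap r idfun t); rewrite [LHS]tE pt tmap0 addr0.
elim/tensor_ind: z => [|t' t'' Et Et'|u v]; first by rewrite !tmap0.
  by rewrite !tmapD Et Et' addr0.
by rewrite !tmap_tens /= (ses_comp S) tens0l.
Qed.

Lemma tswap_bilin U V : bilinear_map (fun (u : U) (v : V) => tens v u).
Proof.
by split=> [v c u u'|u c v v'] /=; rewrite (tensDl, tensDr) (tensZl, tensZr).
Qed.

Definition tswap U V (t : tensor U V) : tensor V U := tlift (fun u v => tens v u) t.

HB.instance Definition _ U V :=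
  GRing.isLinear.Build k (tensor U V) (tensor V U) *:%R (@tswap U V)
    (tlift_linear (@tswap_bilin U V)).

Lemma tswap_tens U V (u : U) (v : V) : tswap (tens u v) = tens v u.
Proof. exact: (tlift_tens (@tswap_bilin U V)). Qed.

Lemma tswapD U V : {morph @tswap U V : s t / s + t}.
Proof. exact: (tliftD (@tswap_bilin U V)). Qed.

Lemma tswap0 U V : @tswap U V 0 = 0.
Proof. exact: (tlift0 (@tswap_bilin U V)). Qed.

Lemma tswapK U V : cancel (@tswap U V) (@tswap V U).
Proof.
elim/tensor_ind => [|s t Es Et|u v]; first by rewrite !tswap0.
  by rewrite !tswapD Es Et.
by rewrite !tswap_tens.
Qed.

Lemma tmap_ses_r U V W (i : {linear U -> V}) (p : {linear V -> W}) X :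
  ses i p -> ses (tmap (idfun : {linear X -> X}) i) (tmap (idfun : {linear X -> X}) p).
Proof.
move=> /(@tmap_ses_l _ _ _ _ _ X) [iI pS e].
have sw (U' V' : lmodType k) (f : {linear U' -> V'}) t :
    tmap (idfun : {linear X -> X}) f (tswap t) = tswap (tmap f (idfun : {linear X -> X}) t).
  elim/tensor_ind: t => [|t t' Et Et'|u v]; first by rewrite !(tmap0, tswap0).
    by rewrite !(tmapD, tswapD) Et Et'.
  by rewrite !(tmap_tens, tswap_tens).
have sw' (U' V' : lmodType k) (f : {linear U' -> V'}) t :
    tmap (idfun : {linear X -> X}) f t = tswap (tmap f (idfun : {linear X -> X}) (tswap t)).
  by rewrite -sw tswapK.
split.
- by move=> s t /=; rewrite (sw' _ _ i s) (sw' _ _ i t) => /(can_inj (@tswapK _ _))/iI/(can_inj (@tswapK _ _)).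
- move=> t; have [y yE] := pS (tswap t).
  by exists (tswap y); rewrite /= sw yE tswapK.
move=> t; rewrite /= (sw' _ _ p t); split=> [|[z ->]].
  rewrite -[RHS](@tswap0 W X) => /(can_inj (@tswapK _ _))/e [z zE].
  by exists (tswap z); rewrite /= sw -zE tswapK.
rewrite /= (sw' _ _ i) tswapK; have -> : tmap p idfun (tmap i idfun (tswap z)) = 0.
  by apply/e; exists (tswap z).
exact: tswap0.
Qed.

End VectorSpaces.

Section TensorNonzero.
Variables (k : fieldType) (A B : algType k).

(** A linear form [xi] on [A] with value 1 at 1 gives a map from [A (x) B] to [B] that sends 1 to 1.
    An algebra here is nonzero by definition, so this has to precede Ext over a tensor product. *)
Fact tensor_neq0 : 1 != 0 :> tensor A B.
Proof.
have g_lin : linear (fun c : k^o => c%:A : A).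
  by move=> c x y; rewrite scalerDl /= -scalerA.
have gI : injective (Lin g_lin).
  move=> c d /= /eqP; rewrite -subr_eq0 -scalerBl scaler_eq0 oner_eq0 orbF subr_eq0.
  by move/eqP.
have [xi xiK] := linear_retraction gI.
have xi1 : xi 1 = 1 by have /= := xiK 1; rewrite scale1r.
have b : bilinear_map (fun (a : A) (b : B) => xi a *: b).
  split=> [y c x x'|x c y y'] /=; first by rewrite linearP /= scalerDl scalerA.
  by rewrite scalerDr !scalerA mulrC.
apply/eqP => e; have := tlift_tens b 1 1.
rewrite tens1 e (tlift0 b) xi1 scale1r => /esym/eqP.
by rewrite oner_eq0.
Qed.

HB.instance Definition _ := GRing.PzSemiRing_isNonZero.Build (tensor A B) tensor_neq0.
HB.instance Definition _ :=
  GRing.Lmodule_isLalgebra.Build k (tensor A B) (@tensor_scaleAl k A B).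
HB.instance Definition _ :=
  GRing.Lalgebra_isAlgebra.Build k (tensor A B) (@tensor_scaleAr k A B).

End TensorNonzero.

(** * External tensor products of modules *)

Section Extens.
Variables (k : fieldType) (A B : algType k).
Implicit Types (X : lmodType A) (Y : lmodType B) (W : lmodType (tensor A B)).

Definition etens X Y (x : X) (y : Y) : extens X Y :=
  @tens k (restr (GRing.in_alg A) X) (restr (GRing.in_alg B) Y) x y.

Lemma etensDl X Y (x x' : X) (y : Y) : etens (x + x') y = etens x y + etens x' y.
Proof. exact: tensDl. Qed.

Lemma etensDr X Y (x : X) (y y' : Y) : etens x (y + y') = etens x y + etens x y'.
Proof. exact: tensDr. Qed.

Lemma etens0l X Y (y : Y) : etens (0 : X) y = 0.
Proof. exact: tens0l. Qed.

Lemma etens0r X Y (x : X) : etens x (0 : Y) = 0.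
Proof. exact: tens0r. Qed.

Lemma etensZ X Y (a : A) (b : B) (x : X) (y : Y) :
  (tens a b : tensor A B) *: etens x y = etens (a *: x) (b *: y).
Proof.
exact: (tact_tens (scale_restr_bilinear X) (scale_restr_bilinear Y)).
Qed.

Lemma etens_ind X Y (P : extens X Y -> Prop) :
  P 0 -> (forall s t, P s -> P t -> P (s + t)) -> (forall x y, P (etens x y)) ->
  forall t, P t.
Proof. exact: tensor_ind. Qed.

Lemma tensor_linear (V W : lmodType (tensor A B)) (f : V -> W) :
  {morph f : s t / s + t} ->
  (forall a b t, f ((tens a b : tensor A B) *: t) = (tens a b : tensor A B) *: f t) ->
  linear f.
Proof.
move=> fD fZ c s t; rewrite fD; congr (_ + _).
elim/tensor_ind: c => [|c d Ec Ed|a b]; last exact: fZ.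
  by rewrite !scale0r (additive0 fD).
by rewrite !scalerDl fD Ec Ed.
Qed.

Lemma extens_linear X Y W (f : extens X Y -> W) :
  {morph f : s t / s + t} ->
  (forall a b x y, f (etens (a *: x) (b *: y)) = (tens a b : tensor A B) *: f (etens x y)) ->
  linear f.
Proof.
move=> fD fZ; apply: tensor_linear => // a b t.
elim/etens_ind: t => [|s t Es Et|x y]; last by rewrite etensZ fZ.
  by rewrite !scaler0 (additive0 fD) scaler0.
by rewrite scalerDr !fD Es Et scalerDr.
Qed.

(** Bilinearity over [k] is not assumed: it follows from compatibility with the actions by taking
    [a] or [c] to be a scalar. *)
Lemma extens_lift X Y W (b : X -> Y -> W) :
  (forall y, {morph b^~ y : x x' / x + x'}) -> (forall x, {morph b x : y y' / y + y'}) ->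
  (forall a c x y, b (a *: x) (c *: y) = (tens a c : tensor A B) *: b x y) ->
  exists h : {linear extens X Y -> W}, forall x y, h (etens x y) = b x y.
Proof.
move=> bDl bDr bZ.
pose b' (x : restr (GRing.in_alg A) X) (y : restr (GRing.in_alg B) Y) :
  restr (tensor_in A B) W := b x y.
have bb : bilinear_map b'.
  split=> [y c x x'|x c y y'].
    rewrite [LHS]bDl; congr (_ + _).
    have := bZ c%:A 1 x y; rewrite scale1r => e; rewrite [LHS]e.
    exact: (congr1 (fun r : tensor A B => r *: b x y) (tensZl c 1 1)).
  rewrite [LHS]bDr; congr (_ + _).
  have := bZ 1 c%:A x y; rewrite scale1r => e; rewrite [LHS]e.
  exact: (congr1 (fun r : tensor A B => r *: b x y) (tensZr c 1 1)).
have hL : linear (tlift b' : extens X Y -> W).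
  apply: extens_linear => [s t|a c x y]; first exact: (tliftD bb).
  have -> : tlift b' (etens (a *: x) (c *: y)) = b (a *: x) (c *: y) := tlift_tens bb _ _.
  have -> : tlift b' (etens x y) = b x y := tlift_tens bb _ _.
  exact: bZ.
by exists (Lin hL) => x y; exact: (tlift_tens bb).
Qed.

Lemma extens_ext X Y W (f g : {linear extens X Y -> W}) :
  (forall x y, f (etens x y) = g (etens x y)) -> f =1 g.
Proof.
move=> e t; elim/etens_ind: t => [|s t Es Et|//]; first by rewrite !linear0.
by rewrite !linearD Es Et.
Qed.

End Extens.

Section RestrLin.
Variables (k R : pzRingType) (phi : {rmorphism k -> R}) (X Y : lmodType R).
Variable f : {linear X -> Y}.

Fact restr_lin_subproof : linear (f : restr phi X -> restr phi Y).
Proof. by move=> c u v; exact: linearP. Qed.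

Definition restr_lin : {linear restr phi X -> restr phi Y} := Lin restr_lin_subproof.

End RestrLin.

Lemma restr_ses (k R : pzRingType) (phi : {rmorphism k -> R}) (Z F X : lmodType R)
    (i : {linear Z -> F}) (p : {linear F -> X}) :
  ses i p -> ses (restr_lin phi i) (restr_lin phi p).
Proof. by []. Qed.

Section ExtensMap.
Variables (k : fieldType) (A B : algType k).
Implicit Types (X Z F : lmodType A) (Y : lmodType B).

Definition emap X X' Y Y' (f : {linear X -> X'}) (g : {linear Y -> Y'})
    (t : extens X Y) : extens X' Y' :=
  tmap (restr_lin (GRing.in_alg A) f) (restr_lin (GRing.in_alg B) g) t.

Lemma emapE X X' Y Y' (f : {linear X -> X'}) (g : {linear Y -> Y'}) x y :
  emap f g (etens x y) = etens (f x) (g y).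
Proof. exact: tmap_tens. Qed.

Lemma emapD X X' Y Y' (f : {linear X -> X'}) (g : {linear Y -> Y'}) :
  {morph emap f g : s t / s + t}.
Proof.
exact: tmapD.
Qed.

Lemma emap0 X X' Y Y' (f : {linear X -> X'}) (g : {linear Y -> Y'}) : emap f g 0 = 0.
Proof. exact: additive0 (emapD f g). Qed.

Fact emap_linear X X' Y Y' (f : {linear X -> X'}) (g : {linear Y -> Y'}) :
  linear (emap f g).
Proof.
apply: extens_linear => [|a b x y]; first exact: emapD.
by rewrite !emapE etensZ !linearZ.
Qed.

HB.instance Definition _ X X' Y Y' (f : {linear X -> X'}) (g : {linear Y -> Y'}) :=
  GRing.isLinear.Build (tensor A B) (extens X Y) (extens X' Y') *:%R (emap f g)
    (emap_linear f g).

Lemma extens_ses_l Z F X Y (i : {linear Z -> F}) (p : {linear F -> X}) :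
  ses i p -> ses (emap i (idfun : {linear Y -> Y})) (emap p (idfun : {linear Y -> Y})).
Proof.
move=> /(restr_ses (GRing.in_alg A))/(@tmap_ses_l _ _ _ _ _ _ (restr (GRing.in_alg B) Y)).
have id_eq (V V' : lmodType A) (f : {linear V -> V'}) : emap f (idfun : {linear Y -> Y}) =1
   tmap (restr_lin (GRing.in_alg A) f) (idfun : {linear restr (GRing.in_alg B) Y -> _}).
  move=> t; elim/tensor_ind: t => [|t t' Et Et'|u v]; first by rewrite emap0 tmap0.
    by rewrite emapD tmapD Et Et'.
  by rewrite emapE tmap_tens.
move=> [iI pS e]; split=> [s t|t|t]; rewrite /= ?id_eq.
- exact: iI.
- by have [y <-] := pS t; exists y; rewrite /= id_eq.
split=> [/e [z ->]|[z ->]]; first by exists z; rewrite /= id_eq.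
by rewrite /= id_eq; apply/e; exists z.
Qed.

End ExtensMap.

Lemma extens_ses_r (k : fieldType) (A B : algType k) (Z F X : lmodType B)
    (Y : lmodType A) (i : {linear Z -> F}) (p : {linear F -> X}) :
  ses i p -> ses (emap (idfun : {linear Y -> Y}) i) (emap (idfun : {linear Y -> Y}) p).
Proof.
move=> /(restr_ses (GRing.in_alg B))/(@tmap_ses_r _ _ _ _ _ _ (restr (GRing.in_alg A) Y)).
have id_eq (V V' : lmodType B) (f : {linear V -> V'}) : emap (idfun : {linear Y -> Y}) f =1
   tmap (idfun : {linear restr (GRing.in_alg A) Y -> _}) (restr_lin (GRing.in_alg B) f).
  move=> t; elim/tensor_ind: t => [|t t' Et Et'|u v]; first by rewrite emap0 tmap0.
    by rewrite emapD tmapD Et Et'.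
  by rewrite emapE tmap_tens.
move=> [iI pS e]; split=> [s t|t|t]; rewrite /= ?id_eq.
- exact: iI.
- by have [y <-] := pS t; exists y; rewrite /= id_eq.
split=> [/e [z ->]|[z ->]]; first by exists z; rewrite /= id_eq.
by rewrite /= id_eq; apply/e; exists z.
Qed.

Lemma freeg_ind (R : nzRingType) (K : choiceType) (P : {freeg K / R} -> Prop) :
  P 0 -> (forall r s, P r -> P s -> P (r + s)) -> (forall c x, P (c *: << x >>)) ->
  forall r, P r.
Proof.
move=> P0 PD PU r; rewrite -[r]freeg_sumE; apply: (big_ind P) => // x _.
by rewrite -[coeff _ _]mulr1 -freegUZ.
Qed.

Section TensorIncl.
Variables (k : fieldType) (A B : algType k).

Definition tinl (a : A) : tensor A B := tens a 1.
Definition tinr (b : B) : tensor A B := tens 1 b.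

Fact tinl_zmod : zmod_morphism tinl.
Proof. by move=> a a'; rewrite /tinl -scaleN1r tensDl tensZl scaleN1r. Qed.
Fact tinl_monoid : monoid_morphism tinl.
Proof. by split=> // a a'; rewrite [RHS]tensM mulr1. Qed.
HB.instance Definition _ := GRing.isZmodMorphism.Build A (tensor A B) tinl tinl_zmod.
HB.instance Definition _ := GRing.isMonoidMorphism.Build A (tensor A B) tinl tinl_monoid.

Fact tinr_zmod : zmod_morphism tinr.
Proof. by move=> a a'; rewrite /tinr -scaleN1r tensDr tensZr scaleN1r. Qed.
Fact tinr_monoid : monoid_morphism tinr.
Proof. by split=> // a a'; rewrite [RHS]tensM mulr1. Qed.
HB.instance Definition _ := GRing.isZmodMorphism.Build B (tensor A B) tinr tinr_zmod.
HB.instance Definition _ := GRing.isMonoidMorphism.Build B (tensor A B) tinr tinr_monoid.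

Lemma tinlr a b : tinl a * tinr b = tens a b.
Proof. by rewrite [LHS]tensM mulr1 mul1r. Qed.

Lemma tinrl a b : tinr b * tinl a = tens a b.
Proof. by rewrite [LHS]tensM mulr1 mul1r. Qed.

End TensorIncl.

Section ProjectiveExtens.
Variables (k : fieldType) (A B : algType k).

(** The lifting is done for the free covers of [X] and [Y], where it amounts to a choice of [w x y]
    for pairs of basis elements, and is then pulled back along sections [sX] and [sY] of these
    covers. *)
Lemma projective_extens (X : lmodType A) (Y : lmodType B) :
  projective X -> projective Y -> projective (extens X Y : lmodType (tensor A B)).
Proof.
move=> Xpr Ypr V W g f gS.
have [sX sXK] := Xpr _ _ (@free_aug A X) idfun (@free_aug_surj A X).
have [sY sYK] := Ypr _ _ (@free_aug B Y) idfun (@free_aug_surj B Y).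
pose w x y := projT1 (cid (gS (f (etens x y)))).
have wE x y : g (w x y) = f (etens x y) := projT2 (cid (gS (f (etens x y)))).
(* [V] is a module over [A] and over [B] through the two inclusions into [A (x) B]. The choice [w]
   is extended [B]-linearly in the second variable, then [A]-linearly in the first; [b] stays
   [B]-linear because the two actions commute. *)
pose phi (v : {freeg Y / B}) (x : X) : restr (@tinl k A B) V :=
  fglift (w x : Y -> restr (@tinr k A B) V) v.
pose b (u : {freeg X / A}) v : V := fglift (phi v) u.
have bDl v : {morph b^~ v : x x' / x + x'} by exact: (linearD (fglift (phi v))).
have bZl a u v : b (a *: u) v = @tinl k A B a *: b u v by exact: (linearZ_LR (fglift (phi v))).
have bU x v : b << x >> v = phi v x by rewrite /b liftU scale1r.
have phiD x v v' : phi (v + v') x = phi v x + phi v' x.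
  exact: (linearD (fglift (w x : Y -> restr (@tinr k A B) V))).
have phiZ x c v : phi (c *: v) x = @tinr k A B c *: (phi v x : V).
  exact: (linearZ_LR (fglift (w x : Y -> restr (@tinr k A B) V))).
have bDr u : {morph b u : v v' / v + v'}.
  move=> v v'; elim/freeg_ind: u => [|r s Er Es|c x].
  - by rewrite !(additive0 (bDl _)) addr0.
  - by rewrite !bDl Er Es addrACA.
  by rewrite !bZl !bU phiD; exact: scalerDr.
have bZr c u v : b u (c *: v) = @tinr k A B c *: b u v.
  elim/freeg_ind: u => [|r s Er Es|a x].
  - by rewrite !(additive0 (bDl _)) scaler0.
  - by rewrite !bDl Er Es scalerDr.
  by rewrite !bZl !bU phiZ !scalerA tinlr tinrl.
have [h hE] : exists h : {linear extens {freeg X / A} {freeg Y / B} -> V},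
    forall u v, h (etens u v) = b u v.
  by apply: extens_lift => // a c u v; rewrite bZl bZr scalerA tinlr.
have gb u v : g (b u v) = f (etens (free_aug u) (free_aug v)).
  elim/freeg_ind: u => [|r s Er Es|a x].
  - by rewrite (additive0 (bDl _)) !linear0 etens0l linear0.
  - by rewrite bDl !linearD Er Es /= etensDl linearD.
  rewrite bZl bU linearZ_LR /=.
  have -> : free_aug (a *: << x >>) = a *: x.
    by rewrite linearZ_LR /= /free_aug liftU scale1r.
  have -> : etens (a *: x) (free_aug v) = @tinl k A B a *: etens x (free_aug v).
    by rewrite etensZ scale1r.
  rewrite linearZ_LR; congr (_ *: _).
  elim/freeg_ind: v => [|r s Er Es|c y].
  - have -> : phi 0 x = 0 := additive0 (phiD x).
    by rewrite !linear0 etens0r linear0.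
  - by rewrite phiD !linearD Er Es /= etensDr linearD.
  rewrite phiZ linearZ_LR /=.
  have -> : free_aug (c *: << y >>) = c *: y.
    by rewrite linearZ_LR /= /free_aug liftU scale1r.
  have -> : etens x (c *: y) = @tinr k A B c *: etens x y by rewrite etensZ scale1r.
  rewrite linearZ_LR; congr (_ *: _).
  by rewrite /phi liftU scale1r wE.
exists (h \o emap sX sY)%FUN.
apply: (extens_ext (f := (g \o (h \o emap sX sY))%FUN)) => x y /=.
by rewrite emapE hE gb (sXK x) (sYK y).
Qed.

(** Tensoring over [k] is exact, so a syzygy of either factor gives a short exact sequence of
    external tensor products. The inner induction treats a projective first factor. *)
Lemma fpd_extens (X : lmodType A) (Y : lmodType B) :
  finite_pd X -> finite_pd Y -> finite_pd (extens X Y : lmodType (tensor A B)).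
Proof.
move=> [n Xn] [m]; elim: n X Xn Y m => [|n IH] X Xn Y m.
  elim: m Y => [|m IH] Y Ym; first exact/fpd_projective/projective_extens.
  apply: (fpd_ses (extens_ses_r X (free_syzygy_ses Y))).
    by apply: IH; rewrite -free_syzS.
  by apply/fpd_projective/projective_extens => //; exact: free_projective.
move=> Ym; apply: (fpd_ses (extens_ses_l Y (free_syzygy_ses X))).
  by apply: IH Ym; rewrite -free_syzS.
elim: m Y Ym => [|m IHm] Y Ym.
  by apply/fpd_projective/projective_extens => //; exact: free_projective.
apply: (fpd_ses (extens_ses_r _ (free_syzygy_ses Y))).
  by apply: IHm; rewrite -free_syzS.
by apply/fpd_projective/projective_extens => //; exact: free_projective.
Qed.

End ProjectiveExtens.

(** * Scalar extension along a split square-zero extension *)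

(** A Hochschild 1-cocycle of [R] with values in the additive maps from [X] to [K]. The rule [cocM]
    is the associativity of the action on [X * K] twisted by it. *)
Record cocycle (R : pzRingType) (X K : lmodType R) := Cocycle {
  coc :> R -> X -> K;
  cocDl : forall r s x, coc (r + s) x = coc r x + coc s x;
  cocDr : forall r x y, coc r (x + y) = coc r x + coc r y;
  cocM : forall r s x, coc (r * s) x = r *: coc s x + coc r (s *: x)
}.

Definition cocext (R : pzRingType) (X K : lmodType R) (d : cocycle X K) : Type :=
  (X * K)%type.

Section CocycleExtension.
Variables (R : pzRingType) (X K : lmodType R) (d : cocycle X K).
Local Notation E := (cocext d).

HB.instance Definition _ := GRing.Zmodule.on E.

Definition cocext_scale (r : R) (e : E) : E := (r *: e.1, r *: e.2 + d r e.1).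

Lemma coc1 x : d 1 x = 0.
Proof. by apply: (addIr (d 1 x)); rewrite add0r -[in RHS](mul1r 1) cocM !scale1r. Qed.

Fact cocext_scaleA a b e : cocext_scale a (cocext_scale b e) = cocext_scale (a * b) e.
Proof. by rewrite /cocext_scale /= !scalerA cocM scalerDr scalerA addrA. Qed.
Fact cocext_scale1 : left_id 1 cocext_scale.
Proof. by move=> [x y]; rewrite /cocext_scale !scale1r coc1 addr0. Qed.
Fact cocext_scaleDr : right_distributive cocext_scale +%R.
Proof.
by move=> a x y; congr (_, _); rewrite /= ?scalerDr // cocDr addrACA.
Qed.
Fact cocext_scaleDl e : {morph cocext_scale^~ e : a b / a + b}.
Proof.
by move=> a b; congr (_, _); rewrite /= ?scalerDl // cocDl addrACA.
Qed.

HB.instance Definition _ := GRing.Zmodule_isLmodule.Build R E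
  cocext_scaleA cocext_scale1 cocext_scaleDr cocext_scaleDl.

Lemma cocextZ r (e : E) : r *: e = ((r *: e.1, r *: e.2 + d r e.1) : E).
Proof. by []. Qed.

Lemma coc0r r : d r 0 = 0.
Proof. exact: (additive0 (cocDr d r)). Qed.

Lemma cocext_ses : exists (i : {linear K -> E}) (p : {linear E -> X}),
  [/\ ses i p, forall y, i y = (0, y) & forall e, p e = e.1].
Proof.
have iL : linear (fun y : K => ((0, y) : E)).
  move=> a u v; rewrite cocextZ; congr (_, _); first by rewrite /= scaler0 addr0.
  by rewrite /= coc0r addr0.
have pL : linear (fun e : E => e.1) by move=> a u v; rewrite cocextZ.
exists (Lin iL), (Lin pL); split=> //; split.
- by move=> u v [].
- by move=> x; exists (x, 0).
by move=> [x y]; split=> [/= ->|[z ->]] //; exists y.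
Qed.

End CocycleExtension.

Section TensorMorphism.
Variables (k : fieldType) (A A' B B' : algType k).
Variables (f : {lrmorphism A -> A'}) (g : {lrmorphism B -> B'}).

Definition tmor (t : tensor A B) : tensor A' B' := tmap f g t.

Lemma tmor_tens a b : tmor (tens a b) = tens (f a) (g b).
Proof. exact: tmap_tens. Qed.

Fact tmor_zmod : zmod_morphism tmor.
Proof. exact: linearB. Qed.
Fact tmor_monoid : monoid_morphism tmor.
Proof.
split=> [|s t]; first by rewrite -[1]tens1 tmor_tens !rmorph1.
have D : {morph tmor : x y / x + y} := linearD (tmap f g).
elim/tensor_ind: s => [|s s' E E'|a b].
- by rewrite mul0r !(additive0 D) mul0r.
- by rewrite mulrDl !D mulrDl -E -E'.
elim/tensor_ind: t => [|s s' E E'|a' b'].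
- by rewrite mulr0 !(additive0 D) mulr0.
- by rewrite mulrDr !D mulrDr -E -E'.
by rewrite tensM !tmor_tens !rmorphM tensM.
Qed.
HB.instance Definition _ :=
  GRing.isZmodMorphism.Build (tensor A B) (tensor A' B') tmor tmor_zmod.
HB.instance Definition _ :=
  GRing.isMonoidMorphism.Build (tensor A B) (tensor A' B') tmor tmor_monoid.

End TensorMorphism.

(* A split extension [G = io C + P] of [C] by the square-zero ideal
   [P = (+)_i C mu_i C], where [C mu_i C] is isomorphic to [C y_i (x) x_i C]
   and [rho_i : G -> C (x) C] extracts the i-th coordinate. *)
Record nse (k : fieldType) (C G : algType k) (I : finType) := Nse {
  io : {lrmorphism C -> G};
  pr : {lrmorphism G -> C};
  mu : I -> G;
  yy : I -> C;
  xx : I -> C;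
  rho : I -> {linear G -> tensor C C};
  pr_io : forall c, pr (io c) = c;
  pr_mu : forall i, pr (mu i) = 0;
  rho_io : forall i c, rho i (io c) = 0;
  rho_mu : forall i j, rho i (mu j) = if i == j then tens (yy i) (xx i) else 0;
  rho_mul : forall i g h, rho i (g * h) =
    (tens (pr g) 1 : tensor C C) * rho i h + rho i g * (tens 1 (pr h) : tensor C C);
  yy_idem : forall i, yy i * yy i = yy i;
  xx_idem : forall i, xx i * xx i = xx i;
  mu_yx : forall i, io (yy i) * mu i * io (xx i) = mu i;
  mulmu : forall g i, g * mu i = io (pr g) * mu i;
  mumul : forall i g, mu i * g = mu i * io (pr g);
  nse_expand : forall g, g = io (pr g) +
    \sum_i tlift (fun c c' => io c * mu i * io c') (rho i g)
}.

(** * Scalar extension of a module over [C (x) T] to [G (x) T] *)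

Section Induction.
Variables (k : fieldType) (C G : algType k) (I : finType) (P : nse C G I).
Variable T : algType k.
Local Notation R := (tensor G T).
Local Notation S := (tensor C T).

Let q : {rmorphism R -> S} := tmor (pr P) (idfun : {lrmorphism T -> T}).
Let phi : {rmorphism S -> R} := tmor (io P) (idfun : {lrmorphism T -> T}).

Definition nsU (i : I) : lmodType G := restr (pr P) (lideal (yy P i)).

Definition nsu (i : I) (c : C) : nsU i :=
  @mk_submod _ _ (Submod (@lideal0 C (yy P i)) (@lidealD C (yy P i)) (@lidealZ C (yy P i)))
    (c * yy P i) (ex_intro _ c erefl).

Definition nsuv (i : I) (u : nsU i) : C := val (u : lideal (yy P i)).

Lemma nsu_val i u : nsu i (nsuv u) = u.
Proof.
apply: val_inj => /=; have [c cE] := submod_ofP u.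
by rewrite /nsuv cE -mulrA yy_idem.
Qed.

Lemma nsuD i c c' : nsu i (c + c') = nsu i c + nsu i c'.
Proof. by apply: val_inj; rewrite /= mulrDl. Qed.

Lemma nsuZ i g c : nsu i (pr P g * c) = g *: nsu i c.
Proof. by apply: val_inj; rewrite /= -mulrA. Qed.

Section Module.
Variable X : lmodType S.
Implicit Type x : X.

Fact nsx0 i : @tinl k C T (xx P i) *: (0 : X) = 0.
Proof. exact: scaler0. Qed.
Fact nsxD i (u v : restr (@tinr k C T) X) :
  @tinl k C T (xx P i) *: (u : X) = u -> @tinl k C T (xx P i) *: (v : X) = v ->
  @tinl k C T (xx P i) *: (u + v : X) = u + v.
Proof. by move=> ue ve; rewrite scalerDr ue ve. Qed.
Fact nsxZ i (t : T) (v : restr (@tinr k C T) X) :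
  @tinl k C T (xx P i) *: (v : X) = v ->
  @tinl k C T (xx P i) *: (@tinr k C T t *: v : X) = @tinr k C T t *: (v : X).
Proof. by move=> ve; rewrite scalerA tinlr -tinrl -scalerA ve. Qed.

Definition nsX_submod i : submod (restr (@tinr k C T) X) :=
  Submod (@nsx0 i) (@nsxD i) (@nsxZ i).
Definition nsX i : lmodType T := submod_of (nsX_submod i).

Fact nsx_subproof i x :
  @tinl k C T (xx P i) *: (@tinl k C T (xx P i) *: x) = @tinl k C T (xx P i) *: x.
Proof. by rewrite scalerA -rmorphM xx_idem. Qed.
Definition nsx i x : nsX i := mk_submod (S := nsX_submod i) (nsx_subproof i x).
Definition nsxv i (w : nsX i) : X := val w.

Lemma nsx_val i w : nsx i (nsxv w) = w.
Proof. by apply: val_inj => /=; exact: (submod_ofP w). Qed.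

Lemma nsx_D i x x' : nsx i (x + x') = nsx i x + nsx i x'.
Proof. by apply: val_inj; rewrite /= scalerDr. Qed.

Lemma nsx_Z i t x : nsx i (@tinr k C T t *: x) = t *: nsx i x.
Proof. by apply: val_inj; rewrite /= !scalerA tinlr -tinrl -scalerA. Qed.

Lemma nsxv_D i (w w' : nsX i) : nsxv (w + w') = nsxv w + nsxv w'.
Proof. by []. Qed.

Lemma nsxv_Z i t (w : nsX i) : nsxv (t *: w) = @tinr k C T t *: nsxv w.
Proof. by []. Qed.

Definition nsK : lmodType R := dirsum (fun i => extens (nsU i) (nsX i)).

(** For [w = c (x) c'] this is [c y_i (x) x_i c' x], that is, the element [c mu_i c' (x) x] of
    [P (x)_C X] written in the i-th summand of [nsK]. *)
Definition nsD i x (w : tensor C C) : extens (nsU i) (nsX i) :=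
  @tlift k C C (tensor (restr (GRing.in_alg G) (nsU i)) (restr (GRing.in_alg T) (nsX i)))
    (fun c c' => etens (nsu i c) (nsx i (@tinl k C T c' *: x))) w.

Fact nsD_bilin i x : @bilinear_map k C C
  (tensor (restr (GRing.in_alg G) (nsU i)) (restr (GRing.in_alg T) (nsX i)))
  (fun c c' => etens (nsu i c) (nsx i (@tinl k C T c' *: x))).
Proof.
split=> [c' a c d|c a c' d'].
  rewrite nsuD etensDl; congr (_ + _).
  have -> : nsu i (a *: c) = a%:A *: nsu i c.
    by rewrite -nsuZ rmorph_alg mulr_algl.
  exact: tensZl.
rewrite rmorphD scalerDl nsx_D etensDr; congr (_ + _).
have -> : @tinl k C T (a *: c') *: x = @tinr k C T a%:A *: (@tinl k C T c' *: x).
  rewrite scalerA tinrl; congr (_ *: x).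
  by rewrite /tinl tensZl tensZr.
rewrite nsx_Z.
exact: tensZr.
Qed.

Lemma nsD_tens i x c c' :
  nsD i x (tens c c') = etens (nsu i c) (nsx i (@tinl k C T c' *: x)).
Proof. exact: (tlift_tens (nsD_bilin i x)). Qed.

Lemma nsDDr i x w w' : nsD i x (w + w') = nsD i x w + nsD i x w'.
Proof. exact: (tliftD (nsD_bilin i x)). Qed.

Lemma nsD0r i x : nsD i x 0 = 0.
Proof. exact: (additive0 (nsDDr i x)). Qed.

Lemma nsDDl i x x' w : nsD i (x + x') w = nsD i x w + nsD i x' w.
Proof.
elim/tensor_ind: w => [|w w' E E'|c c']; first by rewrite !nsD0r addr0.
  by rewrite !nsDDr E E' addrACA.
by rewrite !nsD_tens scalerDr nsx_D etensDr.
Qed.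

Lemma nsD_l i x g t w :
  (tens g t : R) *: nsD i x w = nsD i (@tinr k C T t *: x) ((tens (pr P g) 1 : tensor C C) * w).
Proof.
elim/tensor_ind: w => [|w w' E E'|c c'].
- by rewrite mulr0 !nsD0r scaler0.
- by rewrite mulrDr !nsDDr scalerDr E E'.
rewrite tensM mul1r !nsD_tens etensZ -nsuZ; congr (etens _ _).
by rewrite -nsx_Z !scalerA tinlr tinrl.
Qed.

Lemma nsD_r i x c w :
  nsD i x (w * (tens 1 c : tensor C C)) = nsD i (@tinl k C T c *: x) w.
Proof.
elim/tensor_ind: w => [|w w' E E'|a b].
- by rewrite mul0r !nsD0r.
- by rewrite mulrDl !nsDDr E E'.
by rewrite tensM mulr1 !nsD_tens scalerA -rmorphM.
Qed.

Definition nsd_coord i (r : R) x : extens (nsU i) (nsX i) :=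
  @tlift k G T (tensor (restr (GRing.in_alg G) (nsU i)) (restr (GRing.in_alg T) (nsX i)))
    (fun g t => nsD i (@tinr k C T t *: x) (rho P i g)) r.

Fact nsd_bilin i x : @bilinear_map k G T
  (tensor (restr (GRing.in_alg G) (nsU i)) (restr (GRing.in_alg T) (nsX i)))
  (fun g t => nsD i (@tinr k C T t *: x) (rho P i g)).
Proof.
split=> [t a g g'|g a t t'].
  by rewrite linearP nsDDr; congr (_ + _); exact: (tliftZ (nsD_bilin i _)).
rewrite rmorphD scalerDl nsDDl; congr (_ + _).
set w := rho P i g.
rewrite -[RHS](tliftZ (nsD_bilin i _)) -/(nsD _ _ _).
have -> : a *: w = w * (tens 1 a%:A : tensor C C).
  by rewrite tensZr -tensor_scaleAr mulr1.
rewrite nsD_r; congr nsD; rewrite scalerA tinlr; congr (_ *: x).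
exact: etrans (tensZr a 1 t) (esym (tensZl a 1 t)).
Qed.

Lemma nsd_tens i g t x :
  nsd_coord i (tens g t) x = nsD i (@tinr k C T t *: x) (rho P i g).
Proof. exact: (tlift_tens (nsd_bilin i x)). Qed.

Lemma nsd_Dl i r r' x : nsd_coord i (r + r') x = nsd_coord i r x + nsd_coord i r' x.
Proof. exact: (tliftD (nsd_bilin i x)). Qed.

Lemma nsd_0l i x : nsd_coord i 0 x = 0.
Proof. exact: (tlift0 (nsd_bilin i x)). Qed.

Lemma nsd_Dr i r x y : nsd_coord i r (x + y) = nsd_coord i r x + nsd_coord i r y.
Proof.
elim/tensor_ind: r => [|r r' E E'|g t]; first by rewrite !nsd_0l addr0.
  by rewrite !nsd_Dl E E' addrACA.
by rewrite !nsd_tens scalerDr nsDDl.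
Qed.

(** The derivation rule of [rho] turns into the cocycle rule: the right factor [tens 1 (pr h)] is
    moved across to [x], where it becomes the action of [q s]. *)
Lemma nsd_M i r s x :
  nsd_coord i (r * s) x = r *: nsd_coord i s x + nsd_coord i r (q s *: x).
Proof.
elim/tensor_ind: r => [|r r' E E'|g t].
- by rewrite mul0r !nsd_0l scale0r addr0.
- by rewrite mulrDl !nsd_Dl scalerDl E E' addrACA.
elim/tensor_ind: s => [|s s' E E'|g' t'].
- by rewrite mulr0 !nsd_0l rmorph0 scale0r scaler0 (additive0 (nsd_Dr i _)) addr0.
- by rewrite mulrDr !nsd_Dl scalerDr rmorphD scalerDl nsd_Dr E E' addrACA.
rewrite tensM !nsd_tens rho_mul nsDDr nsD_l nsD_r; congr (_ + _).
  by rewrite scalerA -rmorphM.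
congr (nsD _ _ _); rewrite /q /= tmor_tens !scalerA tinlr.
by rewrite /tinr tensM mul1r.
Qed.

Definition nsd : cocycle (restr q X) nsK.
Proof.
exists (fun r (x : restr q X) i => nsd_coord i r x) => [r s x|r x y|r s x];
  apply: functional_extensionality_dep => i.
- exact: nsd_Dl.
- exact: nsd_Dr.
exact: nsd_M.
Defined.

(** This is [G (x)_C X]. Since [G] is [io C] plus the bimodules [C mu_i C], each isomorphic to
    [C y_i (x) x_i C], the tensor product is [X] plus the sum of the [C y_i (x) x_i X]; the cocycle
    records how [P] sends [X] into this sum. *)
Definition nsE : lmodType R := cocext nsd.

End Module.

Section Functor.
Variables (X X' : lmodType S) (f : {linear X -> X'}).

Fact nsXmap_subproof i (w : nsX X i) : smem (nsX_submod X' i) (f (nsxv w)).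
Proof. by have /= := submod_ofP w; rewrite -linearZ_LR => ->. Qed.

Fact nsXmap_linear i : linear (fun w => mk_submod (nsXmap_subproof w) : nsX X' i).
Proof. by move=> a u v; apply: val_inj => /=; rewrite /nsxv /= linearD linearZ_LR. Qed.

Definition nsXmap i : {linear nsX X i -> nsX X' i} := Lin (@nsXmap_linear i).

Lemma nsXmap_nsx i x : nsXmap i (nsx i x) = nsx i (f x).
Proof. by apply: val_inj; rewrite /= linearZ_LR. Qed.

Lemma nsd_nat i r x : nsd_coord i r (f x) =
  emap (idfun : {linear nsU i -> nsU i}) (nsXmap i) (nsd_coord i r x).
Proof.
have Dn y w : nsD i (f y) w =
    emap (idfun : {linear nsU i -> nsU i}) (nsXmap i) (nsD i y w).
  elim/tensor_ind: w => [|w w' E E'|c c']; first by rewrite !nsD0r emap0.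
    by rewrite !nsDDr emapD -E -E'.
  by rewrite !nsD_tens emapE nsXmap_nsx linearZ_LR.
elim/tensor_ind: r => [|r r' E E'|g t]; first by rewrite !nsd_0l emap0.
  by rewrite !nsd_Dl emapD -E -E'.
by rewrite !nsd_tens -Dn linearZ_LR.
Qed.

End Functor.

Lemma nsX_ses (Z F X : lmodType S) (i : {linear Z -> F}) (p : {linear F -> X}) j :
  ses i p -> ses (nsXmap i j) (nsXmap p j).
Proof.
move=> [iI pS e]; split.
- move=> u v /(congr1 val) /= /iI; exact: val_inj.
- move=> w; have [y yE] := pS (nsxv w); exists (nsx j y).
  by rewrite nsXmap_nsx yE nsx_val.
move=> y; split=> [/(congr1 val) /= /e [z zE]|[z ->]].
  exists (nsx j z); apply: val_inj.
  by rewrite /= linearZ_LR -zE; exact/esym/(submod_ofP y).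
by apply: val_inj => /=; apply/e; exists (nsxv z).
Qed.

Lemma nsE_ses (Z F X : lmodType S) (i : {linear Z -> F}) (p : {linear F -> X}) : ses i p ->
  exists (i' : {linear nsE Z -> nsE F}) (p' : {linear nsE F -> nsE X}),
    ses i' p' /\ forall z, i' ((z, 0) : nsE Z) = ((i z, 0) : nsE F).
Proof.
move=> ipS.
have [iK [pK [[iKI pKS eK] iKE pKE]]] :=
  dirsum_ses (fun j => extens_ses_r (nsU j) (nsX_ses j ipS)).
have [iI pS e] := ipS.
have mapL (V W : lmodType S) (f : {linear V -> W}) (fK : {linear nsK V -> nsK W}) :
    (forall z a, fK z a = emap (idfun : {linear nsU a -> nsU a}) (nsXmap f a) (z a)) ->
    linear ((fun v => (f v.1, fK v.2)) : nsE V -> nsE W).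
  move=> fKE a u v; rewrite cocextZ; congr (_, _); first exact: linearP.
  rewrite /= linearD linearD linearZ_LR; congr (_ + _ + _).
  apply: functional_extensionality_dep => b; rewrite fKE.
  exact/esym/nsd_nat.
exists (Lin (mapL _ _ _ _ iKE)), (Lin (mapL _ _ _ _ pKE)); split.
  split.
  - by move=> [u u'] [v v'] [/iI -> /iKI ->].
  - by move=> [x y]; have [[x' <-] [y' <-]] := (pS x, pKS y); exists (x', y').
  move=> [x y]; split=> [[/e [z ->] /eK [z' ->]]|[[z z'] [-> ->]]].
    by exists (z, z').
  by congr (_, _); [apply/e; exists z | apply/eK; exists z'].
by move=> z; congr (_, _); exact: linear0.
Qed.

Lemma q_phi s : q (phi s) = s.
Proof.
have D := linearD (tmap (pr P) (idfun : {linear T -> T}) \o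
  tmap (io P) (idfun : {linear T -> T}))%FUN.
have D0 := additive0 D.
elim/tensor_ind: s => [|s t Es Et|c t]; first exact: D0.
  by rewrite [LHS]D [X in X + _]Es [X in _ + X]Et.
by rewrite /q /phi /= !tmor_tens /= pr_io.
Qed.

Lemma nsd_phi (X : lmodType S) i s (x : X) : nsd_coord i (phi s) x = 0.
Proof.
elim/tensor_ind: s => [|s t Es Et|c t]; first by rewrite rmorph0 nsd_0l.
  by rewrite rmorphD nsd_Dl Es Et addr0.
by rewrite /phi /= tmor_tens nsd_tens rho_io nsD0r.
Qed.

(** The cocycle vanishes on the image of [phi], because [rho] kills [io C]. Thus the inclusion of
    [X] is linear over [C (x) T]; it is the unit of the adjunction. *)
Lemma nsE_phiZ (X : lmodType S) s (x : X) : phi s *: ((x, 0) : nsE X) = ((s *: x, 0) : nsE X).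
Proof.
rewrite cocextZ; congr (_, _).
  by rewrite -[in RHS](q_phi s).
rewrite /= scaler0 add0r; apply: functional_extensionality_dep => i.
exact: nsd_phi.
Qed.

Section Adjunction.
Variables (X : lmodType S) (Y : lmodType R).

(** Shows that the copy of [X] generates [nsE X], which gives uniqueness in the universal
    property. *)
Lemma nsE_gen i (u : nsU i) (w : nsX X i) :
  @tinl k G T (io P (nsuv u) * mu P i) *: ((nsxv w, 0) : nsE X) =
  ((0, dsingle (etens u w)) : nsE X).
Proof.
rewrite cocextZ; congr (_, _).
  rewrite -[LHS]/(q (@tinl k G T _) *: nsxv w) /q /tinl /= tmor_tens /=.
  have -> : pr P (io P (nsuv u) * mu P i) = 0 by rewrite [LHS]rmorphM [X in _ * X]pr_mu mulr0.
  by rewrite tens0l scale0r.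
rewrite /= scaler0 add0r; apply: functional_extensionality_dep => j.
apply: etrans (nsd_tens j (io P (nsuv u) * mu P i) 1 (nsxv w)) _.
rewrite rmorph1 scale1r rho_mul rho_io mul0r addr0 pr_io rho_mu.
have [e|ne] := eqVneq j i; last first.
  by rewrite mulr0 nsD0r dsingle_out // eq_sym.
subst j; rewrite tensM mul1r nsD_tens dsingle_in; congr etens.
  rewrite -[RHS]nsu_val; congr nsu; have [c cE] := submod_ofP u.
  by rewrite /nsuv cE -mulrA yy_idem.
apply: val_inj => /=; rewrite nsx_subproof; exact: (submod_ofP w).
Qed.

Lemma nsE_ext (f g : {linear nsE X -> Y}) :
  (forall x, f ((x, 0) : nsE X) = g ((x, 0) : nsE X)) -> f =1 g.
Proof.
move=> fg [x y].
have -> : ((x, y) : nsE X) = ((x, 0) : nsE X) + \sum_i ((0, dsingle (y i)) : nsE X).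
  have [j [_ [_ jE _]]] := cocext_ses (nsd X).
  under eq_bigr do rewrite -jE.
  rewrite -linear_sum /= dirsum_sumE jE.
  by congr (_, _); rewrite /= ?addr0 ?add0r.
rewrite !linearD fg; congr (_ + _).
rewrite !linear_sum; apply: eq_bigr => i _.
elim/etens_ind: (y i) => [|s t Es Et|u w].
- have -> : (0, dsingle (0 : extens (nsU i) (nsX X i))) = 0 :> nsE X.
    by congr (_, _); exact: (linear0 (Lin (@dsingle_linear _ _ _ i))).
  by rewrite !linear0.
- have -> : (0, dsingle (s + t)) = ((0, dsingle s) : nsE X) + ((0, dsingle t) : nsE X).
    congr (_, _); first by rewrite /= addr0.
    exact: (linearD (Lin (@dsingle_linear _ _ _ i))).
  by rewrite !linearD Es Et.
by rewrite -nsE_gen !linearZ_LR fg.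
Qed.

(** The only candidate sends [u (x) w] in the i-th summand to [u mu_i g(w)], as [nsE_gen] forces. *)
Lemma nsE_lift (g : {linear X -> restr phi Y}) :
  exists f : {linear nsE X -> Y}, forall x, f ((x, 0) : nsE X) = g x.
Proof.
have [h hE] : exists h : forall i, {linear extens (nsU i) (nsX X i) -> Y},
    forall i u w, h i (etens u w) = @tinl k G T (io P (nsuv u) * mu P i) *: (g (nsxv w) : Y).
  have H i : exists h : {linear extens (nsU i) (nsX X i) -> Y},
    forall u w, h (etens u w) = @tinl k G T (io P (nsuv u) * mu P i) *: (g (nsxv w) : Y).
    apply: extens_lift => [w u u'|u w w'|a t u w].
    - by rewrite /nsuv /= !rmorphD mulrDl rmorphD scalerDl.
    - by rewrite /nsxv /= linearD scalerDr.
    rewrite nsxv_Z.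
    have -> : nsuv (a *: u) = pr P a * nsuv u by [].
    have -> : g (@tinr k C T t *: nsxv w) = @tinr k G T t *: (g (nsxv w) : Y).
      have <- : phi (@tinr k C T t) = @tinr k G T t.
        by rewrite /phi /tinr /= tmor_tens rmorph1.
      exact: linearZ_LR.
    rewrite !scalerA tinlr; congr (_ *: _).
    rewrite /tinl tensM mulr1; congr tens.
    rewrite [RHS]mulrA [RHS]mulmu; congr (io P _ * _).
    by rewrite [RHS]rmorphM; congr (_ * _); exact/esym/pr_io.
  by exists (fun i => projT1 (cid (H i))) => i; exact: (projT2 (cid (H i))).
have hD i x w : h i (nsD i x w) =
    @tinl k G T (tlift (fun c c' => io P c * mu P i * io P c') w) *: (g x : Y).
  have thb : bilinear_map (fun c c' => io P c * mu P i * io P c').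
    split=> [c a d d'|c a d d'] /=.
      by rewrite linearP !mulrDl -!scalerAl.
    by rewrite linearP mulrDr -scalerAr.
  elim/tensor_ind: w => [|w w' E E'|c c'].
  - by rewrite nsD0r linear0 (tlift0 thb) rmorph0 scale0r.
  - by rewrite nsDDr linearD E E' (tliftD thb) rmorphD scalerDl.
  rewrite nsD_tens hE (tlift_tens thb).
  have -> : nsxv (nsx i (@tinl k C T c' *: x)) = @tinl k C T (xx P i * c') *: x.
    by rewrite rmorphM -scalerA.
  have -> : g (@tinl k C T (xx P i * c') *: x) = @tinl k G T (io P (xx P i * c')) *: (g x : Y).
    have <- : phi (@tinl k C T (xx P i * c')) = @tinl k G T (io P (xx P i * c')).
      by rewrite /phi /tinl /= tmor_tens.
    exact: linearZ_LR.
  have e : io P (nsuv (nsu i c)) * mu P i * io P (xx P i * c') = io P c * mu P i * io P c'.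
    have -> : nsuv (nsu i c) = c * yy P i by [].
    have iM u v : io P (u * v) = io P u * io P v := rmorphM (io P) u v.
    by rewrite !iM -[in RHS](mu_yx P i) !mulrA.
  by rewrite scalerA -rmorphM e.
have [hK hKE] := dirsum_lift h.
(* This identity is the linearity of the candidate on the copy of [X]. For [r = a (x) t] it is the
   expansion of [a] in [G] applied to [g (t x)]: the [io] part gives the first term, the [mu_i]
   parts the second. *)
have key r x : r *: (g x : Y) = g (q r *: x) + hK (nsd X r x).
  rewrite hKE; elim/tensor_ind: r => [|r s Er Es|a t].
  - rewrite !scale0r rmorph0 scale0r linear0 add0r big1 // => i _.
    by rewrite [nsd X 0 x i]nsd_0l linear0.
  - rewrite scalerDl Er Es rmorphD scalerDl linearD addrACA; congr (_ + _).
    rewrite -big_split; apply: eq_bigr => i _ /=.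
    by rewrite -linearD; congr (h i _); exact/esym/nsd_Dl.
  rewrite -[tens a t]tinlr -scalerA.
  have gt : g (@tinr k C T t *: x) = @tinr k G T t *: (g x : Y).
    have <- : phi (@tinr k C T t) = @tinr k G T t.
      by rewrite /phi /tinr /= tmor_tens rmorph1.
    exact: linearZ_LR.
  rewrite -gt; set x' := @tinr k C T t *: x.
  have -> : q (@tinl k G T a * @tinr k G T t) *: x = @tinl k C T (pr P a) *: x'.
    rewrite /x' scalerA tinlr; congr (_ *: x).
    by rewrite tinlr /q /= tmor_tens.
  have -> : g (@tinl k C T (pr P a) *: x') = @tinl k G T (io P (pr P a)) *: (g x' : Y).
    have <- : phi (@tinl k C T (pr P a)) = @tinl k G T (io P (pr P a)).
      by rewrite /phi /tinl /= tmor_tens.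
    exact: linearZ_LR.
  rewrite [in LHS](nse_expand P a) rmorphD scalerDl; congr (_ + _).
  rewrite rmorph_sum scaler_suml; apply: eq_bigr => i _.
  rewrite -hD; congr (h i _); rewrite tinlr.
  exact/esym/nsd_tens.
have fL : linear (fun e : nsE X => (g e.1 : Y) + hK e.2).
  move=> r u v.
  rewrite [g _](linearD g) [hK _]linearD addrACA; congr (_ + _).
  by rewrite [in LHS]linearD scalerDr addrCA -key addrC linearZ_LR.
by exists (Lin fL) => x /=; rewrite linear0 addr0.
Qed.

End Adjunction.

(** A left adjoint of restriction, which keeps surjections: a lift on [X] extends to [nsE X]. *)
Lemma projective_nsE X : projective X -> projective (nsE X).
Proof.
move=> Xpr V W g f gS.
have f0L : linear ((fun x => f ((x, 0) : nsE X)) : X -> restr phi W).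
  move=> s u v; have -> : ((s *: u + v, 0) : nsE X) = phi s *: ((u, 0) : nsE X) + (v, 0).
    by rewrite nsE_phiZ; congr (_, _); rewrite /= addr0.
  exact: linearP.
have [h0 h0E] := Xpr _ _ (restr_lin phi g) (Lin f0L) gS.
have [h hE] := nsE_lift h0; exists h.
by apply: (nsE_ext (f := (g \o h)%FUN)) => x /=; rewrite hE; exact: h0E.
Qed.

Fact ns_tau_subproof X (Y : lmodType R) (f : hom (nsE X) Y) :
  @is_hom k S X (restr phi Y) (fun x : X => val f ((x, 0) : nsE X)).
Proof.
move=> s u v; have -> : ((s *: u + v, 0) : nsE X) = phi s *: ((u, 0) : nsE X) + (v, 0).
  by rewrite nsE_phiZ; congr (_, _); rewrite /= addr0.
exact: (linearP (hom_lin f)).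
Qed.

Definition ns_tau X (Y : lmodType R) (f : hom (nsE X) Y) : hom X (restr phi Y) :=
  @mk_submod k _ (hom_submod X (restr phi Y)) _ (ns_tau_subproof f).

Fact ns_tau_linear X Y : linear (@ns_tau X Y).
Proof.
move=> c f g; apply: hom_eq => x.
have e : GRing.in_alg R c = phi (GRing.in_alg S c).
  apply: etrans (esym (tliftZ (tmap_bilin (io P) (idfun : {linear T -> T})) c 1)).
  exact: (congr1 ( *:%R c) (esym (rmorph1 phi))).
apply: etrans (hom_valP c f g ((x, 0) : nsE X)) _.
rewrite e; exact: (esym (hom_valP c (ns_tau f) (ns_tau g) x)).
Qed.

Lemma Ext_nsE X Y n : lmod_iso (Ext n.+1 (nsE X) Y) (Ext n.+1 X (restr phi Y)).
Proof.
apply: (@Ext_adjoint _ _ _ nsE Y (restr phi Y) (fun X => Lin (@ns_tau_linear X Y))).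
- move=> V f g /(congr1 val) /= e; apply: hom_eq.
  by apply: (nsE_ext (f := hom_lin f) (g := hom_lin g)) => x; exact: (congr1 (fun h => h x) e).
- move=> V g; have [f fE] := nsE_lift (hom_lin g).
  by exists (lin_hom f); apply: hom_eq.
- exact: projective_nsE.
move=> Z F V i p ipS; have [i' [p' [S' i'E]]] := nsE_ses ipS.
exists i', p'; split=> // g; apply: hom_eq => z /=.
by rewrite i'E.
Qed.

Lemma ev_stab_nsE X : (forall i, finite_pd (nsU i)) -> (forall i, finite_pd (nsX X i)) ->
  ev_stable_iso (nsE X) (restr q X).
Proof.
move=> Uf Xf; have [i [p [ipS _ _]]] := cocext_ses (nsd X).
by apply: ev_stab_ses ipS _; apply: fpd_dirsum => j; exact: fpd_extens.
Qed.

(** The inflation of [X] is the quotient of [nsE X] by [nsK X]. Under the two finiteness assumptions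
    this kernel has finite projective dimension, so in high degrees inflation may be traded for
    scalar extension, and then adjunction applies. *)
Lemma Ext_nse X : (forall i, finite_pd (nsU i)) -> (forall i, finite_pd (nsX X i)) ->
  exists h, forall n, (h <= n)%N -> forall Y,
    lmod_iso (Ext n (restr q X) Y) (Ext n X (restr phi Y)).
Proof.
move=> Uf Xf; have [h hE] := Ext_ev_stab (ev_stab_nsE Uf Xf).
exists h.+1 => -[|n] // hn Y.
apply: lmod_iso_trans (lmod_iso_sym (hE _ (ltnW hn) Y)) _.
exact: Ext_nsE.
Qed.

End Induction.

(** * Blocks *)

(* [j] is a multiplicative, possibly non-unital section of [q] whose image is
   the block [R * j 1] of [R] cut out by the central idempotent [j 1]. *)
Record block (k : fieldType) (R S : algType k) := Block {
  bq : {rmorphism R -> S};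
  bj : {linear S -> R};
  bqj : forall s, bq (bj s) = s;
  bjM : forall s t, bj (s * t) = bj s * bj t;
  bjq : forall r, bj (bq r) = r * bj 1;
  bjq' : forall r, bj (bq r) = bj 1 * r
}.

Section BijectiveBlock.
Variables (k : fieldType) (R S : algType k) (q : {rmorphism R -> S}) (j : S -> R).
Hypotheses (jL : linear j) (qK : cancel q j) (jK : cancel j q).

Fact bij_blockM s t : j (s * t) = j s * j t.
Proof. by apply: (can_inj qK); rewrite rmorphM !jK. Qed.

Fact bij_block1 : j 1 = 1.
Proof. by apply: (can_inj qK); rewrite rmorph1 jK. Qed.

Fact bij_blockr r : j (q r) = r * j 1.
Proof. by rewrite bij_block1 mulr1 qK. Qed.

Fact bij_blockl r : j (q r) = j 1 * r.
Proof. by rewrite bij_block1 mul1r qK. Qed.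

(** An isomorphism is the block with [j 1 = 1]; so the results on blocks also transport Ext along
    ring isomorphisms. *)
Definition bij_block : block R S :=
  @Block k R S q (Lin jL) jK bij_blockM bij_blockr bij_blockl.

End BijectiveBlock.

Section BlockModule.
Variables (k : fieldType) (R S : algType k) (b : block R S) (V : lmodType R).

Fact blockmod0 : bj b 1 *: (0 : V) = 0.
Proof. exact: scaler0. Qed.
Fact blockmodD (u v : V) : bj b 1 *: u = u -> bj b 1 *: v = v ->
  bj b 1 *: (u + v) = u + v.
Proof. by move=> ue ve; rewrite scalerDr ue ve. Qed.
Fact blockmodZ (r : R) (v : V) : bj b 1 *: v = v -> bj b 1 *: (r *: v) = r *: v.
Proof. by move=> ve; rewrite scalerA -bjq' bjq -scalerA ve. Qed.

Definition block_submod : submod V := Submod blockmod0 blockmodD blockmodZ.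
(** The part [j(1) V] of [V], as an [S]-module: the right adjoint of restriction along [bq]. *)
Definition blockmod : Type := submod_of block_submod.

HB.instance Definition _ := GRing.Zmodule.on blockmod.

Definition blockmod_scale (s : S) (v : blockmod) : blockmod :=
  (bj b s *: (v : submod_of block_submod)).

Fact blockmod_scaleA s t v :
  blockmod_scale s (blockmod_scale t v) = blockmod_scale (s * t) v.
Proof. by rewrite /blockmod_scale scalerA bjM. Qed.
Fact blockmod_scale1 : left_id 1 blockmod_scale.
Proof. by move=> v; apply: val_inj; exact: (submod_ofP v). Qed.
Fact blockmod_scaleDr : right_distributive blockmod_scale +%R.
Proof. by move=> s u v; exact: scalerDr. Qed.
Fact blockmod_scaleDl v : {morph blockmod_scale^~ v : s t / s + t}.
Proof. by move=> s t; rewrite /blockmod_scale linearD; exact: scalerDl. Qed.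

HB.instance Definition _ := GRing.Zmodule_isLmodule.Build S blockmod
  blockmod_scaleA blockmod_scale1 blockmod_scaleDr blockmod_scaleDl.

Definition block_val (v : blockmod) : V := val (v : submod_of block_submod).

Lemma block_valP v : bj b 1 *: block_val v = block_val v.
Proof. exact: (submod_ofP (v : submod_of block_submod)). Qed.

Lemma block_valD u v : block_val (u + v) = block_val u + block_val v.
Proof. by []. Qed.

Lemma block_valZ s v : block_val (s *: v) = bj b s *: block_val v.
Proof. by []. Qed.

Lemma block_val_inj : injective block_val.
Proof. exact: val_inj. Qed.

Lemma block_lift (X : lmodType S) (f : {linear restr (bq b) X -> V}) :
  exists g : {linear X -> blockmod}, forall x, block_val (g x) = f x.
Proof.
have fE x : bj b 1 *: f x = f x.
  by rewrite -linearZ_LR; congr (f _); rewrite /GRing.scale /= /restr_scale bqj scale1r.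
pose g (x : X) : blockmod := @mk_submod _ _ block_submod (f x) (fE x).
have gL : linear g.
  move=> s u v; apply: block_val_inj.
  have -> : s *: u + v = bj b s *: (u : restr (bq b) X) + v :> X.
    by congr (_ + _); rewrite /GRing.scale /= /restr_scale bqj.
  exact: linearP.
by exists (Lin gL).
Qed.

End BlockModule.

Section BlockRestr.
Variables (k : fieldType) (R S : algType k) (b : block R S).

(** Multiplying a preimage by the central idempotent [bj b 1] shows that [blockmod] keeps
    surjections, so its left adjoint keeps projectives. *)
Lemma projective_restr (X : lmodType S) :
  projective X -> projective (restr (bq b) X).
Proof.
move=> Xpr V W g f gS.
have [f' f'E] := block_lift f.
have ge (v : blockmod b V) : bj b 1 *: block_val v = block_val v -> bj b 1 *: g (block_val v) = g (block_val v).
  by move=> e; rewrite -linearZ_LR e.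
pose g' (v : blockmod b V) : blockmod b W :=
  @mk_submod _ _ (block_submod b W) (g (block_val v)) (ge v (block_valP v)).
have g'L : linear g'.
  by move=> s u v; apply: block_val_inj; exact: linearP.
have [h hE] : exists h : {linear X -> blockmod b V}, forall x, g' (h x) = f' x.
  apply: (Xpr _ _ (Lin g'L) f') => w; have [v vE] := gS (block_val w).
  have ve : bj b 1 *: (bj b 1 *: v) = bj b 1 *: v by rewrite scalerA -bjM mulr1.
  exists (@mk_submod _ _ (block_submod b V) (bj b 1 *: v) ve).
  apply: block_val_inj; rewrite -[RHS]block_valP -vE; exact: linearZ_LR.
have hL : linear ((fun x => block_val (h x)) : restr (bq b) X -> V).
  move=> r u v; rewrite [h _](linearP h (bq b r)) block_valD block_valZ.
  by rewrite bjq -scalerA block_valP.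
exists (Lin hL) => x /=; rewrite -f'E -hE; exact: erefl.
Qed.

Lemma fpd_restr (X : lmodType S) : finite_pd X -> finite_pd (restr (bq b) X).
Proof.
move=> [n]; elim: n X => [|n IH] X Xn; first exact/fpd_projective/projective_restr.
apply: (fpd_ses (restr_ses (bq b) (free_syzygy_ses X))).
  by apply: IH; rewrite -free_syzS.
by apply/fpd_projective/projective_restr; exact: free_projective.
Qed.

Section Adjunction.
Variables (Y : lmodType R) (Y' : lmodType S) (th : Y' -> Y).
Hypothesis thD : {morph th : x y / x + y}.
Hypothesis thZ : forall s y, th (s *: y) = bj b s *: th y.
Hypothesis thI : injective th.
Hypothesis thS : forall y, bj b 1 *: y = y -> exists y', th y' = y.

Fact block_tau_subproof (X : lmodType S) (f : hom (restr (bq b) X) Y) :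
  exists g : hom X Y', forall x, th (val g x) = val f x.
Proof.
have [g gE] := block_lift (hom_lin f).
have H x : exists y', th y' = block_val (g x) by exact/thS/block_valP.
have hL : linear (fun x => projT1 (cid (H x))).
  move=> s u v; apply: thI; rewrite thD thZ !(projT2 (cid (H _))).
  by rewrite linearP.
by exists (lin_hom (Lin hL)) => x /=; rewrite (projT2 (cid (H x))) gE.
Qed.

Definition block_tau X f : hom X Y' := projT1 (cid (@block_tau_subproof X f)).

Lemma block_tauE X f x : th (val (@block_tau X f) x) = val f x.
Proof. exact: (projT2 (cid (@block_tau_subproof X f))). Qed.

Fact block_tau_linear X : linear (@block_tau X).
Proof.
move=> c f g; apply: hom_eq => x; apply: thI.
apply: etrans (block_tauE _ x) _; rewrite (hom_valP c f g x).
rewrite (hom_valP c (block_tau f) (block_tau g) x) thD thZ !block_tauE.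
congr (_ + _); rewrite -(block_tauE f) linearZ_LR /=.
by rewrite -[in RHS]mulr_algl -scalerA -thZ scale1r.
Qed.

(** Restriction along a surjection onto a block is exact and keeps projectives, and Hom out of a
    restricted module only sees [j(1) Y]. The map [th] identifies [Y'] with that part, so a
    convenient model of it can be chosen in each use. *)
Lemma Ext_block X n : lmod_iso (Ext n.+1 (restr (bq b) X) Y) (Ext n.+1 X Y').
Proof.
apply: (@Ext_adjoint _ _ _ (fun X => restr (bq b) X) Y Y' (fun X => Lin (@block_tau_linear X))).
- move=> V f g /= e; apply: hom_eq => x.
  by rewrite -(block_tauE f) -(block_tauE g) e.
- move=> V g; have fL : linear ((fun x => th (val g x)) : restr (bq b) V -> Y).
    move=> r u v; have -> : val g (r *: u + v) = bq b r *: val g u + val g v.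
      exact: (linearP (hom_lin g)).
    have e : bj b 1 *: th (val g u) = th (val g u) by rewrite -thZ scale1r.
    by rewrite thD thZ bjq -scalerA e.
  exists (lin_hom (Lin fL)); apply: hom_eq => x; apply: thI.
  by rewrite [LHS]block_tauE.
- exact: projective_restr.
move=> Z F V i p ipS; exists (restr_lin (bq b) i), (restr_lin (bq b) p); split=> // g.
apply: hom_eq => z; apply: thI.
by rewrite [LHS]block_tauE /= [in RHS]block_tauE.
Qed.

End Adjunction.
End BlockRestr.

Lemma Ext_iso (k : fieldType) (R : algType k) (X X' Y : lmodType R) n
    (u : {linear X -> X'}) (v : {linear X' -> X}) :
  cancel u v -> cancel v u -> lmod_iso (Ext n.+1 X Y) (Ext n.+1 X' Y).
Proof. by move=> uK vK; apply/Ext_stab/stab_free_syz/(stab_iso uK vK). Qed.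

(** * Opposite extensions and finiteness *)

(** Along an edge from [i] to [j] the set of reachable vertices shrinks strictly, since it loses
    [i]; induction is on its cardinality. *)
Lemma acyclic_ind (I : finType) (r : rel I) (Q : I -> Prop) :
  (forall i j, r i j -> ~~ connect r j i) ->
  (forall i, (forall j, r i j -> Q j) -> Q i) -> forall i, Q i.
Proof.
move=> ac step i; have [n] := ubnP #|connect r i|.
elim: n i => // n IH i lt_n; apply: step => j rij.
apply: IH; apply: (leq_trans _ (lt_n : (#|connect r i| <= n)%N)).
apply: proper_card; apply/properP; split.
  by apply/fintype.subsetP => l; rewrite !inE; apply/connect_trans/connect1.
by exists i; rewrite !inE ?connect0 // ac.
Qed.

Section OppositeMorphism.
Variables (k : fieldType) (A B : algType k) (f : {lrmorphism A -> B}).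

Definition oppmor (a : A^c) : B^c := f a.

Fact oppmor_linear : linear oppmor.
Proof. exact: (linearP f). Qed.
Fact oppmor_monoid : monoid_morphism oppmor.
Proof. by split=> [|x y]; [exact: (rmorph1 f) | exact: (rmorphM f)]. Qed.
HB.instance Definition _ := GRing.isLinear.Build k A^c B^c *:%R oppmor oppmor_linear.
HB.instance Definition _ := GRing.isMonoidMorphism.Build A^c B^c oppmor oppmor_monoid.

End OppositeMorphism.

Section OppositeTensor.
Variables (k : fieldType) (A B : algType k).

Fact topp_bilin : bilinear_map (fun (a : A) (b : B) => @tens k B^c A^c b a).
Proof.
split=> [b c a a'|a c b b'] /=.
  by rewrite [LHS](@tensDr k B^c A^c) [X in X + _](@tensZr k B^c A^c).
by rewrite [LHS](@tensDl k B^c A^c) [X in X + _](@tensZl k B^c A^c).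
Qed.

Definition topp (t : tensor A B) : tensor B^c A^c :=
  tlift (fun (a : A) (b : B) => @tens k B^c A^c b a) t.

HB.instance Definition _ :=
  GRing.isLinear.Build k (tensor A B) (tensor B^c A^c) *:%R topp (tlift_linear topp_bilin).

Lemma topp_tens a b : topp (tens a b) = tens (b : B^c) (a : A^c).
Proof. exact: (tlift_tens topp_bilin). Qed.

Lemma topp0 : topp 0 = 0. Proof. exact: (tlift0 topp_bilin). Qed.
Lemma toppD s t : topp (s + t) = topp s + topp t.
Proof. exact: (tliftD topp_bilin). Qed.
Lemma toppZ c t : topp (c *: t) = c *: topp t.
Proof. exact: linearZ_LR. Qed.

Lemma topp_mul s t : topp (s * t) = topp t * topp s.
Proof.
elim/tensor_ind: s => [|s s' E E'|a b]; first by rewrite mul0r topp0 mulr0.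
  by rewrite mulrDl !toppD mulrDr E E'.
elim/tensor_ind: t => [|t t' E E'|a' b']; first by rewrite mulr0 topp0 mul0r.
  by rewrite mulrDr !toppD mulrDl E E'.
by rewrite tensM !topp_tens [RHS]tensM.
Qed.

End OppositeTensor.

Definition alg_tensor_lin (k : fieldType) (G C : algType k) (f : G -> tensor C C)
  (fL : linear f) : {linear G -> tensor C C} := Lin fL.

Section OppositeExtension.
Variables (k : fieldType) (C G : algType k) (I : finType) (P : nse C G I).

Fact nse_op_rho_linear i :
  linear ((fun g => topp (rho P i g)) :
    (G^c : algType k) -> tensor (C^c : algType k) (C^c : algType k)).
Proof.
move=> a g h.
have e : rho P i (a *: (g : G) + (h : G)) = a *: rho P i g + rho P i h.
  exact: (linearP (rho P i)).
rewrite [LHS](congr1 (@topp k C C) e) [LHS]toppD; congr (_ + _).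
exact: toppZ.
Qed.

(** The idempotents [xx] and [yy] trade places, so the left module [nsU] of the opposite extension
    is [x_i C] as a right [G]-module. *)
Definition nse_op : nse C^c G^c I.
Proof.
refine (@Nse k C^c G^c I (oppmor (io P)) (oppmor (pr P)) (mu P) (xx P) (yy P)
  (fun i => @alg_tensor_lin k G^c C^c _ (@nse_op_rho_linear i))
  (pr_io P) (pr_mu P) _ _ _ (xx_idem P) (yy_idem P) _
  (fun g i => mumul P i g) (fun i g => mulmu P g i) _) => /=.
- by move=> i c; rewrite -[RHS](@topp0 k C C); congr topp; exact: rho_io.
- move=> i j; rewrite rho_mu; case: eqP => _; last exact: topp0.
  exact: topp_tens.
- move=> i g h; rewrite [X in topp X](rho_mul P i h g) toppD addrC.
  by rewrite !topp_mul !topp_tens.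
- by move=> i; rewrite -[RHS](mu_yx P i) -mulrA.
move=> g; rewrite {1}(nse_expand P g); congr (_ + _).
have big_opp (F : I -> G) : (\sum_i F i : G) = (\sum_i (F i : G^c) : G^c) by [].
rewrite big_opp; apply: eq_bigr => i _.
have b1 : @bilinear_map k C C G (fun c c' => io P c * mu P i * io P c').
  split=> [c a d d'|c a d d'] /=; first by rewrite linearP !mulrDl -!scalerAl.
  by rewrite linearP mulrDr -scalerAr.
have b2 : @bilinear_map k C^c C^c G^c
    (fun c c' => (oppmor (io P) c * mu P i * oppmor (io P) c')).
  split=> [c a d d'|c a d d']; first by rewrite linearP !mulrDl -!scalerAl.
  by rewrite linearP mulrDr -scalerAr.
elim/tensor_ind: (rho P i g) => [|w w' E E'|c c'].
- by rewrite (tlift0 b1) topp0 (tlift0 b2).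
- by rewrite (tliftD b1) toppD (tliftD b2) E E'.
rewrite (tlift_tens b1) topp_tens (tlift_tens b2).
exact: (esym (mulrA (io P c) (mu P i) (io P c'))).
Defined.

End OppositeExtension.

Section Swap.
Variables (k : fieldType) (A B : algType k).

Definition swapmor (t : tensor A B) : tensor B A := tswap t.

Fact swapmor_zmod : zmod_morphism swapmor.
Proof. exact: linearB. Qed.
Fact swapmor_monoid : monoid_morphism swapmor.
Proof.
have D : {morph swapmor : x y / x + y} := linearD (@tswap k A B).
have t1 a b : swapmor (tens a b) = tens b a := tswap_tens a b.
split=> [|s t]; first exact: t1.
elim/tensor_ind: s => [|s s' E E'|a b].
- by rewrite mul0r !(additive0 D) mul0r.
- by rewrite mulrDl !D mulrDl -E -E'.
elim/tensor_ind: t => [|s s' E E'|a' b'].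
- by rewrite mulr0 !(additive0 D) mulr0.
- by rewrite mulrDr !D mulrDr -E -E'.
by rewrite tensM !t1 tensM.
Qed.
HB.instance Definition _ :=
  GRing.isZmodMorphism.Build (tensor A B) (tensor B A) swapmor swapmor_zmod.
HB.instance Definition _ :=
  GRing.isMonoidMorphism.Build (tensor A B) (tensor B A) swapmor swapmor_monoid.

Lemma swapmor_tens a b : swapmor (tens a b) = tens b a.
Proof. exact: tswap_tens. Qed.

Definition scalmor (t : tensor A k^o) : A := tlift (fun (a : A) (c : k^o) => c *: a) t.

Fact scalmor_bilin : bilinear_map (fun (a : A) (c : k^o) => c *: a).
Proof.
split=> [c a x y|a c x y] /=; first by rewrite scalerDr !scalerA mulrC.
by rewrite scalerDl scalerA.
Qed.

Lemma scalmor_tens a c : scalmor (tens a c) = c *: a.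
Proof. exact: (tlift_tens scalmor_bilin). Qed.

Lemma scalmorD : {morph scalmor : s t / s + t}.
Proof. exact: (tliftD scalmor_bilin). Qed.

Fact scalmor_linear : linear scalmor.
Proof. exact: (tlift_linear scalmor_bilin). Qed.
Fact scalmor_monoid : monoid_morphism scalmor.
Proof.
split=> [|s t]; first by rewrite [LHS]scalmor_tens scale1r.
elim/tensor_ind: s => [|s s' E E'|a b].
- by rewrite mul0r !(additive0 scalmorD) mul0r.
- by rewrite mulrDl !scalmorD mulrDl -E -E'.
elim/tensor_ind: t => [|s s' E E'|a' b'].
- by rewrite mulr0 !(additive0 scalmorD) mulr0.
- by rewrite mulrDr !scalmorD mulrDr -E -E'.
by rewrite tensM !scalmor_tens -scalerAr -scalerAl scalerA mulrC.
Qed.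
HB.instance Definition _ :=
  GRing.isLinear.Build k (tensor A k^o) A *:%R scalmor scalmor_linear.
HB.instance Definition _ :=
  GRing.isMonoidMorphism.Build (tensor A k^o) A scalmor scalmor_monoid.

Fact tinl_linear : linear (@tinl k A B).
Proof. by move=> c a a'; rewrite /tinl tensDl tensZl. Qed.

End Swap.

Definition swap_block (k : fieldType) (A B : algType k) :
  block (tensor A B) (tensor B A) :=
  @bij_block k (tensor A B) (tensor B A) (@swapmor k A B) (@tswap k B A)
    (linearP (@tswap k B A)) (@tswapK k A B) (@tswapK k B A).

Lemma tinl_scal (k : fieldType) (A : algType k) (t : tensor A k^o) :
  @tinl k A k^o (scalmor t) = t.
Proof.
apply: (tensor_additive_ext (f := fun t => @tinl k A k^o (scalmor t)) (g := id)) => //.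
  by move=> x y; rewrite scalmorD rmorphD.
move=> a c; rewrite scalmor_tens /tinl tensZl -tensZr.
by congr tens; exact: mulr1.
Qed.

Lemma scal_tinl (k : fieldType) (A : algType k) (a : A) : scalmor (@tinl k A k^o a) = a.
Proof. by rewrite /tinl scalmor_tens scale1r. Qed.

(** With [tinl_block] it gives both directions of [A (x) k = A]: one makes a [C]-module a module
    over [C (x) k], the other returns from [G (x) k] to [G]. *)
Definition scal_block (k : fieldType) (A : algType k) : block (tensor A k^o) A :=
  @bij_block k (tensor A k^o) A (@scalmor k A) (@tinl k A k^o) (@tinl_linear k A k^o)
    (@tinl_scal k A) (@scal_tinl k A).

Definition tinl_block (k : fieldType) (A : algType k) : block A (tensor A k^o) :=
  @bij_block k A (tensor A k^o) (@tinl k A k^o) (@scalmor k A) (@scalmor_linear k A)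
    (@scal_tinl k A) (@tinl_scal k A).

Lemma projective_regular (R : pzRingType) : projective (R^o : lmodType R).
Proof.
move=> V W g f gS; have [v vE] := gS (f 1).
have hL : linear ((fun r => r *: v) : R^o -> V).
  by move=> a r s; rewrite scalerDl -scalerA.
by exists (Lin hL) => r /=; rewrite linearZ_LR vE -linearZ_LR; congr (f _); exact: mulr1.
Qed.

Lemma projective_lideal (R : nzRingType) (e : R) : e * e = e ->
  projective (lideal e).
Proof.
move=> ee.
have rL : linear ((fun c => @mk_submod _ _ (Submod (@lideal0 R e) (@lidealD R e) (@lidealZ R e))
    (c * e) (ex_intro _ c erefl)) : R^o -> lideal e).
  by move=> a c d; apply: val_inj; rewrite /= mulrDl -mulrA.
apply: (projective_retract (i := (val : {linear lideal e -> R^o})) (r := Lin rL) _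
  (@projective_regular R)) => u.
by apply: val_inj => /=; have [c ->] := submod_ofP u; rewrite -mulrA ee.
Qed.

(** * Finite projective dimension of the inflated modules [C y_i] *)

Section FiniteDimension.
Variables (k : fieldType) (C G : algType k) (I : finType) (P : nse C G I).

Definition nse_rel : rel I := fun i j => `[< exists c, xx P j * c * yy P i <> 0 >].

Hypothesis acyclic : forall i j, nse_rel i j -> ~~ connect nse_rel j i.

(** With [T = k], the module [nsE] of [C y_i] is projective and covers the inflated [C y_i]; the
    kernel is the sum of the [C y_j (x) x_j C y_i], where only successors [j] of [i] contribute.
    Acyclicity makes this an induction. *)
Lemma fpd_nsU i : finite_pd (nsU P i).
Proof.
move: i; apply: (acyclic_ind acyclic) => i IH.
pose Y : lmodType (tensor C k^o) := restr (bq (scal_block C)) (lideal (yy P i)).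
have Ypr : projective Y by apply/projective_restr/projective_lideal/yy_idem.
have [l [p [S _ _]]] := cocext_ses (nsd P Y).
have Kf : finite_pd (nsK P Y).
  apply: fpd_dirsum => j.
  (* For a successor [j] the second tensor factor is a vector space, hence projective over [k];
     otherwise [x_j C y_i] is zero and so is the summand. *)
  have [rij|nr] := boolP (nse_rel i j).
    apply: fpd_extens; first exact: IH.
    by apply: fpd_projective; exact: (@projective_field k).
  apply/fpd_projective/projective_zero; apply: etens_ind => [//|s t -> ->|u w].
    by rewrite addr0.
  have -> : w = 0; last exact: etens0r.
  apply: val_inj; rewrite -[LHS](submod_ofP w).
  apply: (@val_inj _ _ (lideal (yy P i))).
  have [c cE] := submod_ofP (nsxv w : lideal (yy P i)).
  apply: contrapT => ne; move/negP: nr; apply; apply/asboolP; exists c => e; apply: ne.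
  have -> : val (@tinl k C k^o (xx P j) *: (nsxv w : Y) : lideal (yy P i)) =
     scalmor (@tinl k C k^o (xx P j)) * val (nsxv w : lideal (yy P i)) by [].
  by rewrite scal_tinl cE mulrA e.
have Xf := fpd_ses S Kf (fpd_projective (@projective_nsE _ _ _ _ P _ _ Ypr)).
(* Returns from [G (x) k] to [G]; what remains is that the two inflations of [C y_i] carry the same
   action. *)
have := fpd_restr (tinl_block G) Xf.
have sc g : scalmor (tmor (pr P) (idfun : {lrmorphism k^o -> k^o}) (@tinl k G k^o g)) = pr P g.
  by rewrite /tinl tmor_tens scalmor_tens scale1r.
set X := restr (bq (tinl_block G)) _ => Xfpd.
have sE (g : G) (u : nsU P i) : g *: u = g *: (u : X) :> lideal (yy P i).
  by rewrite [RHS]/(scalmor (tmor (pr P) (idfun : {lrmorphism k^o -> k^o}) (@tinl k G k^o g)) *: (u : lideal (yy P i))) sc.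
have uL : linear (id : nsU P i -> X) by move=> g u v; congr (_ + _); exact: sE.
have vL : linear (id : X -> nsU P i) by move=> g u v; congr (_ + _); exact/esym/sE.
exact: (fpd_iso (u := Lin uL) (v := Lin vL)).
Qed.

End FiniteDimension.

(** * Bimodules over a square-zero extension *)

Lemma nse_rel_op (k : fieldType) (C G : algType k) (I : finType) (P : nse C G I) i j :
  nse_rel (nse_op P) i j = nse_rel P j i.
Proof.
by apply/asboolP/asboolP => -[c cE]; exists c => e; apply: cE;
  rewrite -[RHS]e; [exact: (mulrA (xx P i) c (yy P j)) | exact/esym/(mulrA (xx P i) c (yy P j))].
Qed.

Lemma nse_acyclic_op (k : fieldType) (C G : algType k) (I : finType) (P : nse C G I) :
  (forall i j, nse_rel P i j -> ~~ connect (nse_rel P) j i) ->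
  forall i j, nse_rel (nse_op P) i j -> ~~ connect (nse_rel (nse_op P)) j i.
Proof.
move=> ac i j; rewrite nse_rel_op => /ac; apply: contra.
have -> : connect (nse_rel (nse_op P)) j i = connect [rel x y | nse_rel P y x] j i.
  by apply: eq_connect => a b; exact: nse_rel_op.
by rewrite connect_rev.
Qed.

Section Bimodule.
Variables (k : fieldType) (C G : algType k) (I : finType) (P : nse C G I).
Local Notation Go := (G^c : algType k).
Local Notation R := (tensor G G^c).
Local Notation Pop := (nse_op P).
Hypothesis acyclic : forall i j, nse_rel P i j -> ~~ connect (nse_rel P) j i.

Let q : {rmorphism R -> tensor C C^c} := @tmor k G C G^c C^c (pr P) (oppmor (pr P)).

Definition bimG : lmodType R := (regbim G : lmodType (env G)).
Definition bimC : lmodType (tensor C C^c) := (regbim C : lmodType (env C)).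

Lemma bimGE (a : G) (b : G^c) (x : bimG) : (tens a b : R) *: x = (a * (x : G) * (b : G) : G).
Proof. exact: (regbim_scale_tens a b x). Qed.

Lemma bimCE (a : C) (b : C^c) (x : bimC) :
  (tens a b : tensor C C^c) *: x = (a * (x : C) * (b : C) : C).
Proof. exact: (regbim_scale_tens a b x). Qed.

Definition nsth i (w : tensor C C) : G := tlift (fun c c' => io P c * mu P i * io P c') w.

Fact nsth_bilin i : bilinear_map (fun c c' => io P c * mu P i * io P c').
Proof.
split=> [c a d d'|c a d d'] /=; first by rewrite linearP !mulrDl -!scalerAl.
by rewrite linearP mulrDr -scalerAr.
Qed.

(** The ideal [P] as a [G]-bimodule: since its square is zero, [G] acts on both sides through
    [pr]. *)
Definition nsKoo : lmodType R := dirsum (fun i => extens (nsU P i) (nsU Pop i)).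

Lemma io_M u v : io P (u * v) = io P u * io P v. Proof. exact: rmorphM. Qed.
Lemma pr_M u v : pr P (u * v) = pr P u * pr P v. Proof. exact: rmorphM. Qed.
Lemma io_D u v : io P (u + v) = io P u + io P v. Proof. exact: linearD. Qed.

Lemma pr_D u v : pr P (u + v) = pr P u + pr P v. Proof. exact: linearD. Qed.

Lemma nsKoo_lift : exists h : forall i, {linear extens (nsU P i) (nsU Pop i) -> bimG},
  forall i u v, h i (etens u v) = io P (nsuv u) * mu P i * io P (nsuv v : C) :> G.
Proof.
have H i : exists h : {linear extens (nsU P i) (nsU Pop i) -> bimG},
    forall u v, h (etens u v) = io P (nsuv u) * mu P i * io P (nsuv v : C) :> G.
  apply: (extens_lift (W := bimG)) => [v u u'|u v v'|a b u v].
  - by rewrite /nsuv /= io_D !mulrDl.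
  - by rewrite [nsuv (v + v')]/(nsuv v + nsuv v') io_D mulrDr.
  rewrite bimGE.
  have -> : nsuv (a *: u) = pr P a * nsuv u by [].
  have -> : (nsuv (b *: v) : C) = (nsuv v : C) * pr P (b : G) by [].
  rewrite !io_M.
  have e1 : a * (io P (nsuv u) * mu P i) = io P (pr P a) * io P (nsuv u) * mu P i.
    by rewrite mulrA [LHS]mulmu pr_M pr_io io_M.
  have e2 : mu P i * (io P (nsuv v : C) * (b : G)) = mu P i * (io P (nsuv v : C) * io P (pr P (b : G))).
    by rewrite [LHS]mumul pr_M pr_io io_M.
  by rewrite -[LHS]mulrA -e2 mulrA -e1 !mulrA.
by exists (fun i => projT1 (cid (H i))) => i; exact: (projT2 (cid (H i))).
Qed.

Definition nsco i (w : tensor C C) : extens (nsU P i) (nsU Pop i) :=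
  @tlift k C C (tensor (restr (GRing.in_alg G) (nsU P i)) (restr (GRing.in_alg Go) (nsU Pop i)))
    (fun c c' => etens (nsu P i c) (nsu Pop i (c' : C^c))) w.

Fact nsco_bilin i : @bilinear_map k C C
  (tensor (restr (GRing.in_alg G) (nsU P i)) (restr (GRing.in_alg Go) (nsU Pop i)))
  (fun c c' => etens (nsu P i c) (nsu Pop i (c' : C^c))).
Proof.
split=> [c' a c d|c a c' d'].
  rewrite nsuD etensDl; congr (_ + _).
  have -> : nsu P i (a *: c) = a%:A *: nsu P i c.
    by rewrite -nsuZ rmorph_alg mulr_algl.
  exact: tensZl.
have -> : nsu Pop i (a *: c' + d' : C^c) = (a%:A : Go) *: nsu Pop i (c' : C^c) + nsu Pop i (d' : C^c).
  rewrite -nsuZ -nsuD; congr (nsu Pop i (_ + _)).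
  by rewrite (rmorph_alg (pr Pop)) mulr_algl.
rewrite etensDr; congr (_ + _).
exact: tensZr.
Qed.

Lemma nsco_tens i c c' : nsco i (tens c c') = etens (nsu P i c) (nsu Pop i (c' : C^c)).
Proof. exact: (tlift_tens (nsco_bilin i)). Qed.

(** The bimodule sequence with kernel [P], middle term [G] and quotient [C]. The ideal [P] is a sum
    of external tensor products of an inflated [C y_i] and an inflated [x_i C], both of finite
    projective dimension. [nsco] after [rho] inverts the map from these products to [P]. *)
Lemma ev_stab_bim : ev_stable_iso bimG (restr q bimC).
Proof.
have [h hE] := nsKoo_lift; have [hK hKE] := dirsum_lift h.
have hco i w : h i (nsco i w) = nsth i w.
  have bb := nsth_bilin i; have cb := nsco_bilin i.
  elim/tensor_ind: w => [|w w' E E'|c c'].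
  - by rewrite /nsco (tlift0 cb) linear0 /nsth (tlift0 bb).
  - by rewrite /nsco (tliftD cb) -/(nsco i _) -/(nsco i _) linearD E E' /nsth (tliftD bb).
  rewrite nsco_tens hE /nsth (tlift_tens bb).
  have -> : nsuv (nsu P i c) = c * yy P i by [].
  have -> : (nsuv (nsu Pop i (c' : C^c)) : C) = xx P i * c' by [].
  by rewrite !io_M -[in RHS](mu_yx P i) !mulrA.
have rh i j t : i != j -> rho P i (h j t) = 0.
  move=> ne.
  elim/etens_ind: t => [|s t Es Et|u v]; first by rewrite !linear0.
    by rewrite linearD [LHS]linearD Es Et addr0.
  rewrite hE rho_mul rho_io mulr0 add0r rho_mul rho_mu (negPf ne) rho_io.
  by rewrite mul0r mulr0 addr0 mul0r.
have rhi i t : nsco i (rho P i (h i t)) = t.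
  elim/etens_ind: t => [|s t Es Et|u v].
  - by rewrite !linear0; exact: (tlift0 (nsco_bilin i)).
  - rewrite linearD [rho P i _]linearD [LHS](tliftD (nsco_bilin i)).
    by congr (_ + _).
  rewrite hE rho_mul rho_io mulr0 add0r rho_mul rho_mu eqxx rho_io mul0r addr0.
  rewrite !pr_io !tensM mul1r mulr1 nsco_tens; congr etens.
    apply: val_inj => /=; have [c cE] := submod_ofP u.
    by rewrite /nsuv cE -!mulrA !yy_idem.
  rewrite -[RHS]nsu_val; congr (nsu Pop i).
  have [c cE] := submod_ofP v.
  rewrite /nsuv cE.
  have e : xx P i * (xx P i * (c : C)) = xx P i * (c : C) by rewrite mulrA xx_idem.
  exact: e.
have piL : linear (fun g : bimG => (pr P g : restr q bimC)).
  apply: tensor_linear => [g g'|a b g]; first exact: linearD.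
  rewrite bimGE; have -> : tens a b *: (pr P g : restr q bimC) = q (tens a b) *: (pr P g : bimC) by [].
  by rewrite /q /= tmor_tens bimCE !pr_M.
have prh i t : pr P (h i t) = 0.
  elim/etens_ind: t => [|s t Es Et|u v]; first by rewrite !linear0.
    by rewrite (linearD (h i)) pr_D Es Et addr0.
  by rewrite hE !pr_M pr_mu mulr0 mul0r.
apply: (@ev_stab_ses _ nsKoo _ _ hK (Lin piL)); last first.
  apply: fpd_dirsum => i; apply: fpd_extens; first exact: fpd_nsU.
  exact/fpd_nsU/nse_acyclic_op.
split.
- move=> s t e; apply: functional_extensionality_dep => i.
  have co u : nsco i (rho P i (hK u)) = u i.
    rewrite hKE -[RHS]rhi linear_sum (bigD1 i) //= big1 ?addr0 // => j ne.
    by rewrite rh // eq_sym.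
  by rewrite -co e co.
- by move=> c; exists (io P c); exact: pr_io.
move=> g; split=> [/= g0|[t ->]].
  exists (fun i => nsco i (rho P i g)).
  rewrite hKE {1}(nse_expand P g) g0 linear0 add0r.
  by apply: eq_bigr => i _; rewrite hco.
rewrite hKE linear_sum big1 // => i _; exact: prh.
Qed.

End Bimodule.

Section EnvTensor.
Variables (k : fieldType) (A : algType k).

Definition env_id (t : env A) : tensor A A^c := t.

Fact env_id_zmod : zmod_morphism env_id. Proof. by []. Qed.
Fact env_id_monoid : monoid_morphism env_id. Proof. by []. Qed.
HB.instance Definition _ :=
  GRing.isZmodMorphism.Build (env A) (tensor A A^c) env_id env_id_zmod.
HB.instance Definition _ :=
  GRing.isMonoidMorphism.Build (env A) (tensor A A^c) env_id env_id_monoid.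

Fact env_inv_linear :
  linear (id : (tensor A A^c : algType k) -> (env A : algType k)).
Proof. by []. Qed.

(** [env A] and [tensor A A^c] are two names for one ring, each with its own algebra structure; this
    block moves Ext from one to the other. *)
Definition env_block : block (env A) (tensor A A^c) :=
  @bij_block k (env A) (tensor A A^c) env_id id env_inv_linear
    (fun r => erefl r) (fun r => erefl r).

Lemma HH_tensor n : lmod_iso (HH n.+1 A) (Ext n.+1 (bimG A) (bimG A)).
Proof.
apply: lmod_iso_trans; last first.
  apply: (@Ext_block _ _ _ env_block (regbim A : lmodType (env A)) (bimG A) id) => //.
  by move=> y _; exists y.
have uL : linear (id : (regbim A : lmodType (env A)) -> restr (bq env_block) (bimG A)).
  by move=> r u v.
have vL : linear (id : restr (bq env_block) (bimG A) -> (regbim A : lmodType (env A))).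
  by move=> r u v.
exact: (@Ext_iso _ _ _ _ _ n (Lin uL) (Lin vL)).
Qed.

End EnvTensor.

(** * From [G]-bimodules to [C]-bimodules, one side at a time *)

Section Chain.
Variables (k : fieldType) (C G : algType k) (I : finType) (P : nse C G I).
Local Notation Pop := (nse_op P).
Hypothesis acyclic : forall i j, nse_rel P i j -> ~~ connect (nse_rel P) j i.

Let sw := swap_block C G^c.
Let sw3 := swap_block C^c C.

(** Scalar extension changes only the first tensor factor, so the right action of [C] is moved
    there, inflated to [G^c], and moved back. [bimC_left] is thus [C] with [C] on the left and [G]
    on the right, presented so that the opposite extension applies to it later. *)
Definition bimC_swap : lmodType (tensor C^c C) := restr (bq sw3) (bimC C).
Definition bimC_infl : lmodType (tensor G^c C) :=
  restr (@tmor k G^c C^c C C (pr Pop) idfun) bimC_swap.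
Definition bimC_left : lmodType (tensor C G^c) := restr (bq sw) bimC_infl.

Lemma bimC_swapE (a : C^c) (b : C) (x : C) :
  ((tens a b : tensor C^c C) *: (x : bimC_swap) : C) = b * x * (a : C).
Proof.
have -> : (tens a b : tensor C^c C) *: (x : bimC_swap) = (@swapmor k C^c C (tens a b)) *: (x : bimC C) by [].
by rewrite swapmor_tens bimCE.
Qed.

Lemma bimC_leftE (a : C) (b : G^c) (x : C) :
  ((tens a b : tensor C G^c) *: (x : bimC_left) : C) = a * x * pr P (b : G).
Proof.
have -> : (tens a b : tensor C G^c) *: (x : bimC_left) =
  @tmor k G^c C^c C C (pr Pop) idfun (@swapmor k C G^c (tens a b)) *: (x : bimC_swap) by [].
by rewrite swapmor_tens tmor_tens bimC_swapE.
Qed.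

(** Here [x_i X] is [x_i C] as an inflated right [G]-module, which is [nsU] of the opposite
    extension. *)
Lemma fpd_nsX_left i : finite_pd (nsX P bimC_left i).
Proof.
have xiE (x : C) : ((@tinl k C G^c (xx P i) *: (x : bimC_left)) : C) = xx P i * x.
  by rewrite /tinl bimC_leftE rmorph1 mulr1.
have xr (w : nsX P bimC_left i) : xx P i * (nsxv w : C) = (nsxv w : C).
  by rewrite -xiE; exact: (submod_ofP w).
pose u (w : nsX P bimC_left i) : nsU Pop i := nsu Pop i ((nsxv w : C) : C^c).
pose v (w : nsU Pop i) : nsX P bimC_left i := nsx P i ((nsuv w : C) : bimC_left).
have tE (t : G^c) (x : C) : ((@tinr k C G^c t *: (x : bimC_left)) : C) = x * pr P (t : G).
  by rewrite /tinr bimC_leftE mul1r.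
have uL : linear u.
  move=> t a b; rewrite /u -nsuZ -nsuD; congr (nsu Pop i _).
  rewrite nsxv_D nsxv_Z; exact: (congr1 (fun x => x + (nsxv b : C)) (tE t (nsxv a))).
have vL : linear v.
  move=> t a b; rewrite /v -nsx_Z -nsx_D; congr (nsx P i (_ + _)).
  by rewrite [RHS](tE t (nsuv a)).
apply: (fpd_iso (u := Lin uL) (v := Lin vL)); last exact/fpd_nsU/nse_acyclic_op.
- move=> w /=; rewrite /v /u.
  have -> : (nsuv (nsu Pop i ((nsxv w : C) : C^c)) : C) = nsxv w by exact: xr.
  exact: nsx_val.
move=> w /=; rewrite /v /u.
have -> : (nsxv (nsx P i ((nsuv w : C) : bimC_left)) : C) = xx P i * (nsuv w : C) by exact: xiE.
have -> : xx P i * (nsuv w : C) = (nsuv w : C).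
  exact: (congr1 (@nsuv _ _ _ _ Pop i) (nsu_val w)).
exact: (@nsu_val _ _ _ _ Pop i w).
Qed.

(** By now the other side carries only [C], and the module in question is [C y_i] over [C]: a
    retract of [C], by right multiplication with [y_i]. *)
Lemma fpd_nsX_right i : finite_pd (nsX Pop bimC_swap i).
Proof.
have xiE (x : C) : ((@tinl k C^c C (xx Pop i) *: (x : bimC_swap)) : C) = x * yy P i.
  by rewrite /tinl bimC_swapE mul1r.
have tE (t : C) (x : C) : ((@tinr k C^c C t *: (x : bimC_swap)) : C) = t * x.
  by rewrite /tinr bimC_swapE mulr1.
pose u (w : nsX Pop bimC_swap i) : C^o := (nsxv w : C).
pose v (c : C^o) : nsX Pop bimC_swap i := nsx Pop i ((c : C) : bimC_swap).
have uL : linear u.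
  by move=> t a b; exact: (congr1 (fun x => x + (nsxv b : C)) (tE t (nsxv a))).
have vL : linear v.
  by move=> t a b; rewrite /v -nsx_Z -nsx_D; congr (nsx Pop i (_ + _)); exact/esym/tE.
apply/fpd_projective/(projective_retract (i := Lin uL) (r := Lin vL) _ (@projective_regular C)).
by move=> w; exact: nsx_val.
Qed.

Definition bimG_restr : lmodType (tensor C C^c) :=
  restr (@tmor k C G C^c G^c (io P) (oppmor (io P))) (bimG G).

(** Write [G-G], [C-G] and [C-C] for the bimodule categories. In high degrees [Ext_{G-G}(G, G)]
    equals [Ext_{G-G}(C, G)] by [ev_stab_bim], then [Ext_{C-G}(C, G)] by scalar extension on the
    left, then [Ext_{C-C}(C, G)] by scalar extension on the right. *)
Theorem HH_nse : exists h, forall n, (h <= n)%N ->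
  lmod_iso (HH n G) (Ext n (bimC C) bimG_restr).
Proof.
have [h1 h1E] := Ext_ev_stab (ev_stab_bim acyclic).
have [h2 h2E] := @Ext_nse _ _ _ _ P _ bimC_left (fpd_nsU acyclic) fpd_nsX_left.
have [h3 h3E] := @Ext_nse _ _ _ _ Pop _ bimC_swap (fpd_nsU (nse_acyclic_op acyclic)) fpd_nsX_right.
exists (maxn h1 (maxn h2 h3)).+1 => -[//|n]; rewrite ltnS !geq_max => /and3P [n1 n2 n3].
apply: lmod_iso_trans (HH_tensor G n) _.
apply: lmod_iso_trans (h1E _ (leqW n1) _) _.
pose q1 : {rmorphism tensor G G^c -> tensor C G^c} := @tmor k G C G^c G^c (pr P) idfun.
set q := (X in restr X _).
(* Inflating both sides of [C] at once agrees with inflating the right side first, as in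
   [bimC_left], and the left side next. *)
have qE (r : tensor G G^c) (x : C) : (q r *: (x : bimC C) : C) = (q1 r *: (x : bimC_left) : C).
  elim/tensor_ind: r => [|r s Er Es|a b].
  - by rewrite !rmorph0 [LHS]scale0r [RHS]scale0r.
  - by rewrite !rmorphD [LHS]scalerDl [RHS]scalerDl Er Es.
  by rewrite /q /q1 /= !tmor_tens bimCE bimC_leftE.
have uL : linear (id : restr q (bimC C) -> restr q1 bimC_left).
  by move=> r u v; congr (_ + _); exact: qE.
have vL : linear (id : restr q1 bimC_left -> restr q (bimC C)).
  by move=> r u v; congr (_ + _); exact/esym/qE.
apply: lmod_iso_trans (@Ext_iso _ _ _ _ (bimG G) n (Lin uL) (Lin vL) _ _) _ => //.
apply: lmod_iso_trans (h2E _ (leqW n2) (bimG G)) _.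
set Y2 := restr _ (bimG G).
(* The coefficients are swapped together with the first argument, so that the next scalar extension
   acts on the factor [G^c]. *)
pose Y3 : lmodType (tensor G^c C) := restr (bq (swap_block G^c C)) Y2.
apply: lmod_iso_trans.
  by apply: (@Ext_block _ _ _ sw Y2 Y3 id) => // y _; exists y.
apply: lmod_iso_trans (h3E _ (leqW n3) Y3) _.
set Y4 := restr _ Y3.
apply: (@Ext_block _ _ _ sw3 Y4 bimG_restr id) => // [s y|y _]; last by exists y.
elim/tensor_ind: s => [|r s Er Es|a b].
- by rewrite [LHS]scale0r linear0 [RHS]scale0r.
- by rewrite [LHS]scalerDl linearD [RHS]scalerDl Er Es.
have -> : bj sw3 (tens a b) = tens b a by exact: tswap_tens.
have -> : (tens a b *: y : bimG_restr) = @tmor k C G C^c G^c (io P) (oppmor (io P)) (tens a b) *: (y : bimG G) by [].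
have -> : (tens b a *: (y : Y4)) = @tmor k C G G^c G^c (io P) idfun
   (@swapmor k G^c C (@tmor k C^c G^c C C (io Pop) idfun (tens b a))) *: (y : bimG G) by [].
by rewrite !tmor_tens swapmor_tens tmor_tens.
Qed.

End Chain.

(** * Products of two algebras *)

Section CornerBlock.
Variables (k : fieldType) (C A : algType k) (p : {lrmorphism C -> A}).
Variable j : {linear A -> C}.
Hypothesis pj : forall a, p (j a) = a.
Hypothesis jM : forall a b, j (a * b) = j a * j b.
Hypothesis jp : forall c, j (p c) = c * j 1.
Hypothesis jp' : forall c, j (p c) = j 1 * c.

Fact oppj_linear : linear ((fun a => j a) : A^c -> C^c).
Proof. exact: (linearP j). Qed.

Let q : {rmorphism tensor C C^c -> tensor A A^c} := @tmor k C A C^c A^c p (oppmor p).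
Let jj : {linear tensor A A^c -> tensor C C^c} := @tmap k A A^c C C^c j (Lin oppj_linear).

Let jjE a b : jj (tens a b) = tens (j a) (j b : C^c).
Proof. exact: (tmap_tens j (Lin oppj_linear)). Qed.

Let jD : {morph jj : s t / s + t} := linearD jj.
Let qD : {morph q : s t / s + t} := rmorphD q.

Fact corner_jM s t : jj (s * t) = jj s * jj t.
Proof.
elim/tensor_ind: s => [|s s' E E'|a b].
- by rewrite mul0r (additive0 jD) mul0r.
- by rewrite mulrDl !jD mulrDl -E -E'.
elim/tensor_ind: t => [|s s' E E'|a' b'].
- by rewrite mulr0 (additive0 jD) mulr0.
- by rewrite mulrDr !jD mulrDr -E -E'.
rewrite !tensM !jjE tensM jM; congr (@tens k C C^c _ _).
exact: jM.
Qed.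

Fact corner_qj s : q (jj s) = s.
Proof.
apply: (tensor_additive_ext (f := fun s => q (jj s)) (g := id)) => // {}s.
  by move=> t; rewrite jD qD.
move=> t; rewrite jjE /q /= tmor_tens pj; congr (@tens k A A^c _ _).
exact: pj.
Qed.

Fact corner_jq r : jj (q r) = r * jj 1.
Proof.
apply: (tensor_additive_ext (f := fun r => jj (q r)) (g := fun r => r * jj 1)) => [s t|s t|c d].
- by rewrite qD jD.
- by rewrite mulrDl.
rewrite /q /= tmor_tens jjE -[1]tens1 jjE tensM jp; congr (@tens k C C^c _ _).
exact: jp'.
Qed.

Fact corner_jq' r : jj (q r) = jj 1 * r.
Proof.
apply: (tensor_additive_ext (f := fun r => jj (q r)) (g := fun r => jj 1 * r)) => [s t|s t|c d].
- by rewrite qD jD.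
- by rewrite mulrDr.
rewrite /q /= tmor_tens jjE -[1]tens1 jjE tensM jp'; congr (@tens k C C^c _ _).
exact: jp.
Qed.

Definition corner_block : block (tensor C C^c) (tensor A A^c) :=
  @Block k _ _ q jj corner_qj corner_jM corner_jq corner_jq'.

Lemma corner_block_q (a : C) (b : C^c) :
  bq corner_block (@tens k C C^c a b) = @tens k A A^c (p a) (p b).
Proof. exact: (@tmor_tens k C A C^c A^c p (oppmor p)). Qed.

(** The right adjoint of inflation cuts the coefficients down to [j(1) G j(1)]. The condition on the
    [y_i] and [x_i] says that each bimodule [C mu_i C] has zero component there, so only [io (j A)]
    remains. *)
Lemma Ext_corner (G : algType k) (I : finType) (P : nse C G I) n :
  (forall i, j 1 * yy P i = 0 \/ xx P i * j 1 = 0) ->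
  lmod_iso (Ext n.+1 (restr (bq corner_block) (bimC A)) (bimG_restr P)) (HH n.+1 A).
Proof.
move=> off.
have YE a b (y : G) : ((tens a b : tensor C C^c) *: (y : bimG_restr P) : G) = io P a * y * io P (b : C).
  have -> : (tens a b : tensor C C^c) *: (y : bimG_restr P) =
    @tmor k C G C^c G^c (io P) (oppmor (io P)) (tens a b) *: (y : bimG G) by [].
  by rewrite tmor_tens bimGE.
apply: lmod_iso_trans (lmod_iso_sym (HH_tensor A n)).
have iM u v : io P (u * v) = io P u * io P v := rmorphM (io P) u v.
pose th (a : bimG A) : bimG_restr P := io P (j a).
have thD : {morph th : a b / a + b} := linearD (io P \o j)%FUN.
apply: (@Ext_block _ _ _ corner_block (bimG_restr P) (bimG A) th thD).
- move=> s a; elim/tensor_ind: s => [|s t Es Et|b c].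
  + by rewrite linear0 !scale0r (additive0 thD).
  + by rewrite linearD !scalerDl thD Es Et.
  rewrite [bj _ _]jjE YE -!iM -!jM; congr (io P (j _)).
  exact: bimGE.
- by move=> a b /(congr1 (pr P)); rewrite !pr_io => /(congr1 p); rewrite !pj.
move=> y; rewrite -[1]tens1 [bj _ _]jjE YE => yE.
exists (p (pr P (y : G))); rewrite /th jp -[RHS]yE.
(* An element fixed by [j(1)] on both sides is expanded in [G]; the terms in [P] then vanish because
   [j(1)] is central in [C] and can be moved next to [y_i] or [x_i]. *)
have {2}-> : (y : G) = io P (pr P (y : G)) + \sum_i nsth P i (rho P i (y : G)).
  exact: nse_expand.
rewrite mulrDr mulrDl -!iM mulr_sumr mulr_suml big1 ?addr0 => [|i _].
  by congr (io P _); rewrite -jp' -[RHS]jp pj jp.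
rewrite /nsth.
have bb := nsth_bilin P i.
elim/tensor_ind: (rho P i y) => [|w w' E E'|c d].
- by rewrite (tlift0 bb) mulr0 mul0r.
- by rewrite (tliftD bb) mulrDr mulrDl E E' addr0.
rewrite (tlift_tens bb) -(mu_yx P i).
have -> : io P (j 1) * (io P c * (io P (yy P i) * mu P i * io P (xx P i)) * io P d) * io P (j 1) =
  io P (j 1 * c * yy P i) * mu P i * io P (xx P i * (d * j 1)) by rewrite !iM !mulrA.
have -> : j 1 * c * yy P i = c * (j 1 * yy P i) by rewrite -jp' jp -mulrA.
have -> : xx P i * (d * j 1) = xx P i * j 1 * d by rewrite -jp jp' mulrA.
have io0 : io P 0 = 0 := linear0 (io P).
have [-> | ->] := off i; first by rewrite mulr0 io0 !mul0r.
by rewrite mul0r io0 mulr0.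
Qed.

End CornerBlock.

Section ProductAlgebra.
Variables (k : fieldType) (A B : algType k).
Local Notation C := (A * B)%type.

Definition jfst (a : A) : C := (a, 0).
Definition jsnd (b : B) : C := (0, b).

Fact jfst_linear : linear jfst.
Proof. by move=> c a a'; congr (_, _); rewrite /= scaler0 addr0. Qed.
Fact jsnd_linear : linear jsnd.
Proof. by move=> c a a'; congr (_, _); rewrite /= scaler0 addr0. Qed.
HB.instance Definition _ := GRing.isLinear.Build k A C *:%R jfst jfst_linear.
HB.instance Definition _ := GRing.isLinear.Build k B C *:%R jsnd jsnd_linear.

Lemma jfstM a a' : jfst (a * a') = jfst a * jfst a'.
Proof. by congr (_, _); rewrite /= mul0r. Qed.
Lemma jsndM a a' : jsnd (a * a') = jsnd a * jsnd a'.
Proof. by congr (_, _); rewrite /= mul0r. Qed.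
Lemma jfst_fst (c : C) : jfst c.1 = c * jfst 1.
Proof. by congr (_, _); rewrite /= ?mulr1 ?mulr0. Qed.
Lemma jfst_fst' (c : C) : jfst c.1 = jfst 1 * c.
Proof. by congr (_, _); rewrite /= ?mul1r ?mul0r. Qed.
Lemma jsnd_snd (c : C) : jsnd c.2 = c * jsnd 1.
Proof. by congr (_, _); rewrite /= ?mulr1 ?mulr0. Qed.
Lemma jsnd_snd' (c : C) : jsnd c.2 = jsnd 1 * c.
Proof. by congr (_, _); rewrite /= ?mul1r ?mul0r. Qed.

Definition blkA : block (tensor C C^c) (tensor A A^c) :=
  @corner_block k C A fst jfst (fun=> erefl) jfstM jfst_fst jfst_fst'.
Definition blkB : block (tensor C C^c) (tensor B B^c) :=
  @corner_block k C B snd jsnd (fun=> erefl) jsndM jsnd_snd jsnd_snd'.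

(** As a bimodule [C] is the sum of the inflated [A] and [B]. No mixed terms arise, since each
    summand only sees its own diagonal block of the coefficients. *)
Lemma Ext_prod (G : algType k) (I : finType) (P : nse C G I) n :
  (forall i, (jfst 1 * yy P i = 0 \/ xx P i * jfst 1 = 0) /\
    (jsnd 1 * yy P i = 0 \/ xx P i * jsnd 1 = 0)) ->
  lmod_iso (Ext n.+1 (bimC C) (bimG_restr P)) (HH n.+1 A * HH n.+1 B)%type.
Proof.
move=> off.
have uL : linear (fun c : bimC C =>
    (c.1, c.2) : (restr (bq blkA) (bimC A) * restr (bq blkB) (bimC B))%type).
  apply: tensor_linear => // a b c.
  rewrite bimCE; congr (_, _).
    have -> : tens a b *: (c.1 : restr (bq blkA) (bimC A)) =
       bq blkA (tens a b) *: (c.1 : bimC A) by [].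
    by rewrite [bq _ _]corner_block_q bimCE.
  have -> : tens a b *: (c.2 : restr (bq blkB) (bimC B)) =
    bq blkB (tens a b) *: (c.2 : bimC B) by [].
  by rewrite [bq _ _]corner_block_q bimCE.
have vL : linear (fun c : (restr (bq blkA) (bimC A) * restr (bq blkB) (bimC B))%type =>
    (c.1, c.2) : bimC C).
  move=> r u v; have /= := uL r (u.1, u.2) (v.1, v.2).
  by move=> e; apply: etrans (esym e) _; exact/esym/surjective_pairing.
apply: lmod_iso_trans (@Ext_iso _ _ _ _ (bimG_restr P) n (Lin uL) (Lin vL) _ _) _ => [[a b]|[a b]|] //.
apply: lmod_iso_trans (Ext_pair n _ _ _) _.
apply: lmod_iso_pair; apply: Ext_corner => i; have [] := off i => // *.
Qed.

End ProductAlgebra.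

(** * The null-square projective algebra *)

Definition lid (R : nzRingType) (e c : R) : lideal e :=
  @mk_submod _ _ (Submod (@lideal0 R e) (@lidealD R e) (@lidealZ R e))
    (c * e) (ex_intro _ c erefl).

Lemma lid_val (R : nzRingType) (e : R) (u : lideal e) : e * e = e -> lid e (val u) = u.
Proof.
move=> ee; apply: val_inj => /=; have [c ->] := submod_ofP u.
by rewrite -mulrA ee.
Qed.

Lemma lideal_valP (k : fieldType) (A : algType k) (e : A) (c : k)
    (u v : restr (GRing.in_alg A) (lideal e)) :
  val (c *: u + v : lideal e) = c *: val (u : lideal e) + val (v : lideal e) :> A.
Proof. by rewrite -[in RHS]mulr_algl. Qed.

(** * Coordinates on a bimodule [A1 f (x) e A2] *)

Section ProjectiveBimodule.
Variables (k : fieldType) (A1 A2 C : algType k) (f : A1) (e : A2).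
Variables (j1 : {linear A1 -> C}) (j2 : {linear A2 -> C}).
Local Notation Q := (projbim f e).
Local Notation Qk := (tensor (restr (GRing.in_alg A1) (lideal f))
  (restr (GRing.in_alg (A2^c : algType k)) (lideal (e : A2^c)))).

Fact pbco_bilin : @bilinear_map k (restr (GRing.in_alg A1) (lideal f))
  (restr (GRing.in_alg (A2^c : algType k)) (lideal (e : A2^c))) (tensor C C)
  (fun u v => tens (j1 (val (u : lideal f))) (j2 (val (v : lideal (e : A2^c)) : A2))).
Proof.
split=> [v c u u'|u c v v'].
  by rewrite lideal_valP linearP tensDl tensZl.
have j2E : j2 (val (c *: v + v' : lideal (e : A2^c)) : A2) =
    c *: j2 (val (v : lideal (e : A2^c)) : A2) + j2 (val (v' : lideal (e : A2^c)) : A2).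
  by rewrite lideal_valP; exact: linearP.
by rewrite j2E tensDr tensZr.
Qed.

(** The map [j1 (x) j2] on [A1 f (x) e A2]. With [j1], [j2] the inclusions of the factors of
    [A * B], it provides the coordinates [rho] of the null-square algebra. *)
Definition pbco (t : Q) : tensor C C := @tlift k (restr (GRing.in_alg A1) (lideal f))
  (restr (GRing.in_alg (A2^c : algType k)) (lideal (e : A2^c))) (tensor C C)
  (fun u v => tens (j1 (val (u : lideal f))) (j2 (val (v : lideal (e : A2^c)) : A2))) t.

Definition pb (u : A1) (v : A2) : Q := etens (lid f u) (lid (e : A2^c) (v : A2^c)).

Hypotheses (ff : f * f = f) (ee : e * e = e).

Lemma pb_ind (P : Q -> Prop) :
  P 0 -> (forall s t, P s -> P t -> P (s + t)) ->
  (forall u v, u * f = u -> e * v = v -> P (pb u v)) -> forall t, P t.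
Proof.
move=> P0 PD Pt; apply: etens_ind => // u v.
rewrite -(lid_val u ff) -(lid_val v ee); apply: Pt.
  by have [c ->] := submod_ofP u; rewrite -mulrA ff.
have [c ->] := submod_ofP v.
have -> : (c * (e : A2^c) : A2^c) = (e * (c : A2)) :> A2 by [].
by rewrite mulrA ee.
Qed.

Lemma pbco_pb u v : pbco (pb u v) = tens (j1 (u * f)) (j2 (e * v)).
Proof. exact: (tlift_tens pbco_bilin). Qed.

Lemma pbcoD s t : pbco (s + t) = pbco s + pbco t.
Proof. exact: (tliftD pbco_bilin). Qed.

Lemma pbco0 : pbco 0 = 0.
Proof. exact: (tlift0 pbco_bilin). Qed.

Lemma lact_pb a u v : lact a (pb u v) = pb (a * u) v.
Proof.
apply: etrans (etensZ a (1 : A2^c) (lid f u) (lid (e : A2^c) (v : A2^c))) _.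
rewrite scale1r; congr etens; apply: val_inj => /=; exact: mulrA.
Qed.

Lemma ract_pb a u v : ract (pb u v) a = pb u (v * a).
Proof.
apply: etrans (etensZ (1 : A1) (a : A2^c) (lid f u) (lid (e : A2^c) (v : A2^c))) _.
rewrite scale1r; congr etens; apply: val_inj => /=.
exact: (mulrA (a : A2^c) (v : A2^c) (e : A2^c)).
Qed.

Lemma pbcoZ c (t : Q) : pbco (tensor_in A1 A2^c c *: t) = c *: pbco t.
Proof.
elim/pb_ind: t => [|s t Es Et|u v _ _]; first by rewrite scaler0 pbco0 scaler0.
  by rewrite scalerDr !pbcoD scalerDr Es Et.
have -> : tensor_in A1 A2^c c *: pb u v = lact (c%:A) (pb u v).
  rewrite /lact; congr (_ *: _).
  exact: (esym (@tensZl k A1 A2^c c 1 1)).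
by rewrite lact_pb !pbco_pb mulr_algl -scalerAl linearZ_LR -tensZl.
Qed.

Lemma pbco_lact (a : A1) (c : C) t : (forall x, j1 (a * x) = c * j1 x) ->
  pbco (lact a t) = (tens c 1 : tensor C C) * pbco t.
Proof.
move=> jc; elim/pb_ind: t => [|s t Es Et|u v _ _].
- by rewrite lact0 pbco0 mulr0.
- by rewrite lactDr !pbcoD mulrDr Es Et.
by rewrite lact_pb !pbco_pb tensM mul1r -mulrA jc.
Qed.

Lemma pbco_ract (a : A2) (c : C) t : (forall x, j2 (x * a) = j2 x * c) ->
  pbco (ract t a) = pbco t * (tens 1 c : tensor C C).
Proof.
move=> jc; elim/pb_ind: t => [|s t Es Et|u v _ _].
- by rewrite ract0 pbco0 mul0r.
- by rewrite ractDl !pbcoD mulrDl Es Et.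
by rewrite ract_pb !pbco_pb tensM mulr1 mulrA jc.
Qed.

End ProjectiveBimodule.

Section NullSquareExtension.
Variables (k : fieldType) (A B : algType k) (IM IN : finType).
Variables (fM : IM -> B) (eM : IM -> A) (eN : IN -> A) (fN : IN -> B).
Hypothesis fM_idem : forall i, fM i * fM i = fM i.
Hypothesis eM_idem : forall i, eM i * eM i = eM i.
Hypothesis eN_idem : forall j, eN j * eN j = eN j.
Hypothesis fN_idem : forall j, fN j * fN j = fN j.
Let M : lmodType (tensor B A^c) := dirsum (fun i => projbim (fM i) (eM i)).
Let N : lmodType (tensor A B^c) := dirsum (fun j => projbim (eN j) (fN j)).
Local Notation L := (nullsq M N).
Local Notation C := (A * B)%type.

Lemma nsq_mulE (x y : L) : x * y =
  ((x.1.1 * y.1.1, lact x.1.1 (y.1.2 : N) + ract (x.1.2 : N) y.2.2),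
   (ract (x.2.1 : M) y.1.1 + lact x.2.2 (y.2.1 : M), x.2.2 * y.2.2)).
Proof. by []. Qed.

Definition nsq_io (c : C) : L := ((c.1, 0), (0, c.2)).
Definition nsq_pr (x : L) : C := (x.1.1, x.2.2).
Definition nsqM (m : M) : L := ((0, 0), (m, 0)).
Definition nsqN (n : N) : L := ((0, n), (0, 0)).

Fact nsq_io_linear : linear nsq_io.
Proof.
move=> c x y; congr ((_, _), (_, _)).
  by rewrite [RHS](addr0 (_ *: _)); exact/esym/scaler0.
by rewrite [RHS](addr0 (_ *: _)); exact/esym/scaler0.
Qed.
Fact nsq_io_monoid : monoid_morphism nsq_io.
Proof.
split=> // x y; rewrite nsq_mulE; congr ((_, _), (_, _)) => /=.
  by rewrite lact0 ract0 addr0.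
by rewrite lact0 ract0 addr0.
Qed.
HB.instance Definition _ := GRing.isLinear.Build k C L *:%R nsq_io nsq_io_linear.
HB.instance Definition _ := GRing.isMonoidMorphism.Build C L nsq_io nsq_io_monoid.

Fact nsq_pr_linear : linear nsq_pr.
Proof. by []. Qed.
Fact nsq_pr_monoid : monoid_morphism nsq_pr.
Proof. by []. Qed.
HB.instance Definition _ := GRing.isLinear.Build k L C *:%R nsq_pr nsq_pr_linear.
HB.instance Definition _ := GRing.isMonoidMorphism.Build L C nsq_pr nsq_pr_monoid.

Lemma nsq_mulM (x : L) m : x * nsqM m = nsqM (lact x.2.2 m).
Proof.
rewrite nsq_mulE; congr ((_, _), (_, _)); rewrite /= ?mulr0 //.
  by rewrite lact0 ract0r addr0.
by rewrite ract0r add0r.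
Qed.

Lemma nsq_Mmul (x : L) m : nsqM m * x = nsqM (ract m x.1.1).
Proof.
rewrite nsq_mulE; congr ((_, _), (_, _)); rewrite /= ?mul0r //.
  by rewrite lact0l ract0 addr0.
by rewrite lact0l addr0.
Qed.

Lemma nsq_mulN (x : L) n : x * nsqN n = nsqN (lact x.1.1 n).
Proof.
rewrite nsq_mulE; congr ((_, _), (_, _)); rewrite /= ?mulr0 //.
  by rewrite ract0r addr0.
by rewrite lact0 ract0r addr0.
Qed.

Lemma nsq_Nmul (x : L) n : nsqN n * x = nsqN (ract n x.2.2).
Proof.
rewrite nsq_mulE; congr ((_, _), (_, _)); rewrite /= ?mul0r //.
  by rewrite lact0l add0r.
by rewrite lact0l ract0 addr0.
Qed.

Definition nsq_mu (i : IM + IN) : L :=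
  match i with
  | inl i => nsqM (dsingle (pb (fM i) (eM i) 1 1))
  | inr j => nsqN (dsingle (pb (eN j) (fN j) 1 1))
  end.
Definition nsq_y (i : IM + IN) : C :=
  match i with inl i => @jsnd k A B (fM i) | inr j => @jfst k A B (eN j) end.
Definition nsq_x (i : IM + IN) : C :=
  match i with inl i => @jfst k A B (eM i) | inr j => @jsnd k A B (fN j) end.
Definition nsq_rho (i : IM + IN) (x : L) : tensor C C :=
  match i with
  | inl i => pbco (@jsnd k A B) (@jfst k A B) ((x.2.1 : M) i)
  | inr j => pbco (@jfst k A B) (@jsnd k A B) ((x.1.2 : N) j)
  end.

Fact nsq_rho_linear i : linear (nsq_rho i).
Proof.
case: i => i c x y.
  rewrite -[RHS]/(c *: pbco _ _ _ + pbco _ _ _) -(pbcoZ (@jsnd k A B) (@jfst k A B) (fM_idem i) (eM_idem i)) -pbcoD.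
  by [].
rewrite -[RHS]/(c *: pbco _ _ _ + pbco _ _ _) -(pbcoZ (@jfst k A B) (@jsnd k A B) (eN_idem i) (fN_idem i)) -pbcoD.
by [].
Qed.

Lemma lact_dsingleM i b (t : projbim (fM i) (eM i)) :
  lact b (dsingle t : M) = dsingle (lact b t).
Proof. exact: (esym (linearZ_LR (Lin (@dsingle_linear _ _ (fun i => projbim (fM i) (eM i)) i)) _ t)). Qed.
Lemma ract_dsingleM i a (t : projbim (fM i) (eM i)) :
  ract (dsingle t : M) a = dsingle (ract t a).
Proof. exact: (esym (linearZ_LR (Lin (@dsingle_linear _ _ (fun i => projbim (fM i) (eM i)) i)) _ t)). Qed.
Lemma lact_dsingleN i b (t : projbim (eN i) (fN i)) :
  lact b (dsingle t : N) = dsingle (lact b t).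
Proof. exact: (esym (linearZ_LR (Lin (@dsingle_linear _ _ (fun i => projbim (eN i) (fN i)) i)) _ t)). Qed.
Lemma ract_dsingleN i a (t : projbim (eN i) (fN i)) :
  ract (dsingle t : N) a = dsingle (ract t a).
Proof. exact: (esym (linearZ_LR (Lin (@dsingle_linear _ _ (fun i => projbim (eN i) (fN i)) i)) _ t)). Qed.

Lemma nsq_genM i c c' :
  nsq_io c * nsq_mu (inl i) * nsq_io c' = nsqM (dsingle (pb (fM i) (eM i) c.2 c'.1)).
Proof.
by rewrite nsq_mulM nsq_Mmul lact_dsingleM ract_dsingleM lact_pb ract_pb /= mulr1 mul1r.
Qed.

Lemma nsq_genN j c c' :
  nsq_io c * nsq_mu (inr j) * nsq_io c' = nsqN (dsingle (pb (eN j) (fN j) c.1 c'.2)).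
Proof.
by rewrite nsq_mulN nsq_Nmul lact_dsingleN ract_dsingleN lact_pb ract_pb /= mulr1 mul1r.
Qed.

Lemma nsqM_D m m' : nsqM (m + m') = nsqM m + nsqM m'.
Proof. by congr ((_, _), (_, _)); rewrite /= addr0. Qed.
Lemma nsqN_D n n' : nsqN (n + n') = nsqN n + nsqN n'.
Proof. by congr ((_, _), (_, _)); rewrite /= addr0. Qed.

Fact nsq_th_bilin i : bilinear_map (fun c c' => nsq_io c * nsq_mu i * nsq_io c').
Proof.
split=> [c a d d'|c a d d'].
  by rewrite linearP !mulrDl -!scalerAl.
by rewrite linearP mulrDr -scalerAr.
Qed.

Lemma nsq_thM i (t : projbim (fM i) (eM i)) :
  tlift (fun c c' => nsq_io c * nsq_mu (inl i) * nsq_io c')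
    (pbco (@jsnd k A B) (@jfst k A B) t) = nsqM (dsingle t).
Proof.
have bb := nsq_th_bilin (inl i).
have sD (s t' : projbim (fM i) (eM i)) : dsingle (s + t') = dsingle s + dsingle t' :=
  linearD (Lin (@dsingle_linear _ _ (fun i => projbim (fM i) (eM i)) i)) s t'.
have s0 := additive0 sD.
elim/(pb_ind (fM_idem i) (eM_idem i)): t => [|s t Es Et|u v uf ev].
- by rewrite pbco0 (tlift0 bb) s0.
- by rewrite pbcoD (tliftD bb) Es Et sD nsqM_D.
by rewrite pbco_pb (tlift_tens bb) nsq_genM uf ev.
Qed.

Lemma nsq_thN i (t : projbim (eN i) (fN i)) :
  tlift (fun c c' => nsq_io c * nsq_mu (inr i) * nsq_io c')
    (pbco (@jfst k A B) (@jsnd k A B) t) = nsqN (dsingle t).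
Proof.
have bb := nsq_th_bilin (inr i).
have sD (s t' : projbim (eN i) (fN i)) : dsingle (s + t') = dsingle s + dsingle t' :=
  linearD (Lin (@dsingle_linear _ _ (fun i => projbim (eN i) (fN i)) i)) s t'.
have s0 := additive0 sD.
elim/(pb_ind (eN_idem i) (fN_idem i)): t => [|s t Es Et|u v uf ev].
- by rewrite pbco0 (tlift0 bb) s0.
- by rewrite pbcoD (tliftD bb) Es Et sD nsqN_D.
by rewrite pbco_pb (tlift_tens bb) nsq_genN uf ev.
Qed.

(** Products of elements of [M] and [N] vanish, so an entry of [g * h] in [M] or [N] has just two
    terms, with one diagonal factor each. *)
Fact nsq_rho_mul i (g h : L) : nsq_rho i (g * h) =
  (tens (nsq_pr g) 1 : tensor C C) * nsq_rho i h +
  nsq_rho i g * (tens 1 (nsq_pr h) : tensor C C).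
Proof.
case: i => i; rewrite /nsq_rho.
  have -> : ((g * h).2.1 : M) i =
    ract ((g.2.1 : M) i) h.1.1 + lact g.2.2 ((h.2.1 : M) i) by [].
  rewrite pbcoD addrC; congr (_ + _).
    apply: (@pbco_lact k B A C _ _ (@jsnd k A B) (@jfst k A B) (fM_idem i) (eM_idem i)) => x.
    by congr (_, _); rewrite /= mulr0.
  apply: (@pbco_ract k B A C _ _ (@jsnd k A B) (@jfst k A B) (fM_idem i) (eM_idem i)) => x.
  by congr (_, _); rewrite /= mul0r.
have -> : ((g * h).1.2 : N) i =
  lact g.1.1 ((h.1.2 : N) i) + ract ((g.1.2 : N) i) h.2.2 by [].
rewrite pbcoD; congr (_ + _).
  apply: (@pbco_lact k A B C _ _ (@jfst k A B) (@jsnd k A B) (eN_idem i) (fN_idem i)) => x.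
  by congr (_, _); rewrite /= mulr0.
apply: (@pbco_ract k A B C _ _ (@jfst k A B) (@jsnd k A B) (eN_idem i) (fN_idem i)) => x.
by congr (_, _); rewrite /= mul0r.
Qed.

Lemma nsq_expand (g : L) : g = nsq_io (nsq_pr g) +
  \sum_i tlift (fun c c' => nsq_io c * nsq_mu i * nsq_io c') (nsq_rho i g).
Proof.
rewrite big_sumType.
rewrite (eq_bigr (fun i => nsqM (dsingle ((g.2.1 : M) i)))); last by move=> i _; exact: nsq_thM.
rewrite [X in _ + (_ + X)](eq_bigr (fun i => nsqN (dsingle ((g.1.2 : N) i)))); last by move=> i _; exact: nsq_thN.
have M0 : nsqM 0 = 0 by [].
have N0 : nsqN 0 = 0 by [].
rewrite -(big_morph nsqM nsqM_D M0) -(big_morph nsqN nsqN_D N0) !dirsum_sumE.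
by case: g => [[a n] [m b]]; congr ((_, _), (_, _)); rewrite /= ?addr0 ?add0r.
Qed.

Lemma nsq_rho_io i c : nsq_rho i (nsq_io c) = 0.
Proof. by case: i => i; rewrite /nsq_rho [X in pbco _ _ X](_ : _ = 0) ?pbco0. Qed.

Lemma nsq_rho_mu i j :
  nsq_rho i (nsq_mu j) = if i == j then tens (nsq_y i) (nsq_x i) else 0.
Proof.
case: i j => i [] j; rewrite /nsq_rho.
- have -> : ((nsq_mu (inl j)).2.1 : M) = dsingle (pb (fM j) (eM j) 1 1) by [].
  have [ij|ne] := eqVneq i j; last first.
    rewrite dsingle_out 1?eq_sym // pbco0; case: eqP => // -[ij].
    by rewrite ij eqxx in ne.
  by subst j; rewrite eqxx dsingle_in pbco_pb mul1r mulr1.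
- by rewrite [X in pbco _ _ X](_ : _ = 0) ?pbco0.
- by rewrite [X in pbco _ _ X](_ : _ = 0) ?pbco0.
have -> : ((nsq_mu (inr j)).1.2 : N) = dsingle (pb (eN j) (fN j) 1 1) by [].
have [ij|ne] := eqVneq i j; last first.
  rewrite dsingle_out 1?eq_sym // pbco0; case: eqP => // -[ij].
  by rewrite ij eqxx in ne.
by subst j; rewrite eqxx dsingle_in pbco_pb mul1r mulr1.
Qed.

Lemma nsq_mu_yx i : nsq_io (nsq_y i) * nsq_mu i * nsq_io (nsq_x i) = nsq_mu i.
Proof.
case: i => i.
  rewrite nsq_genM; congr (nsqM (dsingle _)); congr etens; apply: val_inj => /=.
    by rewrite fM_idem mul1r.
  by rewrite [LHS](eM_idem i) [RHS](mulr1 (eM i)).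
rewrite nsq_genN; congr (nsqN (dsingle _)); congr etens; apply: val_inj => /=.
  by rewrite eN_idem mul1r.
by rewrite [LHS](fN_idem i) [RHS](mulr1 (fN i)).
Qed.

(** Each copy of a summand of [M] or [N] contributes one generator, [f (x) e] or [e (x) f]. For [M]
    the left idempotent lies in [B] and the right one in [A]; for [N] it is the reverse. *)
Definition nullsq_nse : nse (C : algType k) (L : algType k) (IM + IN)%type.
Proof.
refine (@Nse k C L _ nsq_io nsq_pr nsq_mu nsq_y nsq_x
  (fun i => @alg_tensor_lin k L C _ (nsq_rho_linear i))
  _ _ _ _ _ _ _ _ _ _ _).
- by move=> [a b].
- by case.
- exact: nsq_rho_io.
- exact: nsq_rho_mu.
- exact: nsq_rho_mul.
- by case=> i; congr (_, _); rewrite /= ?mulr0 ?fM_idem ?eN_idem.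
- by case=> i; congr (_, _); rewrite /= ?mulr0 ?eM_idem ?fN_idem.
- exact: nsq_mu_yx.
- by move=> g [] i; rewrite /nsq_mu ?nsq_mulM ?nsq_mulN.
- by move=> [] i g; rewrite /nsq_mu ?nsq_Mmul ?nsq_Nmul.
exact: nsq_expand.
Defined.

End NullSquareExtension.

(** * The Peirce quiver *)

Section Quiver.
Variables (k : fieldType) (A B : algType k) (E : {fset A}) (F : {fset B}).
Variables (hE : is_system E) (hF : is_system F) (m : F -> E -> nat) (n : E -> F -> nat).
Local Notation IM := {fe : F * E & 'I_(m fe.1 fe.2)}.
Local Notation IN := {ef : E * F & 'I_(n ef.1 ef.2)}.

Let idemE (e : E) : val e * val e = val e. Proof. by have [+ _ _] := hE; exact. Qed.
Let idemF (f : F) : val f * val f = val f. Proof. by have [+ _ _] := hF; exact. Qed.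

Definition projbim_nse : nse ((A * B)%type : algType k)
    (nullsq (projbim_sum m) (projbim_sum n) : algType k) (IM + IN)%type :=
  @nullsq_nse k A B IM IN (fun i => val (tag i).1) (fun i => val (tag i).2)
    (fun j => val (tag j).1) (fun j => val (tag j).2)
    (fun i => idemF (tag i).1) (fun i => idemE (tag i).2)
    (fun j => idemE (tag j).1) (fun j => idemF (tag j).2).

(** A generator is viewed as a vertical arrow from its right idempotent to its left one. *)
Definition gsrc (i : IM + IN) : E + F :=
  match i with inl i => inl (tag i).2 | inr j => inr (tag j).2 end.
Definition gtgt (i : IM + IN) : E + F :=
  match i with inl i => inr (tag i).1 | inr j => inl (tag j).1 end.

Lemma arrow_gen i : arrow m n (gsrc i) (gtgt i).
Proof.
case: i => -[[x y] [a lt_a]] /= e.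
  by rewrite /= e in lt_a.
by rewrite /= e in lt_a.
Qed.

(** Since [A] and [B] annihilate each other in [A * B], a nonzero [x_j C y_i] forces the end of [i]
    and the start of [j] to lie in the same system; they are then equal or joined by a Peirce
    arrow. *)
Lemma nse_rel_arrow i j : nse_rel projbim_nse i j ->
  gtgt i = gsrc j \/ arrow m n (gtgt i) (gsrc j) /\ (in_QE (gtgt i) (gsrc j) \/ in_QF (gtgt i) (gsrc j)).
Proof.
move=> /asboolP [[a b] H]; case: i j H => i [] j H; rewrite /gtgt /gsrc.
- by case: H; congr (_, _); rewrite /= ?mulr0 ?mul0r.
- have [->|ne] := eqVneq (tag i).1 (tag j).2; [by left | right; split; last by right].
  split; first exact/eqP.
  by exists b => e; apply: H; congr (_, _); rewrite /= ?mulr0 ?e.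
- have [->|ne] := eqVneq (tag i).1 (tag j).2; [by left | right; split; last by left].
  split; first exact/eqP.
  by exists a => e; apply: H; congr (_, _); rewrite /= ?mulr0 ?e.
by case: H; congr (_, _); rewrite /= ?mulr0 ?mul0r.
Qed.

(** Each step to a generator [j] contributes at most one horizontal arrow followed by the vertical
    arrow of [j], so horizontal arrows are always separated. Starting at [gtgt i] makes a closed
    walk of generators give a closed path, and the bound on the size makes its length positive. *)
Lemma path_efficient i p : path (nse_rel projbim_nse) i p ->
  exists w, [/\ efficient_path m n (gtgt i) w, last (gtgt i) w = gtgt (last i p) &
    (size p <= size w)%N].
Proof.
elim: p i => [|j p IH] i /=; first by exists [::].
move=> /andP [rij /IH [w [[wp wn] wl ws]]].
(* A vertical arrow lies in neither [Q_E] nor [Q_F], so no pair of arrows containing it violates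
   efficiency. *)
have [vE vF] : ~ in_QE (gsrc j) (gtgt j) /\ ~ in_QF (gsrc j) (gtgt j) by case: j {rij wp wn wl ws IH} => j; split.
have tail : no_two_successive (gsrc j) (gtgt j :: w).
  by case: w wn {wp wl ws} => [|z w] wn //=; split=> // -[] => [/vE|/vF].
have [eij|[aij _]] := nse_rel_arrow rij.
  exists (gtgt j :: w); split=> //=.
  by rewrite eij; split=> //; split=> //; exact: arrow_gen.
exists (gsrc j :: gtgt j :: w); split=> //=; last by rewrite ltnW.
split; first by split=> //; split=> //; exact: arrow_gen.
by split=> // -[_] => [/vE|/vF].
Qed.

Lemma projbim_acyclic : (forall x p, ~ efficient_cycle m n x p) ->
  forall i j, nse_rel projbim_nse i j -> ~~ connect (nse_rel projbim_nse) j i.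
Proof.
move=> noc i j rij; apply/negP => /connectP [p pp pl].
have [|w [we wl ws]] := @path_efficient i (j :: p); first by rewrite /= rij.
apply: (noc (gtgt i) w); split=> //; first exact: leq_trans ws.
by rewrite wl /= -pl.
Qed.

End Quiver.

Unset Implicit Arguments.

Theorem theorem8p4 (k : fieldType) (A B : algType k)
    (E : {fset A}) (F : {fset B}) (hE : is_system E) (hF : is_system F)
    (m : F -> E -> nat) (n : E -> F -> nat) :
  let M : lmodType (tensor B A^c) := projbim_sum m in
  let N : lmodType (tensor A B^c) := projbim_sum n in
  let Lambda : algType k := nullsq M N in
  (forall x p, ~ efficient_cycle m n x p) ->
  exists h : nat, (0 < h)%N /\
    forall i : nat, (h <= i)%N ->
      lmod_iso (HH i Lambda) (HH i A * HH i B)%type.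
Proof.
move=> M N Lambda noc.
have [h hE'] := HH_nse (@projbim_acyclic k A B E F hE hF m n noc).
(* The successor makes the bound positive and excludes degree 0, as [Ext_prod] requires. *)
exists h.+1; split=> // -[//|i] hi.
apply: lmod_iso_trans (hE' _ (ltnW hi)) _.
(* [M] and [N] are off-diagonal: for a generator of [M] the unit of [A] kills [y_j] and the unit of
   [B] kills [x_j], and for [N] the roles are exchanged. *)
apply: Ext_prod => -[] j; split.
- by left; congr (_, _); rewrite /= ?mul0r ?mulr0.
- by right; congr (_, _); rewrite /= ?mul0r ?mulr0.
- by right; congr (_, _); rewrite /= ?mul0r ?mulr0.
by left; congr (_, _); rewrite /= ?mul0r ?mulr0.
Qed.
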